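(* Let $\Phi$ be a root system with positive system $\Phi^+$ and Weyl group $W$, and let $L_{\Phi^+}(W)$ be its punctured Weyl group. If $\Phi$ is irreducible, then $\deg(L_{\Phi^+}(W))$ is given according to the type of $\Phi$ as follows: $\lfloor (n+1)^2/4\rfloor$ for $A_n$ ($n\ge1$); $\binom n2+1$ for $B_n/C_n$ ($n\ge2$); $\binom n2$ for $D_n$ ($n\ge4$); $16$ for $E_6$; $27$ for $E_7$; $36$ for $E_8$; $6$ for $F_4$; $2$ for $G_2$; $2$ for $I_2(m)$; $5$ for $H_3$; $8$ for $H_4$. If $\Phi$ decomposes as an orthogonal union of root systems $\Phi_i$, then the degree of $L_{\Phi^+}(W)$ is the sum of the degrees of the $L_{\Phi_i^+}(W_i)$, where $W_i$ is the corresponding direct factor of $W$ (and $\Phi_i^+=\Phi^+\cap\Phi_i$).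
   Context: A root system $\Phi$ in a finite-dimensional real Euclidean space $V$ is a finite spanning set of nonzero vectors such that for every $\alpha\in\Phi$: $\mathbb{R}\alpha\cap\Phi=\{\alpha,-\alpha\}$, and $s_\alpha(\Phi)=\Phi$, where $s_\alpha(v)=v-\frac{2(v,\alpha)}{(\alpha,\alpha)}\alpha$ (so $\Phi$ need not be crystallographic). The Weyl group $W$ is the group generated by all $s_\alpha$, $\alpha\in\Phi$. $\Phi$ is irreducible if it is not the orthogonal union of two or more root systems. A positive system $\Phi^+$ is the set of elements of $\Phi$ that are positive for some total ordering of $V$ compatible with addition and scalar multiplication. Let $\Upsilon$ be the category with objects $[n]=\{0,\dots,n\}$, $n\ge0$, and all functions as morphisms. A symmetric set is a functor $X\colon\Upsilon^{\mathrm{op}}\to\mathsf{Set}$, $X_n=X([n])$; restricting to order-preserving maps gives its underlying simplicial set with faces $d_i$. For a group $G$, $BG$ is the nerve of $G$, a symmetric set with $BG_n=G^n$, elements written $[g_1|\cdots|g_n]$, representing the string of composable morphisms with $g_1$ applied first (so inner faces multiply $g_{i+1}g_i$). The punctured Weyl group $L_{\Phi^+}(W)$ is the symmetric subset of $BW$ whose $n$-simplices are those $[w_1|\cdots|w_n]$ for which there is $\alpha\in\Phi^+$ with $w_iw_{i-1}\cdots w_1(\alpha)\in\Phi^+$ for all $1\le i\le n$. Degree: $I\subset[n]$ is gapped if distinct elements of $I$ differ by at least $2$. For $k\ge1$, a simplicial set $X$ is lower $(2k-1)$-Segal if for every $n$ and every gapped $I\subset[n]$ of cardinality $k+1$, the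 cube $J\mapsto X_{[n]\setminus J}$ ($J\subseteq I$) is a limit diagram; i.e., for every family $(x_i)_{i\in I}$ in $X_{n-1}$ with $d_ix_j=d_{j-1}x_i$ for all $i<j$ in $I$, there is a unique $x\in X_n$ with $d_ix=x_i$ for all $i\in I$. A symmetric set is lower $(2k-1)$-Segal if its underlying simplicial set is. $\deg(X)$ is the least $k\ge1$ such that $X$ is lower $(2k-1)$-Segal, and $\infty$ if there is none. *)

(* Defs.v *)
From HB Require Import structures.
From mathcomp Require Import all_boot all_order all_algebra all_fingroup.
From mathcomp Require Import sesquilinear finmap.
From mathcomp Require Import boolp classical_sets reals constructive_ereal.

Set Implicit Arguments.
Unset Strict Implicit.
Unset Printing Implicit Defensive.

Import Order.TTheory GRing.Theory Num.Theory.
Local Open Scope ring_scope.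

Record symset := SymSet {
  simplex :> nat -> Type;
  smap : forall m n : nat,
    ('I_m.+1 -> 'I_n.+1) -> simplex n -> simplex m;
  smap_id : forall n (x : simplex n), smap id x = x;
  smap_comp : forall l m n (f : 'I_l.+1 -> 'I_m.+1) (g : 'I_m.+1 -> 'I_n.+1)
    (x : simplex n), smap (g \o f) x = smap f (smap g x)
}.

Definition face (X : symset) n (i : 'I_n.+2) : X n.+1 -> X n :=
  smap (fun j : 'I_n.+1 => lift i j).

Definition gapped n (I : {set 'I_n}) : bool :=
  [forall i in I, forall j in I, (i < j)%N ==> (i.+2 <= j)%N].

(* A gapped subset of [n] with at least two elements forces 2 <= n, so only the
   objects [m.+2] occur; then i < j in [m.+2] gives i, j.-1 in [m.+1] and the
   two [inord]s below are exact. *)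
Definition lower_segal (k : nat) (X : symset) : Prop :=
  forall (m : nat) (I : {set 'I_m.+3}), gapped I -> #|I| = k.+1 ->
  forall x : {i : 'I_m.+3 | i \in I} -> X m.+1,
  (forall i j : {i : 'I_m.+3 | i \in I}, (val i < val j)%N ->
     face (inord (val i)) (x j) = face (inord (val j).-1) (x i)) ->
  exists! y : X m.+2, forall i, face (val i) y = x i.

(* [lower_segal k] is the lower (2k-1)-Segal condition. *)
Definition degree (X : symset) : \bar nat :=
  match pselect (exists k, (0 < k)%N && `[< lower_segal k X >]) with
  | left ex_k => (ex_minn ex_k)%:E
  | right _ => +oo%E
  end.

Section SymmetricSubset.
Variables (X : symset) (P : forall n, X n -> Prop).
Hypothesis Pmap : forall m n (f : 'I_m.+1 -> 'I_n.+1) (x : X n),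
  P x -> P (smap f x).

Definition sub_smap m n (f : 'I_m.+1 -> 'I_n.+1) (x : {x : X n | P x}) :
  {x : X m | P x} := exist _ (smap f (sval x)) (Pmap f (svalP x)).

Fact sub_smap_id n (x : {x : X n | P x}) : sub_smap id x = x.
Proof. by case: x => x Px; apply: eq_exist; rewrite smap_id. Qed.

Fact sub_smap_comp l m n (f : 'I_l.+1 -> 'I_m.+1) (g : 'I_m.+1 -> 'I_n.+1)
  (x : {x : X n | P x}) : sub_smap (g \o f) x = sub_smap f (sub_smap g x).
Proof. by apply: eq_exist; rewrite smap_comp. Qed.

Definition sub_symset : symset := SymSet sub_smap_id sub_smap_comp.
End SymmetricSubset.

Section Nerve.
Variable G : groupType.
Local Open Scope group_scope.

(* [walk g k] is g_(k-1) * ... * g_0, the composite of the first k morphisms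
   of the string g. *)
Fixpoint walk n (g : 'I_n -> G) (k : nat) : G :=
  if k is k'.+1 then oapp g 1 (insub k') * walk g k' else 1.

Definition nerve_smap m n (f : 'I_m.+1 -> 'I_n.+1) (g : {ffun 'I_n -> G}) :
  {ffun 'I_m -> G} :=
  [ffun i : 'I_m =>
     walk g (f (lift ord0 i)) * (walk g (f (widen_ord (leqnSn m) i)))^-1].

Lemma walkS n (g : 'I_n -> G) (i : 'I_n) : walk g i.+1 = g i * walk g i.
Proof. by rewrite /= valK. Qed.

Lemma walk_smap m n (f : 'I_m.+1 -> 'I_n.+1) (g : {ffun 'I_n -> G})
  (j : 'I_m.+1) :
  walk (nerve_smap f g) j = walk g (f j) * (walk g (f ord0))^-1.
Proof.
case: j => j; elim: j => [|j IHj] lt_jm.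
  rewrite (_ : Ordinal lt_jm = ord0) ?mulgV //; exact: val_inj.
have lt_jm' : (j < m)%N by [].
have -> : nat_of_ord (Ordinal lt_jm) = (Ordinal lt_jm').+1 by [].
rewrite walkS ffunE (IHj (ltnW lt_jm)).
rewrite (_ : widen_ord _ _ = Ordinal (ltnW lt_jm)); last exact: val_inj.
rewrite (_ : lift _ _ = Ordinal lt_jm); last exact: val_inj.
by rewrite mulgA mulgKV.
Qed.

Fact nerve_smap_id n (g : {ffun 'I_n -> G}) : nerve_smap id g = g.
Proof.
apply/ffunP => i; rewrite ffunE.
by rewrite [nat_of_ord (lift _ _)]/= /bump add1n walkS mulgK.
Qed.

Fact nerve_smap_comp l m n (f : 'I_l.+1 -> 'I_m.+1) (h : 'I_m.+1 -> 'I_n.+1)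
  (g : {ffun 'I_n -> G}) :
  nerve_smap (h \o f) g = nerve_smap f (nerve_smap h g).
Proof.
by apply/ffunP => i; rewrite !ffunE !walk_smap /= invgM invgK mulgA mulgKV.
Qed.

Definition nerve : symset :=
  @SymSet (fun n => {ffun 'I_n -> G}) _ nerve_smap_id nerve_smap_comp.
End Nerve.

Section Generated.
Variable G : groupType.
Local Open Scope group_scope.

Inductive generated (S : set G) : G -> Prop :=
| generated_mem x : S x -> generated S x
| generated1 : generated S 1
| generatedM x y : generated S x -> generated S y -> generated S (x * y)
| generatedV x : generated S x -> generated S x^-1.

Definition gen_pred (S : set G) : pred G := fun x => `[< generated S x >].

Fact gen_group_closed S : group_closed (gen_pred S).
Proof.
split; first by apply/asboolP; exact: generated1.
move=> x y /asboolP gx /asboolP gy; apply/asboolP.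
by apply: generatedM => //; exact: generatedV.
Qed.

Definition gen_group (S : set G) := {x : G | x \in gen_pred S}.

HB.instance Definition _ S := SubChoice.on (gen_group S).
HB.instance Definition _ S :=
  SubChoice_isSubGroup.Build G (gen_pred S) (gen_group S) (gen_group_closed S).
End Generated.

Section GeneralLinear.
Variables (R : realType) (V : vectType R).

Definition GL_pred : pred 'End(V) := fun f => lker f == 0%VS.
Definition GL := {f : 'End(V) | GL_pred f}.
HB.instance Definition _ := SubChoice.on GL.

Fact GL_mul_subproof (f g : GL) : GL_pred (val f \o val g)%VF.
Proof.
apply/lker0P => u v; rewrite !comp_lfunE.
by move/(lker0P (valP f))/(lker0P (valP g)).
Qed.

Fact GL_inv_subproof (f : GL) : GL_pred (val f)^-1%VF.
Proof.
apply/lker0P => u v /(congr1 (val f)).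
by rewrite !(lker0_lfunVK (valP f)).
Qed.

Fact GL_one_subproof : GL_pred \1%VF.
Proof. by apply/lker0P => u v; rewrite !id_lfunE. Qed.

Definition GL_mul (f g : GL) : GL :=
  exist (fun h => GL_pred h) _ (GL_mul_subproof f g).
Definition GL_inv (f : GL) : GL :=
  exist (fun h => GL_pred h) _ (GL_inv_subproof f).
Definition GL_one : GL := exist (fun h => GL_pred h) _ GL_one_subproof.

Fact GL_mulA : associative GL_mul.
Proof. by move=> f g h; apply: val_inj; rewrite /= comp_lfunA. Qed.
Fact GL_mul1 : left_id GL_one GL_mul.
Proof. by move=> f; apply: val_inj; rewrite /= comp_lfun1l. Qed.
Fact GL_mulr1 : right_id GL_one GL_mul.
Proof. by move=> f; apply: val_inj; rewrite /= comp_lfun1r. Qed.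
Fact GL_mulV : left_inverse GL_one GL_inv GL_mul.
Proof. by move=> f; apply: val_inj; rewrite /= (lker0_compVf (valP f)). Qed.
Fact GL_mulrV : right_inverse GL_one GL_inv GL_mul.
Proof. by move=> f; apply: val_inj; rewrite /= (lker0_compfV (valP f)). Qed.

HB.instance Definition _ :=
  isGroup.Build GL GL_mulA GL_mul1 GL_mulr1 GL_mulV GL_mulrV.
End GeneralLinear.

Section RootSystems.
Variables (R : realType) (V : vectType R) (dot : {dot V for idfun}).
Implicit Types (a b u v : V) (Phi Pos : {fset V}).

(* For a = 0 the convention x / 0 = 0 makes [refl 0] the identity, so that the
   lemmas below need no hypothesis on a. *)
Definition refl a v : V := v - (2 * dot v a / dot a a) *: a.

Fact refl_is_linear a : linear (refl a).
Proof.
move=> c u v; rewrite /refl.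
have -> : dot (c *: u + v) a = c * dot u a + dot v a by rewrite linearPl.
rewrite mulrDr mulrDl scalerDl scalerBr scalerA opprD addrACA.
by congr (_ - _ *: _ + _); rewrite !mulrA [2 * c]mulrC.
Qed.
HB.instance Definition _ a := GRing.isLinear.Build R V V _ (refl a)
  (refl_is_linear a).

Fact reflK a : involutive (refl a).
Proof.
move=> v; have [->|a0] := eqVneq a 0; first by rewrite /refl !scaler0 !subr0.
have aa0 : dot a a != 0 by rewrite gt_eqF // neq0_dnorm_gt0.
set c := 2 * dot v a / dot a a.
have -> : refl a v = v - c *: a by [].
rewrite /refl linearBl linearZl_LR /= mulrBr mulrBl -/c.
have -> : 2 * (c * dot a a) / dot a a = c + c.
  by rewrite mulrA mulfK // mulr_natl mulr2n.
by rewrite opprD addrA subrr sub0r scaleNr opprK subrK.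
Qed.

Fact refl_subproof a : GL_pred (linfun (refl a)).
Proof. by apply/lker0P => u v; rewrite !lfunE; exact: (inv_inj (reflK a)). Qed.

Definition reflGL a : GL V := exist (fun h => GL_pred h) _ (refl_subproof a).

Definition weyl Phi : groupType :=
  gen_group [set g | exists2 a, a \in Phi & g = reflGL a].

Definition weyl_act Phi (w : weyl Phi) (v : V) : V := val (val w) v.

Fact weyl_actM Phi (w w' : weyl Phi) v :
  weyl_act (w * w')%g v = weyl_act w (weyl_act w' v).
Proof. by rewrite /weyl_act /= comp_lfunE. Qed.

Record root_system (U : {vspace V}) Phi : Prop := RootSystem {
  root_span : <<Phi>>%VS = U;
  root_neq0 : 0 \notin Phi;
  root_line : forall a, a \in Phi ->
    forall b, (b \in Phi /\ b \in <[a]>%VS) <-> (b = a \/ b = - a);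
  root_refl : forall a, a \in Phi -> [fset refl a b | b in Phi]%fset = Phi
}.

(* The components are required to be nonempty: the empty set is a root system
   in the zero space and could otherwise be added to any decomposition. *)
Record orthogonal_union r (Phi_ : 'I_r -> {fset V}) Phi : Prop :=
  OrthogonalUnion {
  ounion_root : forall i, root_system <<Phi_ i>>%VS (Phi_ i);
  ounion_neq0 : forall i, Phi_ i != fset0;
  ounion_orth : forall i j, i != j ->
    forall a b, a \in Phi_ i -> b \in Phi_ j -> dot a b = 0;
  ounion_cover : forall a, a \in Phi <-> exists i, a \in Phi_ i
}.

Definition irreducible Phi : Prop :=
  ~ exists r (Phi_ : 'I_r -> {fset V}), (1 < r)%N /\ orthogonal_union Phi_ Phi.

Record vector_order (le : rel V) : Prop := VectorOrder {
  vo_anti : antisymmetric le;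
  vo_trans : transitive le;
  vo_total : total le;
  vo_add : forall u v w, le u v -> le (u + w) (v + w);
  vo_scale : forall (c : R) u v, 0 <= c -> le u v -> le (c *: u) (c *: v)
}.

Definition positive_system Phi Pos : Prop :=
  exists2 le : rel V, vector_order le &
    forall a, (a \in Pos) = [&& a \in Phi, a != 0 & le 0 a].

Definition punctured Phi Pos n (w : {ffun 'I_n -> weyl Phi}) : Prop :=
  exists2 a, a \in Pos &
    forall i : nat, (1 <= i <= n)%N -> weyl_act (walk w i) a \in Pos.

Fact punctured_smap Phi Pos m n (f : 'I_m.+1 -> 'I_n.+1)
  (w : nerve (weyl Phi) n) :
  punctured Pos w -> punctured Pos (smap f w).
Proof.
case=> a Pa Pw.
have {Pw} Pw (j : 'I_n.+1) : weyl_act (walk w j) a \in Pos.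
  case: j => -[|j] lt_jn; first by rewrite /weyl_act /= id_lfunE.
  exact: Pw.
exists (weyl_act (walk w (f ord0)) a) => [//|i /andP[_ le_im]].
have /= -> := walk_smap f w (Ordinal (le_im : (i < m.+1)%N)).
by rewrite -weyl_actM mulgKV; exact: Pw.
Qed.

Definition punctured_weyl Phi Pos : symset :=
  sub_symset (@punctured_smap Phi Pos).

Definition simple_system Phi n (D : n.-tuple V) : Prop :=
  [/\ {subset D <= Phi}, basis_of fullv D &
      forall a, a \in Phi ->
        (forall i, 0 <= coord D i a) \/ (forall i, coord D i a <= 0)].

Definition has_order (g : GL V) (m : nat) : Prop :=
  [/\ (0 < m)%N, (g ^+ m = 1)%g &
      forall k, (0 < k < m)%N -> (g ^+ k <> 1)%g].

End RootSystems.

Inductive coxeter_type :=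
| TypeA of nat | TypeBC of nat | TypeD of nat
| TypeE6 | TypeE7 | TypeE8 | TypeF4 | TypeG2
| TypeI2 of nat | TypeH3 | TypeH4.

Definition type_valid (t : coxeter_type) : bool :=
  match t with
  | TypeA n => 1 <= n
  | TypeBC n => 2 <= n
  | TypeD n => 4 <= n
  | TypeI2 m => 3 <= m
  | _ => true
  end%N.

Definition type_rank (t : coxeter_type) : nat :=
  match t with
  | TypeA n | TypeBC n | TypeD n => n
  | TypeE6 => 6 | TypeE7 => 7 | TypeE8 => 8
  | TypeF4 | TypeH4 => 4 | TypeH3 => 3
  | TypeG2 | TypeI2 _ => 2
  end%N.

(* The entry m_ij (i < j) of the Coxeter matrix. The nodes 0, 1, ... are
   numbered along a path, except that in types D and E the last node n-1 is
   attached to the node n-3 (type D_n), resp. to node 2 (type E_n), of the path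
   0, ..., n-2. *)
Definition coxeter_entry (t : coxeter_type) (i j : nat) : nat :=
  (match t with
  | TypeA n => if j == i.+1 then 3 else 2
  | TypeBC n => if j == i.+1 then if j == n.-1 then 4 else 3 else 2
  | TypeD n =>
      if (j == i.+1) && (j < n.-1) || (i == n - 3) && (j == n.-1)
      then 3 else 2
  | TypeE6 | TypeE7 | TypeE8 =>
      if (j == i.+1) && (j < (type_rank t).-1)
         || (i == 2) && (j == (type_rank t).-1)
      then 3 else 2
  | TypeF4 => if j == i.+1 then if i == 1 then 4 else 3 else 2
  | TypeG2 => 6
  | TypeI2 m => m
  | TypeH3 | TypeH4 => if j == i.+1 then if i == 0 then 5 else 3 else 2
  end)%N.

Definition type_degree (t : coxeter_type) : nat :=
  match t with
  | TypeA n => (n.+1 ^ 2) %/ 4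
  | TypeBC n => 'C(n, 2) + 1
  | TypeD n => 'C(n, 2)
  | TypeE6 => 16 | TypeE7 => 27 | TypeE8 => 36
  | TypeF4 => 6 | TypeG2 => 2 | TypeI2 _ => 2
  | TypeH3 => 5 | TypeH4 => 8
  end%N.

(* Since roots of a non-crystallographic system have no canonical lengths, the
   type is read off the Coxeter matrix of a simple system; B_n and C_n share
   it. *)
Definition has_type (R : realType) (V : vectType R) (dot : {dot V for idfun})
    (Phi : {fset V}) (t : coxeter_type) : Prop :=
  exists2 D : (type_rank t).-tuple V, simple_system Phi D &
    forall i j : 'I_(type_rank t), (i < j)%N ->
      has_order (reflGL dot (tnth D i) * reflGL dot (tnth D j))%g
        (coxeter_entry t i j).

(* Main.v *)
From Stdlib Require Import ZArith.
From HB Require Import structures.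
From mathcomp Require Import all_boot all_order all_algebra all_fingroup.
From mathcomp Require Import sesquilinear finmap.
From mathcomp Require Import boolp classical_sets reals constructive_ereal.
From mathcomp Require Import ring lra zify ssrZ.
Require Import Defs.

Set Implicit Arguments.
Unset Strict Implicit.
Unset Printing Implicit Defensive.

Import Order.TTheory GRing.Theory Num.Theory.
Local Open Scope ring_scope.

(** Simplices of the nerve of a group are configurations of points, so the lower
    Segal condition on the punctured Weyl group is a Helly property of positive
    systems: it holds in degree [k] as soon as every family of positive systems, in
    which removing any one of [k + 1] chosen members leaves a common root, has a
    common root ([lower_segal_helly]). The Weyl group is transitive on positive
    systems ([weyl_transitive]), so these are the sets of roots on the positive side
    of generic linear functionals. Their intersections play the part of convex
    sets, and as in the theorems of Hoffman and Doignon the Helly number is the largest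
    size of a free set, that is, of a set of roots [D] on which some functional is
    positive and from which, for every root [b], some functional that is negative on
    [b] is positive on the other elements ([helly_convex_free], [degree_max]). The
    hard half of this takes a critical family of half-spaces, enlarges its members
    as much as possible and reads off a free set from the roots that they could
    gain next ([critical_free]).

    Free sets of an orthogonal union are unions of free sets of its components, so
    degrees add up ([degree_union]). For an irreducible type, the orders of products of
    simple reflections determine the angles between the simple roots and hence,
    after rescaling, a frame with known Gram matrix that generates all rays of
    roots ([simple_frame]). It remains to maximise the size of a free set.
    Upper bounds use mainly that two elements of a free set never span a cone
    containing a third root. In particular they form no obtuse angle.

    In type A a root is an arrow from one of [n + 1] points to another, and no head
    of an arrow in a free set is the tail of another one, so there are at most
    [p q] arrows with [p + q <= n + 1]. In types B and D the roots lie on vectors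
    [e i], [- e i] and [+- e i +- e j], and a free set has at most one element per
    pair [i, j] and one short element in type B, while type D needs a discharging
    argument ([size_signed_pairs]). In rank two only two elements of a free set fit
    into a half-plane.

    For the exceptional types the roots are listed in coordinates with entries in
    [Z + Z phi], [phi] the golden ratio, and free sets are bounded by exhaustive
    search. Shifting in the manner of Erdos, Ko and Rado reduces type E to sets closed
    upwards ([shifted_bound]). Types F4 and H3 are searches for cliques
    ([clique_bound]), and so is type H4 after a normalisation by the Weyl group and
    the exclusion of one configuration of four roots ([pattern_free], [H4_bound]).
    The free sets of largest size are certified by explicit functionals
    ([certified_free]). *)

(** * Inner products and reflections *)

Section Euclidean.
Variables (R : realType) (V : vectType R) (dot : {dot V for idfun}).
Implicit Types (a b u v : V) (Phi Pos : {fset V}).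

Lemma dotC u v : dot u v = dot v u.
Proof. by rewrite hermC /= expr0 mul1r. Qed.
Lemma dotDl u v w : dot (u + v) w = dot u w + dot v w.
Proof. exact: linearDl. Qed.
Lemma dotDr u v w : dot w (u + v) = dot w u + dot w v.
Proof. exact: linearDr. Qed.
Lemma dotNl u w : dot (- u) w = - dot u w.
Proof. exact: linearNl. Qed.
Lemma dotNr u w : dot w (- u) = - dot w u.
Proof. exact: linearNr. Qed.
Lemma dotBl u v w : dot (u - v) w = dot u w - dot v w.
Proof. by rewrite dotDl dotNl. Qed.
Lemma dotBr u v w : dot w (u - v) = dot w u - dot w v.
Proof. by rewrite dotDr dotNr. Qed.
Lemma dotZl c u w : dot (c *: u) w = c * dot u w.
Proof. exact: linearZl_LR. Qed.
Lemma dotZr c u w : dot w (c *: u) = c * dot w u.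
Proof. by rewrite dotC dotZl dotC. Qed.
Lemma dot0l u : dot 0 u = 0.
Proof. exact: linear0l. Qed.
Lemma dot0r u : dot u 0 = 0.
Proof. exact: linear0r. Qed.
Lemma dot_suml I (r : seq I) (P : pred I) (F : I -> V) w :
  dot (\sum_(i <- r | P i) F i) w = \sum_(i <- r | P i) dot (F i) w.
Proof. by apply: (big_morph (dot^~ w)) => [x y|]; rewrite ?dotDl ?dot0l. Qed.
Lemma dot_sumr I (r : seq I) (P : pred I) (F : I -> V) w :
  dot w (\sum_(i <- r | P i) F i) = \sum_(i <- r | P i) dot w (F i).
Proof. by rewrite dotC dot_suml; apply: eq_bigr => i _; rewrite dotC. Qed.
Definition dotE := (dotDl, dotDr, dotNl, dotNr, dotZl, dotZr).

Lemma dot_gt0 u : (0 < dot u u) = (u != 0).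
Proof.
by apply/idP/idP => [|/(@neq0_dnorm_gt0 _ _ _ dot)//]; apply: contraTneq => ->; rewrite dot0l ltxx.
Qed.

Lemma reflE a v : refl dot a v = v - (2 * dot v a / dot a a) *: a.
Proof. by []. Qed.

Lemma refl_dot a u v : dot (refl dot a u) (refl dot a v) = dot u v.
Proof.
have [->|a0] := eqVneq a 0; first by rewrite /refl !scaler0 !subr0.
have aa0 : dot a a != 0 by rewrite gt_eqF ?dot_gt0.
rewrite /refl !dotE (dotC a v); field.
exact: aa0.
Qed.

Lemma refl_self a : refl dot a a = - a.
Proof.
have [->|a0] := eqVneq a 0; first by rewrite /refl scaler0 subr0 oppr0.
have aa0 : dot a a != 0 by rewrite gt_eqF ?dot_gt0.
by rewrite /refl mulfK // scaler_nat mulr2n opprD addrA subrr add0r.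
Qed.

Lemma reflZ c a v : c != 0 -> refl dot (c *: a) v = refl dot a v.
Proof.
move=> c0; have [->|a0] := eqVneq a 0; first by rewrite scaler0.
have aa0 : dot a a != 0 by rewrite gt_eqF ?dot_gt0.
rewrite /refl scalerA !dotE; congr (_ - _ *: _); field.
by rewrite c0 aa0.
Qed.

Lemma dot_refl a u v : dot (refl dot a u) v = dot u (refl dot a v).
Proof. by rewrite -{1}(reflK dot a v) refl_dot. Qed.

(** * Perturbing functionals *)

Lemma small_shift (s : seq V) u v : exists2 e : R, 0 < e &
  forall x, x \in s -> (0 < dot u x -> 0 < dot (u + e *: v) x) /\
                       (dot u x < 0 -> dot (u + e *: v) x < 0).
Proof.
suff [e e0 He] : exists2 e : R, 0 < e &
    forall x, x \in s -> dot u x != 0 -> e * `|dot v x| < `|dot u x|.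
  exists e => // x xs; have H := He x xs; rewrite !dotE.
  have := ler_norm (dot v x); have := ler_norm (- dot v x); rewrite normrN.
  move=> le1 le2; split=> ux; move: H.
    by rewrite (gt_eqF ux) (gtr0_norm ux) => /(_ isT); nra.
  by rewrite (lt_eqF ux) (ltr0_norm ux) => /(_ isT); nra.
elim: s => [|x s [e e0 IH]]; first by exists 1.
have [ux0|ux0] := eqVneq (dot u x) 0.
  exists e => // y; rewrite inE => /orP[/eqP-> | /IH //]; by rewrite ux0 eqxx.
have ux : 0 < `|dot u x| by rewrite normr_gt0.
have vx : 0 <= `|dot v x| by rewrite normr_ge0.
pose d := `|dot u x| / (`|dot v x| + 1).
have d0 : 0 < d by rewrite divr_gt0 // ltr_pwDr.
exists (Num.min e d); first by rewrite lt_min e0.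
move=> y; rewrite inE => /orP[/eqP-> _ | /IH{}IH /IH{}IH].
  apply: (@le_lt_trans _ _ (d * `|dot v x|)).
    by rewrite ler_wpM2r // ge_min lexx orbT.
  rewrite /d mulrAC ltr_pdivrMr ?ltr_pwDr // ltr_pM2l //; lra.
apply: le_lt_trans IH; rewrite ler_wpM2r // ?normr_ge0 // ge_min lexx //.
Qed.

Lemma perturb (s t : seq V) u : 0 \notin s ->
  exists u', (forall x, x \in s -> dot u' x != 0) /\
    forall x, x \in t -> (0 < dot u x -> 0 < dot u' x) /\
                       (dot u x < 0 -> dot u' x < 0).
Proof.
elim: s => [_|v s IH]; first by exists u.
rewrite inE negb_or eq_sym => /andP[v0 /IH[u1 [u1s u1t]]].
have [u1v|u1v] := eqVneq (dot u1 v) 0; last first.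
  by exists u1; split=> // x; rewrite inE => /orP[/eqP->|/u1s].
have [e e0 He] := small_shift (s ++ t) u1 v.
exists (u1 + e *: v); split=> x.
  rewrite inE => /orP[/eqP->|xs].
    by rewrite !dotE u1v add0r mulf_neq0 ?gt_eqF ?dot_gt0.
  have := u1s x xs; rewrite neq_lt => /orP[ux|ux].
    by have [|_ /(_ ux)] := He x; rewrite ?mem_cat ?xs // => H; rewrite lt_eqF.
  by have [|/(_ ux) H _] := He x; rewrite ?mem_cat ?xs // gt_eqF.
move=> xt; have [|H1 H2] := He x; first by rewrite mem_cat xt orbT.
by have [H3 H4] := u1t x xt; split=> [/H3|/H4].
Qed.

(** * Reflection groups and positive systems *)

Section Weyl.
Variable Phi : {fset V}.
Local Notation W := (weyl dot Phi).

Lemma weyl_act1 v : weyl_act (1%g : W) v = v.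
Proof. by rewrite /weyl_act /= id_lfunE. Qed.

Lemma weyl_actK (w : W) : cancel (weyl_act w) (weyl_act w^-1%g).
Proof. by move=> v; rewrite -weyl_actM mulVg weyl_act1. Qed.

Lemma weyl_actKV (w : W) : cancel (weyl_act w^-1%g) (weyl_act w).
Proof. by move=> v; rewrite -weyl_actM mulgV weyl_act1. Qed.

Lemma weyl_actZD (w : W) c u v :
  weyl_act w (c *: u + v) = c *: weyl_act w u + weyl_act w v.
Proof. exact: linearP. Qed.

HB.instance Definition _ (w : W) := GRing.isLinear.Build R V V _ (weyl_act w)
  (weyl_actZD w).

Lemma weyl_act_ind (P : V -> V -> Prop) :
  (forall v, P v v) ->
  (forall a u v, a \in Phi -> P u v -> P u (refl dot a v)) ->
  (forall u v, P u v -> P v u) ->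
  (forall u v w, P u v -> P v w -> P u w) ->
  forall (w : W) v, P v (weyl_act w v).
Proof.
move=> P1 PR PS PT [g /= gW] v; rewrite /weyl_act /=.
have {gW} : generated [set g | exists2 a, a \in Phi & g = reflGL dot a]%classic g.
  exact/asboolP.
move=> gW; elim: gW v => {g} [_ [a aPhi ->] v||x y _ IHx _ IHy v|x _ IH v].
- by rewrite /= lfunE; apply: PR.
- by move=> v; rewrite /= id_lfunE.
- by rewrite /= comp_lfunE; apply: PT (IHy v) (IHx _).
apply: PS; have := IH (val (x^-1)%g v).
by rewrite /= (lker0_lfunVK (valP x)).
Qed.

Lemma weyl_dot (w : W) u v : dot (weyl_act w u) (weyl_act w v) = dot u v.
Proof.
rewrite /weyl_act; case: w => g /= gW.
have {gW} : generated [set g | exists2 a, a \in Phi & g = reflGL dot a]%classic g.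
  exact/asboolP.
move=> gW; elim: gW u v => {g} [_ [a aPhi ->] u v||x y _ IHx _ IHy u v|x _ IH u v].
- by rewrite /= !lfunE refl_dot.
- by move=> u v; rewrite /= !id_lfunE.
- by rewrite /= !comp_lfunE IHx.
by rewrite -IH /= !(lker0_lfunVK (valP x)).
Qed.

Definition refl_weyl a (aPhi : a \in Phi) : W :=
  exist _ (reflGL dot a) (asboolT (generated_mem (ex_intro2 _ _ a aPhi erefl))).

Lemma refl_weylE a (aPhi : a \in Phi) v : weyl_act (refl_weyl aPhi) v = refl dot a v.
Proof. by rewrite /weyl_act /= lfunE. Qed.

Variables (U : {vspace V}) (Phi_root : root_system dot U Phi).

Lemma root_refl_mem a b : a \in Phi -> b \in Phi -> refl dot a b \in Phi.
Proof.
by move=> aP bP; rewrite -(root_refl Phi_root aP); apply/imfsetP; exists b.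
Qed.

Lemma root_opp a : a \in Phi -> - a \in Phi.
Proof. by move=> aP; rewrite -refl_self root_refl_mem. Qed.

Lemma root_n0 a : a \in Phi -> a != 0.
Proof. by apply: contraTneq => ->; exact: root_neq0 Phi_root. Qed.

Lemma root_dot_gt0 a : a \in Phi -> 0 < dot a a.
Proof. by move=> /root_n0; rewrite dot_gt0. Qed.

Lemma root_prop a b (c : R) : a \in Phi -> b \in Phi -> b = c *: a -> b = a \/ b = - a.
Proof.
move=> aP bP bE; apply/(root_line Phi_root aP b); split=> //.
by apply/vlineP; exists c.
Qed.

Lemma root_propp a b (c : R) : a \in Phi -> b \in Phi -> 0 < c -> b = c *: a -> b = a.
Proof.
move=> aP bP c0 bE; have [//|bN] := root_prop aP bP bE.
have a0 := root_n0 aP; have : (c + 1) *: a = 0.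
  by rewrite scalerDl scale1r -bE bN addNr.
by move/eqP; rewrite scaler_eq0 (negPf a0) orbF gt_eqF // addr_gt0.
Qed.

Lemma weyl_root (w : W) a : a \in Phi -> weyl_act w a \in Phi.
Proof.
suff: (a \in Phi) = (weyl_act w a \in Phi) by move=> ->.
apply: (@weyl_act_ind (fun u v => (u \in Phi) = (v \in Phi))) => //.
- move=> b u v bP ->; apply/idP/idP => [|H]; first exact: root_refl_mem.
  by rewrite -(reflK dot b v) root_refl_mem.
- by move=> u v w' -> ->.
Qed.

Lemma weyl_rootE (w : W) a : (weyl_act w a \in Phi) = (a \in Phi).
Proof.
apply/idP/idP => [|/(weyl_root w)//].
by move/(weyl_root w^-1%g); rewrite weyl_actK.
Qed.

Lemma big_refl (P : pred V) (F : V -> R) b : b \in Phi ->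
  \sum_(a <- Phi | P a) F a =
  \sum_(a <- Phi | P (refl dot b a)) F (refl dot b a).
Proof.
move=> bP; have pE : perm_eq [seq refl dot b a | a <- Phi] Phi.
  apply: uniq_perm; rewrite ?fset_uniq ?map_inj_uniq ?fset_uniq //.
    exact: (inv_inj (reflK dot b)).
  move=> x; apply/mapP/idP => [[y yP ->]|xP].
    exact: root_refl_mem.
  by exists (refl dot b x); rewrite ?reflK ?root_refl_mem.
by rewrite -(perm_big _ pE) /= big_map.
Qed.

(** Pairing [a] with its mirror image under the reflection in [b] cancels every
    [a] for which both are positive; the other summands are those that the
    reflection makes negative, and these are acute to [b]. *)
Lemma half_sum_gt0 (P : pred V) :
  (forall u v, P u -> P v -> P (u + v)) ->
  (forall (c : R) v, 0 < c -> P v -> P (c *: v)) ->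
  (forall v, P v -> ~~ P (- v)) ->
  forall b, b \in Phi -> P b -> 0 < dot (\sum_(a <- Phi | P a) a) b.
Proof.
move=> PD PZ PN b bP Pb; rewrite dot_suml.
rewrite (bigID (fun a => P (refl dot b a))) /=.
have -> : \sum_(a <- Phi | P a && P (refl dot b a)) dot a b = 0.
  set s := LHS; suff : s = - s by move=> /eqP; rewrite -addr_eq0 -mulr2n mulrn_eq0 => /eqP.
  rewrite {1}/s (@big_refl _ (fun a => dot a b) b) // /s -sumrN.
  apply: eq_big => a; first by rewrite reflK andbC.
  by move=> _; rewrite dot_refl refl_self dotNr.
rewrite add0r (big_rem b) //= Pb refl_self PN //=.
rewrite ltr_pwDl ?root_dot_gt0 // sumr_ge0 // => a /andP[Pa nPa].
rewrite leNgt; apply: contra nPa => ab; rewrite reflE -scaleNr.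
apply: PD => //; apply: PZ => //.
by rewrite oppr_gt0 pmulr_llt0 ?invr_gt0 ?root_dot_gt0 // pmulr_rlt0.
Qed.

Section PositiveSystem.
Variables (Pos : {fset V}) (hPos : positive_system Phi Pos).

Definition rho : V := \sum_(a <- Pos) a.

Lemma pos_cone : exists P : pred V,
  [/\ forall u v, P u -> P v -> P (u + v),
      forall (c : R) v, 0 < c -> P v -> P (c *: v),
      forall v, P v -> ~~ P (- v),
      forall v, v != 0 -> P v || P (- v) &
      forall a, (a \in Pos) = (a \in Phi) && P a].
Proof.
case: hPos => le [anti trans tot addl scal] PosE.
exists (fun v => (v != 0) && le 0 v).
have le0N v : le 0 v -> le (- v) 0.
  by move=> /(addl _ _ (- v)); rewrite add0r subrr.
have leN0 v : le v 0 -> le 0 (- v).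
  by move=> /(addl _ _ (- v)); rewrite add0r subrr.
split=> [u v /andP[u0 lu] /andP[v0 lv]|c v c0 /andP[v0 lv]|v /andP[v0 lv]|v v0|a].
- have luv : le u (u + v) by have := addl _ _ u lv; rewrite add0r addrC.
  rewrite (trans _ _ _ lu luv) andbT; apply: contraNneq u0 => uv0.
  by apply/eqP/anti; rewrite lu -[X in le u X]uv0 luv.
- by rewrite scaler_eq0 negb_or gt_eqF //= v0 /= -(scaler0 V c) scal // ltW.
- rewrite negb_and oppr_eq0 negbK; apply/orP; right; apply: contraNN v0 => lNv.
  by apply/eqP/anti; rewrite lv andbT; have := le0N _ lNv; rewrite opprK.
- rewrite v0 oppr_eq0 v0 /=; case/orP: (tot 0 v) => [->//|/leN0 ->].
  by rewrite orbT.
- by rewrite PosE.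
Qed.

Lemma rho_gt0 a : a \in Phi -> (0 < dot rho a) = (a \in Pos).
Proof.
have [P [PD PZ PN PT PosE]] := pos_cone.
have rhoE : rho = \sum_(a <- Phi | P a) a.
  rewrite /rho -[RHS]big_filter; apply: perm_big; apply: uniq_perm.
  - exact: fset_uniq.
  - by rewrite filter_uniq ?fset_uniq.
  - by move=> x; rewrite mem_filter PosE andbC.
have H := half_sum_gt0 PD PZ PN.
move=> aP; rewrite PosE aP /=; have [Pa|nPa] := boolP (P a).
  by rewrite rhoE H.
have PNa : P (- a) by have := PT a (root_n0 aP); rewrite (negPf nPa).
by have := H _ (root_opp aP) PNa; rewrite -rhoE dotNr oppr_gt0 => /lt_geF/negbT; rewrite -ltNge => ?; apply/negbTE; rewrite -leNgt ltW.
Qed.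

Lemma rho_neq0 a : a \in Phi -> dot rho a != 0.
Proof.
move=> aP; have [P [PD PZ PN PT PosE]] := pos_cone.
have := PT a (root_n0 aP) => /orP[Pa|Pa].
  by rewrite gt_eqF // rho_gt0 // PosE aP.
by rewrite -oppr_eq0 -dotNr gt_eqF // rho_gt0 ?root_opp // PosE root_opp.
Qed.

(** The Weyl group is transitive on positive systems: if [v] maximises the value
    of [u] at [weyl_act v rho], no reflection can increase that value, so
    [weyl_act v rho] and [u] lie on the same side of every root hyperplane. *)
Lemma weyl_transitive u : (forall a, a \in Phi -> dot u a != 0) ->
  exists w : W, forall a, a \in Phi -> (weyl_act w a \in Pos) = (0 < dot u a).
Proof.
move=> u_gen.
pose S (v : W) : {set Phi} := [set a : Phi | weyl_act v^-1%g (val a) \in Pos].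
pose val_ (A : {set Phi}) : R := \sum_(a in A) dot u (val a).
have PosP a : a \in Pos -> a \in Phi.
  by have [P [_ _ _ _ PosE]] := pos_cone; rewrite PosE => /andP[].
have SE (v : W) : val_ (S v) = dot u (weyl_act v rho).
  rewrite /val_ /rho linear_sum dot_sumr -big_enum /=.
  rewrite -(big_map (fun a : Phi => val a) predT (dot u)).
  rewrite -(big_map (weyl_act v) predT (dot u)); apply: perm_big.
  apply: uniq_perm.
  - by rewrite map_inj_uniq ?enum_uniq //; exact: val_inj.
  - by rewrite map_inj_uniq ?fset_uniq //; exact: can_inj (weyl_actK v).
  move=> x; apply/mapP/mapP => [[a]|[a aP ->]].
    rewrite mem_enum inE => aP ->.
    by exists (weyl_act v^-1%g (val a)); rewrite ?weyl_actKV.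
  have vaP : weyl_act v a \in Phi by rewrite weyl_root ?PosP.
  by exists [` vaP]%fset => //; rewrite mem_enum inE /= weyl_actK.
pose orbit A := `[< exists v : W, A = S v >].
have orbit1 : orbit (S 1%g) by apply/asboolP; exists 1%g.
case: (arg_maxP val_ orbit1) => A /asboolP[v ->] vmax; exists v^-1%g => a aP.
have va : weyl_act v^-1%g a \in Phi by rewrite weyl_root.
rewrite -rho_gt0 //; have -> : dot rho (weyl_act v^-1%g a) = dot (weyl_act v rho) a.
  by rewrite -[LHS](weyl_dot v) weyl_actKV.
have : val_ (S (refl_weyl aP * v)%g) <= val_ (S v).
  by apply: vmax; apply/asboolP; exists (refl_weyl aP * v)%g.
rewrite !SE weyl_actM refl_weylE reflE dotBr dotZr gerBl.
have: dot (weyl_act v rho) a != 0.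
  by rewrite -[X in dot _ X](weyl_actKV v) weyl_dot rho_neq0 // weyl_root.
move: (dot _ a) (u_gen a aP) (root_dot_gt0 aP) => x u0 aa0 x0.
rewrite mulrAC pmulr_lge0 ?invr_gt0 // -mulrA pmulr_rge0 ?ltr0n //.
move: u0 x0; rewrite !neq_lt => /orP[] u0 /orP[] x0; rewrite ?u0 ?x0 ?(lt_gtF u0) ?(lt_gtF x0) //; nra.
Qed.
End PositiveSystem.
End Weyl.
End Euclidean.

(** * Simplices of a nerve as configurations of points *)

Section Edges.
Variable G : groupType.
Local Open Scope group_scope.

Definition edge n (g : {ffun 'I_n -> G}) (a b : 'I_n.+1) : G :=
  walk g b * (walk g a)^-1.

Lemma edge_smap m n (f : 'I_m.+1 -> 'I_n.+1) (g : nerve G n) a b :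
  edge (smap f g : nerve G m) a b = edge g (f a) (f b).
Proof. by rewrite /edge /= !walk_smap invgM invgK mulgA mulgKV. Qed.

Lemma edge_face n (i : 'I_n.+2) (g : nerve G n.+1) a b :
  edge (face i g : nerve G n) a b = edge g (lift i a) (lift i b).
Proof. exact: edge_smap. Qed.

Lemma edge_inj n (g h : {ffun 'I_n -> G}) : edge g =2 edge h -> g = h.
Proof.
move=> gh; apply/ffunP => i; have := gh (widen_ord (leqnSn n) i) (lift ord0 i).
by rewrite /edge [nat_of_ord (lift _ _)]/= /bump add1n !walkS !mulgK.
Qed.

Lemma edgeM n (g : {ffun 'I_n -> G}) a b c :
  edge g c b * (edge g c a)^-1 = edge g a b.
Proof. by rewrite /edge invgM invgK mulgA mulgKV. Qed.

Definition of_points n (p : 'I_n.+1 -> G) : {ffun 'I_n -> G} :=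
  [ffun i => p (lift ord0 i) * (p (widen_ord (leqnSn n) i))^-1].

Lemma edge_of_points n (p : 'I_n.+1 -> G) a b :
  edge (of_points p) a b = p b * (p a)^-1.
Proof.
have walkE (j : 'I_n.+1) : walk (of_points p) j = p j * (p ord0)^-1.
  case: j => j; elim: j => [|j IHj] lt_jn.
    by rewrite (_ : Ordinal lt_jn = ord0) ?mulgV //; exact: val_inj.
  have lt_jn' : (j < n)%N by [].
  have -> : nat_of_ord (Ordinal lt_jn) = (Ordinal lt_jn').+1 by [].
  rewrite walkS ffunE (IHj (ltnW lt_jn)).
  rewrite (_ : widen_ord _ _ = Ordinal (ltnW lt_jn)); last exact: val_inj.
  rewrite (_ : lift _ _ = Ordinal lt_jn); last exact: val_inj.
  by rewrite mulgA mulgKV.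
by rewrite /edge !walkE invgM invgK mulgA mulgKV.
Qed.

Lemma gapped_compl n (I : {set 'I_n}) : gapped I -> (1 < #|I|)%N ->
  exists c, c \notin I.
Proof.
move=> /forall_inP gI /card_gt1P[i [j [iI jI]]].
wlog ij : i j iI jI / (i < j)%N => [H ne|_].
  have := ne; rewrite -val_eqE neq_ltn => /orP[] ij; first exact: (H i j).
  by apply: (H j i); rewrite // eq_sym.
have lt_i1 : (i.+1 < n)%N by exact: leq_ltn_trans ij (ltn_ord j).
exists (Ordinal lt_i1); apply/negP => i1I.
by have /forall_inP/(_ _ i1I) := gI i iI; rewrite /= ltnSn ltnn.
Qed.

(** The faces opposite to two vertices other than [c] contain between them all
    the edges out of [c], and these determine a simplex. *)
Lemma faces_inj m (I : {set 'I_m.+3}) (g h : nerve G m.+2) :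
  gapped I -> (1 < #|I|)%N ->
  (forall i, i \in I -> face i g = face i h) -> g = h.
Proof.
move=> gI I2 gh; have [c cI] := gapped_compl gI I2.
suff gcE a : edge g c a = edge h c a.
  by apply: edge_inj => a b; rewrite -(edgeM g a b c) -(edgeM h a b c) !gcE.
have [i /setD1P[ia iI]] : exists i, i \in I :\ a.
  apply/card_gt0P; move: I2; rewrite (cardsD1 a I).
    by case: (a \in I) => // /ltnW.
have ic : i != c by apply: contraNneq cI => <-.
have [a' aE _] := unlift_some ia; have [c' cE _] := unlift_some ic.
by rewrite aE cE -!edge_face gh.
Qed.

Lemma lift_lift m (i j : 'I_m.+3) (a : 'I_m.+1) : (i < j)%N ->
  lift j (lift (inord i : 'I_m.+2) a) = lift i (lift (inord j.-1 : 'I_m.+2) a).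
Proof.
move=> ij; have jm := ltn_ord j.
have im : (i < m.+2)%N by lia.
have jm' : (j.-1 < m.+2)%N by lia.
by apply: val_inj; rewrite /= !inordK // /bump; lia.
Qed.

Lemma lift_lift_surj m (i j a : 'I_m.+3) : (i < j)%N -> i != a -> j != a ->
  exists b : 'I_m.+1, a = lift j (lift (inord i : 'I_m.+2) b).
Proof.
move=> ij ia ja; have [b aE _] := unlift_some ja.
have ib : inord i != b :> 'I_m.+2.
  apply: contraNneq ia => ib; apply/eqP/val_inj; rewrite aE /= -ib.
  by have := ltn_ord j => jm; rewrite inordK /bump; lia.
by have [b' bE _] := unlift_some ib; exists b'; rewrite -bE.
Qed.
End Edges.

Section SegalHelly.
Variables (R : realType) (V : vectType R) (dot : {dot V for idfun}).
Variables (Phi Pos : {fset V}).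
Local Notation W := (weyl dot Phi).
Local Notation L := (punctured_weyl dot Phi Pos).

Lemma punctured_points n (g : {ffun 'I_n -> W}) (p : 'I_n.+1 -> W) :
  (forall a b, edge g a b = p b * (p a)^-1)%g ->
  punctured Pos g <-> exists x, forall j, weyl_act (p j) x \in Pos.
Proof.
move=> gE; have walkE j : walk g (j : 'I_n.+1) = (p j * (p ord0)^-1)%g.
  by rewrite -gE /edge /= invg1 mulg1.
split=> [[a aPos ga]|[x px]].
  exists (weyl_act (p ord0)^-1%g a) => j; rewrite -weyl_actM -walkE.
  case: j => -[|j] lt_jn; first by rewrite weyl_act1.
  exact: ga.
exists (weyl_act (p ord0) x) => [//|i /andP[_ le_in]].
by have /= -> := walkE (Ordinal (le_in : (i < n.+1)%N)); rewrite -weyl_actM mulgKV.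
Qed.

(** In terms of points, a simplex of the punctured Weyl group is a family of
    positive systems with a common root. *)
Definition helly (k : nat) : Prop :=
  forall (m : nat) (I : {set 'I_m.+3}), gapped I -> #|I| = k.+1 ->
  forall p : 'I_m.+3 -> W,
  (forall i, i \in I -> exists x, forall j, i != j -> weyl_act (p j) x \in Pos) ->
  exists x, forall j, weyl_act (p j) x \in Pos.

Lemma lower_segal_helly k : (0 < k)%N -> lower_segal k L <-> helly k.
Proof.
move=> k0; split=> [segal m I gI cI p pI|hel m I gI cI x xC].
  have I2 : (1 < #|I|)%N by rewrite cI.
  pose y : nerve W m.+2 := of_points p.
  have yI (i : {i : 'I_m.+3 | i \in I}) : punctured Pos (face (val i) y : nerve W m.+1).
    apply/(punctured_points (p := fun a => p (lift (val i) a))) => [a b|].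
      by rewrite edge_face edge_of_points.
    by have [x xi] := pI _ (valP i); exists x => j; apply: xi; exact: neq_lift.
  pose xs (i : {i : 'I_m.+3 | i \in I}) : L m.+1 := exist _ _ (yI i).
  have xC (i j : {i : 'I_m.+3 | i \in I}) : (val i < val j)%N ->
      face (inord (val i)) (xs j) = face (inord (val j).-1) (xs i).
    move=> ij; apply: eq_exist => /=; apply: edge_inj => a b.
    by rewrite !edge_smap; congr edge; exact: lift_lift.
  have [[z zP] /= [zx _]] := segal m I gI cI xs xC.
  have zy : z = y.
    apply: faces_inj gI I2 _ => i iI.
    by have /(congr1 sval) := zx (exist _ i iI).
  apply/(punctured_points (g := y)) => [a b|]; first exact: edge_of_points.
  by rewrite -zy.
have I2 : (1 < #|I|)%N by rewrite cI.
have [c cNI] := gapped_compl gI I2.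
pose unl (i a : 'I_m.+3) : 'I_m.+2 := odflt ord0 (unlift i a).
have unlK i a : i != a -> lift i (unl i a) = a.
  by move=> ia; rewrite /unl; have [b aE ->] := unlift_some ia; rewrite /= -aE.
have liftK' i a : unl i (lift i a) = a by rewrite /unl liftK.
pose e (i : {i : 'I_m.+3 | i \in I}) a b := edge (sval (x i)) (unl (val i) a) (unl (val i) b).
have eC i j a b : val i != a -> val i != b -> val j != a -> val j != b ->
    e i a b = e j a b.
  wlog ij : i j / (val i < val j)%N => [H ia ib ja jb|].
    have [ij|ij|ij] := ltngtP (val i) (val j); first exact: H.
      by rewrite -(H j i).
    by congr e; apply/val_inj/val_inj.
  move=> ia ib ja jb; have [a' aE] := lift_lift_surj ij ia ja.
  have [b' bE] := lift_lift_surj ij ib jb.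
  rewrite /e aE bE !liftK' lift_lift // (lift_lift b') // !liftK' -!edge_face.
  by have /(congr1 sval) /= -> := xC i j ij.
have other a : exists i : {i : 'I_m.+3 | i \in I}, val i != a.
  have [i /setD1P[ia iI]] : exists i, i \in I :\ a.
    apply/card_gt0P; move: I2; rewrite (cardsD1 a I).
    by case: (a \in I) => // /ltnW.
  by exists (exist _ i iI).
have [h hE] := boolp.choice other.
have cN (i : {i : 'I_m.+3 | i \in I}) : val i != c.
  by apply: contraNneq cNI => <-; exact: valP.
pose p a : W := e (h a) c a.
have pE i a : val i != a -> p a = e i c a.
  by move=> ia; apply: eC; rewrite ?cN ?hE.
pose y : nerve W m.+2 := of_points p.
have yx i : face (val i) y = sval (x i).
  apply: edge_inj => a b; rewrite edge_face edge_of_points !(pE i) ?neq_lift //.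
  by rewrite /e !liftK' edgeM.
have yP : punctured Pos y.
  apply/(punctured_points (p := p)) => [a b|]; first exact: edge_of_points.
  apply: (hel m I gI cI) => i iI.
  have := svalP (x (exist _ i iI)); rewrite -yx.
  move/(punctured_points (p := fun a => p (lift i a))) => [a b|z zP].
    by rewrite edge_face edge_of_points.
  by exists z => j ij; rewrite -(unlK _ _ ij).
exists (exist _ y yP); split=> [i|[z zP] zx].
  by move: (yx i); case: (x i) => xi xiP /= yxi; apply: eq_exist.
apply: eq_exist; apply: faces_inj gI I2 _ => i iI.
by rewrite (yx (exist _ i iI)) -(zx (exist _ i iI)).
Qed.
End SegalHelly.

(** * Convexly free sets of roots *)

Section ConvexFree.
Variables (R : realType) (V : vectType R) (dot : {dot V for idfun}).
Implicit Types (a b u v : V) (Phi Pos D : {fset V}).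

(** The intersections of positive systems play the part of convex sets; [D] is free
    when [D] and all its subsets are such intersections. *)
Definition convex_free Phi D : Prop :=
  [/\ {subset D <= Phi},
      exists u, forall a, a \in D -> 0 < dot u a &
      forall b, b \in Phi -> exists2 u, dot u b < 0 &
        forall a, a \in D -> a != b -> 0 < dot u a].

Lemma convex_freeS Phi D D' :
  {subset D' <= D} -> convex_free Phi D -> convex_free Phi D'.
Proof.
move=> sD [DP [u uD] Db]; split=> [a /sD/DP //||b /Db[v vb vD]].
  by exists u => a /sD/uD.
by exists v => // a /sD/vD.
Qed.

Section Slide.
Variables (U : {vspace V}) (Phi : {fset V}) (Phi_root : root_system dot U Phi).
Variables (Q : {fset V}) (uQ : V).
Hypothesis QPhi : {subset Q <= Phi}.
Hypothesis uQ_gt0 : forall a, a \in Q -> 0 < dot uQ a.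

Definition generic u : Prop :=
  (forall a, a \in Q -> dot u a != 0) /\
  forall a b, a \in Q -> b \in Q -> a != b ->
    dot u a / dot uQ a != dot u b / dot uQ b.

Lemma make_generic u : (forall a, a \in Q -> dot u a != 0) ->
  exists2 u', generic u' & forall a, a \in Q -> (0 < dot u' a) = (0 < dot u a).
Proof.
move=> u0.
pose s := [seq dot uQ p.2 *: p.1 - dot uQ p.1 *: p.2 |
            p <- [seq p <- [seq (a, b) | a <- Q, b <- Q] | p.1 != p.2]].
have s0 : 0 \notin s.
  apply/mapP => -[[a b]]; rewrite mem_filter /= => /andP[ab /allpairsP[[a' b'] /= [aQ bQ [? ?]]]].
  subst a' b' => /esym/eqP; rewrite subr_eq0 => /eqP E.
  have bE : b = (dot uQ b / dot uQ a) *: a.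
    by rewrite mulrC -scalerA E scalerA mulVf ?scale1r // gt_eqF ?uQ_gt0.
  have : b = a by apply: (root_propp Phi_root) bE; rewrite ?QPhi // divr_gt0 ?uQ_gt0.
  by move=> ba; rewrite ba eqxx in ab.
have [u' [u's u't]] := perturb dot Q u s0.
have sgn a : a \in Q -> (0 < dot u' a) = (0 < dot u a) /\ dot u' a != 0.
  move=> aQ; have [H1 H2] := u't a aQ; have := u0 a aQ.
  rewrite neq_lt => /orP[ua|ua].
    by have H := H2 ua; rewrite (lt_gtF H) (lt_gtF ua) (lt_eqF H).
  by have H := H1 ua; rewrite H ua (gt_eqF H).
exists u' => [|a /sgn[]//]; split=> [a /sgn[]//|a b aQ bQ ab].
have : dot u' (dot uQ b *: a - dot uQ a *: b) != 0.
  apply: u's; apply/mapP; exists (a, b) => //.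
  rewrite mem_filter ab /=; apply/allpairsP; by exists (a, b).
rewrite dotBr !dotZr subr_eq0; apply: contraNneq => E.
have [ua ub] := (uQ_gt0 aQ, uQ_gt0 bQ).
have -> : dot u' a = dot u' b / dot uQ b * dot uQ a by rewrite -E divfK ?gt_eqF.
by apply/eqP; field; rewrite gt_eqF.
Qed.

(** Rotating [u] towards [uQ] makes the roots on its negative side cross over
    one at a time, since the ratios [dot u a / dot uQ a] are distinct. *)
Lemma gain_one u : generic u -> (exists2 b, b \in Q & dot u b < 0) ->
  exists u' x, [/\ generic u', x \in Q, dot u x < 0 &
    forall a, a \in Q -> (0 < dot u' a) = (0 < dot u a) || (a == x)].
Proof.
move=> [u0 u_ratio] [b bQ ub].
pose r a := dot u a / dot uQ a.
pose P (a : Q) := dot u (val a) < 0.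
have Pb : P [` bQ]%fset by [].
case: (arg_maxP (fun a : Q => r (val a)) Pb) => -[x xQ]; rewrite /P /= => ux xmax.
pose u1 := u - r x *: uQ.
have u1E a : a \in Q -> dot u1 a = dot uQ a * (r a - r x).
  move=> aQ; rewrite /u1 dotBl dotZl mulrBr [r a]/r mulrCA divff ?gt_eqF ?uQ_gt0 //.
  by rewrite mulr1 mulrC.
have [e e0 He] := small_shift dot Q u1 uQ.
pose u2 := u1 + e *: uQ.
have rx0 : r x < 0 by rewrite pmulr_llt0 ?invr_gt0 ?uQ_gt0.
have u2P a : a \in Q -> dot u2 a != 0 /\ (0 < dot u2 a) = (0 < dot u a) || (a == x).
  move=> aQ; have [H1 H2] := He a aQ; have ua := uQ_gt0 aQ.
  have [ax|ax] := eqVneq a x.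
    have : 0 < dot u2 a.
      by rewrite /u2 dotDl dotZl u1E // ax subrr mulr0 add0r mulr_gt0 ?uQ_gt0.
    by move=> H; rewrite orbT H (gt_eqF H).
  rewrite orbF; have := u0 a aQ; rewrite neq_lt => /orP[uan|uap].
    have : dot u2 a < 0.
      apply: H2; rewrite u1E // pmulr_rlt0 // subr_lt0 lt_neqAle.
      by rewrite u_ratio //=; apply: (xmax [` aQ]%fset).
    by move=> H; rewrite (lt_eqF H) (lt_gtF H) (lt_gtF uan).
  have : 0 < dot u2 a.
    apply: H1; rewrite u1E // mulr_gt0 // subr_gt0 (lt_trans rx0) //.
    by rewrite divr_gt0.
  by move=> H; rewrite uap H (gt_eqF H).
have [u' gu' u'E] := make_generic (fun a aQ => (u2P a aQ).1).
by exists u', x; split=> // a aQ; rewrite u'E // (u2P a aQ).2.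
Qed.

(** Hoffman's argument: in a family of half-spaces that is maximal among the
    families with empty intersection all of whose proper subfamilies meet,
    gaining one root in the half-space [i] must gain a point common to all; these
    points form a free set. *)
Lemma critical_free (T : finType) (u : T -> V) :
  (forall b, b \in Phi -> b \notin Q ->
     exists2 v, dot v b < 0 & forall a, a \in Q -> 0 < dot v a) ->
  (forall i a, a \in Q -> dot (u i) a != 0) ->
  (forall i, exists2 a, a \in Q & forall j, j != i -> 0 < dot (u j) a) ->
  ~ (exists2 a, a \in Q & forall j, 0 < dot (u j) a) ->
  exists2 D, convex_free Phi D & #|` D| = #|T|.
Proof.
move=> Q_closed u0 u_crit u_empty.
pose half (v : V) : {set Q} := [set a | 0 < dot v (val a)].
pose crit (C : {ffun T -> {set Q}}) :=
  `[< [/\ forall i, exists2 v, generic v & C i = half v,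
          forall i, exists a : Q, forall j, j != i -> a \in C j &
          ~ exists a : Q, forall j, a \in C j] >].
have [C0 C0crit] : exists C, crit C.
  exists [ffun i => half (u i)]; apply/asboolP; split=> [i|i|[a aC]].
  - have [v gv vE] := make_generic (u0 i); exists v => //; rewrite ffunE.
    by apply/setP => a; rewrite !inE vE ?fsvalP.
  - have [a aQ au] := u_crit i; exists [` aQ]%fset => j ji.
    by rewrite ffunE inE /= au.
  - apply: u_empty; exists (val a); first exact: fsvalP.
    by move=> j; have := aC j; rewrite ffunE inE.
case: (@arg_maxnP _ C0 crit (fun C => \sum_i #|C i|)%N C0crit) => C.
move=> /asboolP[C_half C_crit C_empty] C_max.
have step i : exists vx : V * V * Q, let: (v, v', x) := vx in
    [/\ generic v, generic v', C i = half v, half v' = x |: C i & x \notin C i] /\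
    forall j, j != i -> x \in C j.
  have [v gv CE] := C_half i.
  have [b bQ vb] : exists2 b, b \in Q & dot v b < 0.
    have [a aC] := C_crit i; exists (val a); first exact: fsvalP.
    have vn0 := gv.1 (val a) (fsvalP a).
    rewrite lt_neqAle vn0 leNgt /=; apply/negP => va; apply: C_empty.
    by exists a => j; have [->|/aC//] := eqVneq j i; rewrite CE inE.
  have [v' [x [gv' xQ vx v'E]]] := gain_one gv (ex_intro2 _ _ b bQ vb).
  pose X : Q := [` xQ]%fset.
  have hE : half v' = X |: C i.
    apply/setP => a; rewrite CE !inE v'E ?fsvalP // orbC.
    by rewrite -val_eqE.
  have XC : X \notin C i by rewrite CE inE /= -leNgt ltW.
  exists (v, v', X); split=> //; apply: contrapT => XN.
  pose C' : {ffun T -> {set Q}} := [ffun j => if j == i then X |: C i else C j].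
  have sC j : C j \subset C' j.
    by rewrite ffunE; case: eqP => [->|//]; exact: subsetU1.
  have /C_max : crit C'.
    apply/asboolP; split=> [j|j|[a aC']].
    - rewrite ffunE; case: eqP => [_|_]; last exact: C_half.
      by exists v'.
    - have [a aC] := C_crit j; exists a => l lj.
      by apply: (fintype.subsetP (sC l)); exact: aC.
    have := aC' i; rewrite ffunE eqxx inE => /orP[|aC]; last first.
      by apply: C_empty; exists a => j; have := aC' j; rewrite ffunE; case: eqP => [->|].
    rewrite inE => /eqP aX; apply: XN => j ji.
    by have := aC' j; rewrite ffunE (negPf ji) -aX.
  apply/negP; rewrite -ltnNge.
  rewrite [X in (X < _)%N](bigD1 i) //= [X in (_ < X)%N](bigD1 i) //= ffunE eqxx.
  rewrite cardsU1 XC add1n addSn ltnS leq_add2l.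
  by apply: leq_sum => j _; exact/subset_leq_card/sC.
have [f fP] := boolp.choice step.
pose x i : V := val (f i).2.
have xQ i : x i \in Q by exact: fsvalP.
have xv i : dot (f i).1.1 (x i) < 0.
  have := fP i; rewrite /x; case: (f i) => -[v v'] X /= [[gv gv' CE hE XC] _].
  rewrite CE inE -leNgt in XC.
  by rewrite lt_neqAle XC gv.1 ?fsvalP.
have xv' i : 0 < dot (f i).1.2 (x i).
  have := fP i; rewrite /x; case: (f i) => -[v v'] X /= [[gv gv' CE hE XC] _].
  have : X \in half v' by rewrite hE setU11.
  by rewrite inE.
have xw i j : j != i -> 0 < dot (f i).1.1 (x j) /\ 0 < dot (f i).1.2 (x j).
  rewrite eq_sym => ij; have := fP j; rewrite /x; case: (f j) => -[z z'] X /= [_ /(_ i ij)].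
  have := fP i; case: (f i) => -[v v'] Y /= [[gv gv' CE hE XC] _] XCi.
  have : X \in half v' by rewrite hE finset.in_setU XCi orbT.
  by move: XCi; rewrite CE !inE.
have x_inj : injective x.
  move=> i j xij; apply/eqP/contraT => ij.
  by have [+ _] := xw j i ij; rewrite xij lt_gtF.
pose D := [fset x i | i in T]%fset.
have DP a : a \in D -> exists i, a = x i by move/imfsetP => [i _ ->]; exists i.
exists D; last first.
  by rewrite card_imfset //= -cardT.
split=> [a /DP[i ->]||b bPhi]; first exact/QPhi.
  by exists uQ => a /DP[i ->]; exact: uQ_gt0.
have [bQ|bQ] := boolP (b \in Q); last first.
  by have [v vb vQ] := Q_closed b bPhi bQ; exists v => // a /DP[i ->] _; exact: vQ.
have [[i bi]|nb] := pselect (exists i, dot (f i).1.2 b < 0).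
  exists (f i).1.2 => // a /DP[j ->] _.
  by have [->|/xw[]//] := eqVneq j i.
have [[i bx]|nx] := pselect (exists i, b = x i).
  exists (f i).1.1; rewrite bx // => a /DP[j ->].
  by rewrite (inj_eq x_inj) => /xw[].
case: C_empty; exists [` bQ]%fset => j.
have := fP j; case fj : (f j) => [[v v'] X] /= [[gv gv' CE hE XC] _].
have : [` bQ]%fset \in half v'.
  rewrite inE /= lt_neqAle eq_sym gv'.1 //= leNgt; apply/negP => vb.
  by apply: nb; exists j; rewrite fj.
rewrite hE inE => /orP[|//]; rewrite inE => /eqP bX.
by case: nx; exists j; rewrite /x fj -bX.
Qed.
End Slide.

Section Degree.
Variables (U : {vspace V}) (Phi Pos : {fset V}).
Variables (Phi_root : root_system dot U Phi) (hPos : positive_system Phi Pos).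
Local Notation W := (weyl dot Phi).
Local Notation L := (punctured_weyl dot Phi Pos).

Lemma pos_root a : a \in Pos -> a \in Phi.
Proof. by have [P [_ _ _ _ ->]] := pos_cone hPos => /andP[]. Qed.

Lemma functional_weyl u : exists w : W, forall a, a \in Phi ->
  (0 < dot u a -> weyl_act w a \in Pos) /\ (dot u a < 0 -> weyl_act w a \notin Pos).
Proof.
have [u' [u'0 u's]] := perturb dot Phi u (root_neq0 Phi_root).
have [w wE] := weyl_transitive Phi_root hPos u'0.
exists w => a aP; have [H1 H2] := u's a aP; rewrite wE //.
by split=> // /H2 ua; rewrite -leNgt ltW.
Qed.

Lemma weyl_functional (w : W) : exists u, forall a, a \in Phi ->
  dot u a != 0 /\ (0 < dot u a) = (weyl_act w a \in Pos).
Proof.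
exists (weyl_act w^-1%g (rho Pos)) => a aP.
have -> : dot (weyl_act w^-1%g (rho Pos)) a = dot (rho Pos) (weyl_act w a).
  by rewrite -(weyl_dot w) weyl_actKV.
have waP : weyl_act w a \in Phi by rewrite (weyl_root Phi_root).
by rewrite (rho_gt0 Phi_root hPos) // (rho_neq0 Phi_root hPos).
Qed.

(** A free set with [k + 1] elements violates the property: assign to each of the
    chosen vertices a half-space that misses just one of its elements, and to the
    others half-spaces that cut the intersection down to the free set. Conversely,
    the half-spaces at the chosen vertices form a critical family on the set [Q] of
    roots common to all the others, and [critical_free] applies. *)
Lemma helly_convex_free k : (0 < k)%N ->
  helly dot Phi Pos k <-> forall D, convex_free Phi D -> (#|` D| <= k)%N.
Proof.
move=> k0; split=> [hel D0 freeD0|small m I gI cI p pI].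
  rewrite leqNgt; apply/negP => kD0.
  pose d (i : nat) := nth 0 D0 i.
  have dD0 (i : 'I_k.+1) : d i \in D0.
    by apply: mem_nth; exact: leq_trans (ltn_ord i) kD0.
  have d_inj (i j : 'I_k.+1) : (d i == d j) = (i == j).
    rewrite nth_uniq ?fset_uniq //; exact: leq_trans (ltn_ord _) kD0.
  pose D := [fset d (val i) | i in 'I_k.+1]%fset.
  have dD (i : 'I_k.+1) : d i \in D by apply/imfsetP; exists i.
  have DP a : a \in D -> exists i : 'I_k.+1, a = d i.
    by move/imfsetP => [i _ ->]; exists i.
  have [DPhi [uD uD0] Dfree] : convex_free Phi D.
    by apply: convex_freeS freeD0 => a /DP[i ->].
  have q b : exists u, (forall a, a \in D -> 0 < dot u a) /\
                       (b \in Phi -> b \notin D -> dot u b < 0).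
    have [/andP[/Dfree[u ub uD'] bD]|bN] := boolP ((b \in Phi) && (b \notin D)).
      exists u; split=> // a aD; apply: uD' => //.
      by apply: contraNneq bD => <-.
    by exists uD; split=> // bP bD; rewrite bP bD in bN.
  have r (i : 'I_k.+1) : exists u, dot u (d i) < 0 /\
      forall j : 'I_k.+1, j != i -> 0 < dot u (d j).
    have [u ui uj] := Dfree _ (DPhi _ (dD i)).
    by exists u; split=> // j ji; apply: uj; rewrite // d_inj.
  have [{}q qP] := boolp.choice q; have [{}r rP] := boolp.choice r.
  (* The even vertices up to [2 k] carry the half-spaces opposite to the roots
     of [D]; the others carry half-spaces that contain [D] and whose
     intersection contains no other root. *)
  pose m := (k.*2.-1 + #|` Phi|)%N.
  pose f (i : 'I_k.+1) : 'I_m.+3 := inord i.*2.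
  have fE i : f i = i.*2 :> nat.
    by rewrite inordK // /m; have := ltn_ord i; lia.
  have f_inj : injective f.
    by move=> i j /(congr1 val) /=; rewrite !fE => /double_inj/val_inj.
  pose I := f @: [set: 'I_k.+1].
  have gI : gapped I.
    apply/forall_inP => _ /imsetP[i _ ->]; apply/forall_inP => _ /imsetP[j _ ->].
    by apply/implyP; rewrite !fE; lia.
  have cI : #|I| = k.+1 by rewrite card_imset // cardsT card_ord.
  pose u (j : 'I_m.+3) : V :=
    if [pick i | f i == j] is Some i then r i
    else q (nth 0 Phi (j - k.*2.+1)).
  have uf i : u (f i) = r i.
    rewrite /u; case: pickP => [j /eqP/f_inj-> //|/(_ i)]; by rewrite eqxx.
  have uN j : j \notin I -> u j = q (nth 0 Phi (j - k.*2.+1)).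
    rewrite /u; case: pickP => // i /eqP <-; by rewrite imset_f.
  have [w wP] := boolp.choice (fun j => functional_weyl (u j)).
  have wI i : i \in I -> exists x, forall j, i != j -> weyl_act (w j) x \in Pos.
    move=> /imsetP[i' _ ->]; exists (d i') => j ij.
    have [+ _] := wP j _ (DPhi _ (dD i')); apply.
    have [/imsetP[j' _ jE]|jI] := boolP (j \in I).
      rewrite jE uf; apply: (rP j').2; apply: contraNneq ij => ->.
      by rewrite jE.
    by rewrite uN //; apply: (qP _).1.
  have [x xPos] := hel m I gI cI w wI.
  have xPhi : x \in Phi.
    by have /pos_root := xPos ord0; rewrite (weyl_rootE Phi_root).
  have [/DP[i xE]|xD] := boolP (x \in D).
    have [_] := wP (f i) x xPhi; rewrite xPos uf xE => H.
    by have := H (rP i).1.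
  have lt_x : (index x Phi < #|` Phi|)%N by rewrite index_mem.
  pose j : 'I_m.+3 := inord (k.*2.+1 + index x Phi).
  have jE : j = (k.*2.+1 + index x Phi)%N :> nat.
    by rewrite inordK // /m; lia.
  have jI : j \notin I.
    by apply/imsetP => -[i _ /(congr1 val)] /=; rewrite fE jE; have := ltn_ord i; lia.
  have [_] := wP j x xPhi; rewrite xPos uN // jE addKn nth_index // => H.
  by have := H ((qP x).2 xPhi xD).
apply: contrapT => empty.
have I2 : (1 < #|I|)%N by rewrite cI.
have [c cNI] := gapped_compl gI I2.
have [u uP] := boolp.choice (fun j => weyl_functional (p j)).
pose Q := [fset a in Phi | [forall j, (j \notin I) ==> (0 < dot (u j) a)]]%fset.
have QP a : a \in Q = (a \in Phi) && [forall j, (j \notin I) ==> (0 < dot (u j) a)].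
  by rewrite !inE.
have QPhi : {subset Q <= Phi} by move=> a; rewrite QP => /andP[].
have uc_gt0 a : a \in Q -> 0 < dot (u c) a.
  by rewrite QP => /andP[_ /forallP/(_ c)]; rewrite cNI.
pose uI (i : {i | i \in I}) := u (val i).
have [||||D freeD cardD] := @critical_free U Phi Phi_root Q (u c) QPhi uc_gt0 _ uI.
- move=> b bPhi; rewrite QP bPhi /= negb_forall => /existsP[j].
  rewrite negb_imply => /andP[jI ub]; exists (u j).
    by rewrite lt_neqAle (uP j b bPhi).1 leNgt.
  by move=> a; rewrite QP => /andP[_ /forallP/(_ j)]; rewrite jI.
- by move=> i a /QPhi aPhi; exact: (uP _ a aPhi).1.
- move=> i; have [x xPos] := pI _ (valP i).
  have xPhi : x \in Phi.
    have ic : val i != c by apply: contraNneq cNI => <-; exact: valP.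
    by have /pos_root := xPos c ic; rewrite (weyl_rootE Phi_root).
  exists x.
    rewrite QP xPhi; apply/forallP => j; apply/implyP => jI.
    rewrite (uP j x xPhi).2 xPos //.
    by apply: contraNneq jI => <-; exact: valP.
  by move=> j ji; rewrite (uP _ x xPhi).2 xPos // eq_sym.
- move=> [a aQ ua]; apply: empty; exists a => j.
  have aPhi := QPhi a aQ; rewrite -(uP j a aPhi).2.
  have [jI|jI] := boolP (j \in I); first exact: (ua (exist _ j jI)).
  by move: aQ; rewrite QP => /andP[_ /forallP/(_ j)]; rewrite jI.
have := small D freeD; rewrite cardD card_sig.
by rewrite (eq_card (B := mem I)) ?cI ?ltnn // => i; rewrite inE.
Qed.

(** The Helly property in degree [k] is monotone in [k], being a bound on the sizes
    of free sets. *)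
Lemma degree_max N : (0 < N)%N ->
  (forall D, convex_free Phi D -> (#|` D| <= N)%N) ->
  (exists2 D, convex_free Phi D & #|` D| = N) -> degree L = N%:E.
Proof.
move=> N0 maxN [D freeD cardD].
have segalP k : (0 < k)%N && `[< lower_segal k L >] = (N <= k)%N.
  apply/andP/idP => [[k0 /asboolP]|Nk].
    by rewrite lower_segal_helly // helly_convex_free // => /(_ D freeD); rewrite cardD.
  have k0 := leq_trans N0 Nk; split=> //; apply/asboolP.
  rewrite lower_segal_helly // helly_convex_free // => D' /maxN ND'; exact: leq_trans ND' Nk.
rewrite /degree; case: pselect => [ex|]; last first.
  by case; exists N; rewrite segalP.
case: ex_minnP => n; rewrite segalP => Nn nmin; congr (_%:E); apply/eqP.
by rewrite eqn_leq Nn nmin ?segalP.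
Qed.

Lemma convex_free1 a : a \in Phi -> convex_free Phi [fset a]%fset.
Proof.
move=> aP; have aa := root_dot_gt0 Phi_root aP.
split=> [b|| b bP]; first by rewrite inE => /eqP->.
  by exists a => b; rewrite inE => /eqP->.
have bb := root_dot_gt0 Phi_root bP.
suff [u ub ua] : exists2 u, dot u b < 0 & a != b -> 0 < dot u a.
  by exists u => // x; rewrite inE => /eqP->.
have [->|ab] := eqVneq a b; first by exists (- b); rewrite // dotNl oppr_lt0.
have [->|aNb] := eqVneq a (- b).
  by exists (- b); rewrite ?dotNl ?dotNr ?opprK ?oppr_lt0.
pose x := dot a b / dot b b; pose c := a - x *: b.
have cb : dot c b = 0 by rewrite /c dotBl dotZl divfK ?gt_eqF // subrr.
have c0 : c != 0.
  rewrite subr_eq0; apply/negP => /eqP aE.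
  have [aE'|aE'] := root_prop Phi_root bP aP aE.
    by rewrite aE' eqxx in ab.
  by rewrite aE' eqxx in aNb.
have ca : 0 < dot c a.
  have -> : a = c + x *: b by rewrite subrK.
  by rewrite dotDr dotZr cb mulr0 addr0 dot_gt0.
have [e e0 He] := small_shift dot [:: a] c (- b).
exists (c + e *: - b) => [|_].
  by rewrite dotDl dotZl cb add0r dotNl mulrN oppr_lt0 mulr_gt0.
by have [|+ _] := He a; rewrite ?mem_head //; apply.
Qed.

Lemma max_convex_free : Phi != fset0 -> exists N, [/\ (0 < N)%N,
  forall D, convex_free Phi D -> (#|` D| <= N)%N &
  exists2 D, convex_free Phi D & #|` D| = N].
Proof.
move=> /fset0Pn[a aP].
pose P N := `[< exists2 D, convex_free Phi D & #|` D| = N >].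
have P1 : P 1%N.
  by apply/asboolP; exists [fset a]%fset; [exact: convex_free1 | rewrite cardfs1].
have Pbound N : P N -> (N <= #|` Phi|)%N.
  by move/asboolP => [D [DP _ _] <-]; apply/fsubset_leq_card/fsubsetP.
have exP : exists N, P N by exists 1%N.
case: (ex_maxnP exP Pbound) => N /asboolP PN Nmax; exists N; split=> //.
  exact: Nmax.
by move=> D freeD; apply: Nmax; apply/asboolP; exists D.
Qed.
End Degree.
End ConvexFree.

(** * Orthogonal unions *)

Section OrthogonalUnion.
Variables (R : realType) (V : vectType R) (dot : {dot V for idfun}).
Variables (Phi : {fset V}) (r : nat) (Phi_ : 'I_r -> {fset V}).
Hypothesis Phi_union : orthogonal_union dot Phi_ Phi.
Implicit Types (a b u v : V) (D : {fset V}).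

Lemma component_uniq a i j : a \in Phi_ i -> a \in Phi_ j -> i = j.
Proof.
move=> ai aj; apply/eqP/contraT => /(ounion_orth Phi_union)/(_ _ _ ai aj) aa.
by have := root_dot_gt0 (ounion_root Phi_union i) ai; rewrite aa ltxx.
Qed.

Lemma component_root i : {subset Phi_ i <= Phi}.
Proof. by move=> a ai; apply/(ounion_cover Phi_union); exists i. Qed.

Lemma card_components D : {subset D <= Phi} ->
  #|` D| = (\sum_i #|` (D `&` Phi_ i)%fset|)%N.
Proof.
move=> DPhi; rewrite -sum1_size.
transitivity (\sum_(a <- D) \sum_i (a \in Phi_ i : nat))%N.
  rewrite !big_seq; apply: eq_bigr => a /DPhi/(ounion_cover Phi_union)[i ai].
  rewrite (bigD1 i) //= ai big1 // => j ji.
  by apply/eqP; rewrite eqb0; apply: contra ji => aj; rewrite (component_uniq aj ai).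
rewrite exchange_big; apply: eq_bigr => i _ /=.
rewrite -big_mkcond /= sum1_count -size_filter; apply: perm_size.
apply: uniq_perm; rewrite ?filter_uniq ?fset_uniq // => a.
by rewrite mem_filter in_fsetI andbC.
Qed.

(** A functional can be localised at a component without changing its signs
    there: replace it by the sum of the roots of the component on which it is
    positive, which is orthogonal to the other components. *)
Lemma localise i u : exists v,
  (forall a, a \in Phi_ i -> (0 < dot u a -> 0 < dot v a) /\
                             (dot u a < 0 -> dot v a < 0)) /\
  forall j a, j != i -> a \in Phi_ j -> dot v a = 0.
Proof.
have rooti := ounion_root Phi_union i.
have [w [w0 wu]] := perturb dot (Phi_ i) u (root_neq0 rooti).
exists (\sum_(a <- Phi_ i | 0 < dot w a) a); split=> [a ai|j a ji aj].
  have pos b : b \in Phi_ i -> 0 < dot w b ->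
      0 < dot (\sum_(a <- Phi_ i | 0 < dot w a) a) b.
    apply: (half_sum_gt0 rooti (P := fun b => 0 < dot w b)) => {a b ai}.
    - by move=> a b; rewrite dotDr; exact: addr_gt0.
    - by move=> c b; rewrite dotZr; exact: mulr_gt0.
    - by move=> b wb; rewrite dotNr oppr_gt0 lt_gtF.
  have [H1 H2] := wu a ai; split=> [/H1|/H2 wa]; first exact: pos.
  by rewrite -oppr_gt0 -dotNr pos ?(root_opp rooti) // dotNr oppr_gt0.
rewrite dot_suml big_seq_cond big1 // => b /andP[bi _].
by apply: (ounion_orth Phi_union) bi aj; rewrite eq_sym.
Qed.

Lemma convex_free_component D i :
  convex_free dot Phi D -> convex_free dot (Phi_ i) (D `&` Phi_ i)%fset.
Proof.
move=> [DPhi [u uD] Db]; split=> [a||b bi].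
- by rewrite in_fsetI => /andP[].
- by exists u => a; rewrite in_fsetI => /andP[/uD].
have [v vb vD] := Db b (component_root bi).
by exists v => // a; rewrite in_fsetI => /andP[/vD].
Qed.

Lemma convex_free_union (D_ : 'I_r -> {fset V}) :
  (forall i, convex_free dot (Phi_ i) (D_ i)) ->
  exists2 D, convex_free dot Phi D & forall i, (D `&` Phi_ i)%fset = D_ i.
Proof.
move=> freeD_; have D_Phi i := let: And3 H _ _ := freeD_ i in H.
have pos i : exists v, (forall a, a \in D_ i -> 0 < dot v a) /\
    forall j a, j != i -> a \in Phi_ j -> dot v a = 0.
  have [_ [u uD] _] := freeD_ i; have [v [vu v0]] := localise i u.
  by exists v; split=> // a aD; apply: (vu a (D_Phi i a aD)).1; exact: uD.
have [v vP] := boolp.choice pos.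
pose D := [fset a in Phi | [exists i, a \in D_ i]]%fset.
have DP a : a \in D -> exists i, a \in D_ i.
  by rewrite !inE => /andP[_ /existsP].
exists D => [|i]; last first.
  apply/fsetP => a; rewrite in_fsetI; apply/andP/idP => [[/DP[j aj] ai]|ai].
    by rewrite (component_uniq ai (D_Phi j a aj)).
  split; last exact: D_Phi ai.
  by rewrite !inE (component_root (D_Phi i a ai)); apply/existsP; exists i.
have sum_pos (w : V) b i : b \in Phi_ i -> (forall j a, j != i -> a \in Phi_ j -> dot w a = 0) ->
    (forall j a, j != i -> a \in D_ j -> 0 < dot (w + \sum_(k | k != i) v k) a) /\
    (forall a, a \in Phi_ i -> dot (w + \sum_(k | k != i) v k) a = dot w a).
  move=> bi w0; split=> [j a ji aj|a ai]; rewrite dotDl dot_suml.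
    rewrite (w0 j) ?(D_Phi j) // add0r (bigD1 j) //= big1 => [|k /andP[_ kj]].
      by rewrite addr0; apply: (vP j).1.
    by apply: (vP k).2 (D_Phi j a aj); rewrite eq_sym.
  by rewrite big1 ?addr0 // => k ki; apply: (vP k).2 ai; rewrite eq_sym.
split=> [a||b /(ounion_cover Phi_union)[i bi]].
- by rewrite !inE => /andP[].
- exists (\sum_i v i) => a /DP[i ai]; rewrite dot_suml (bigD1 i) //= big1.
    by rewrite addr0; apply: (vP i).1.
  by move=> j ji; apply: (vP j).2 (D_Phi i a ai); rewrite eq_sym.
have [_ _ /(_ b bi)[u ub uD]] := freeD_ i.
have [w [wu w0]] := localise i u.
have [H1 H2] := sum_pos w b i bi w0.
exists (w + \sum_(k | k != i) v k); first by rewrite H2 // (wu b bi).2.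
move=> a /DP[j aj] ab; have [ji|ji] := eqVneq j i; last exact: H1 aj.
subst j; have ai := D_Phi i a aj; rewrite H2 //; apply: (wu a ai).1.
exact: uD.
Qed.

Variables (Pos : {fset V}) (U : {vspace V}).
Hypotheses (Phi_root : root_system dot U Phi) (hPos : positive_system Phi Pos).

Lemma positive_component i : positive_system (Phi_ i) (Pos `&` Phi_ i)%fset.
Proof.
have [le le_order PosE] := hPos; exists le => // a.
rewrite in_fsetI PosE andbC; case ai: (a \in Phi_ i) => //=.
by rewrite (component_root ai).
Qed.

Lemma degree_union : (0 < r)%N ->
  degree (punctured_weyl dot Phi Pos) =
  (\sum_(i < r) degree (punctured_weyl dot (Phi_ i) (Pos `&` Phi_ i)%fset))%E.
Proof.
move=> r0.
have maxi i := max_convex_free (ounion_root Phi_union i) (ounion_neq0 Phi_union i).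
have [N NP] := boolp.choice maxi.
have degi i : degree (punctured_weyl dot (Phi_ i) (Pos `&` Phi_ i)%fset) = (N i)%:E.
  have [N0 Nmax Nex] := NP i.
  exact: (degree_max (ounion_root Phi_union i) (positive_component i) N0 Nmax Nex).
under [RHS]eq_bigr do rewrite degi.
transitivity ((\sum_(i < r) N i)%N%:E : \bar nat); last first.
  exact: (big_morph (EFin : nat -> \bar nat)).
apply: (degree_max Phi_root hPos).
- rewrite (bigD1 (Ordinal r0)) //= addn_gt0.
  by have [-> _ _] := NP (Ordinal r0).
- move=> D freeD; have [DPhi _ _] := freeD; rewrite card_components //.
  by apply: leq_sum => i _; have [_ H _] := NP i; exact/H/convex_free_component.
have Dex i : exists D, convex_free dot (Phi_ i) D /\ #|` D| = N i.
  by have [_ _ [D]] := NP i; exists D.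
have [D_ D_P] := boolp.choice Dex.
have [D freeD DE] := convex_free_union (fun i => (D_P i).1).
exists D => //; have [DPhi _ _] := freeD; rewrite card_components //.
by apply: eq_bigr => i _; rewrite DE (D_P i).2.
Qed.
End OrthogonalUnion.

(** * Free sets and cones *)

Section Cones.
Variables (R : realType) (V : vectType R) (dot : {dot V for idfun}).
Variables (U : {vspace V}) (Phi : {fset V}) (Phi_root : root_system dot U Phi).
Implicit Types (a b c u v : V) (D : {fset V}).

Lemma convex_free_cone D b (s : seq (R * V)) :
  convex_free dot Phi D -> b \in Phi ->
  (forall p, p \in s -> [/\ 0 <= p.1, p.2 \in D & p.2 != b]) ->
  b != \sum_(p <- s) p.1 *: p.2.
Proof.
move=> [_ _ Dfree] bP sD; have [u ub uD] := Dfree b bP.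
apply/eqP => bE; suff: 0 <= dot u b by rewrite leNgt ub.
rewrite bE dot_sumr big_seq sumr_ge0 // => p /sD[p0 pD pb].
by rewrite dotZr mulr_ge0 // ltW // uD.
Qed.

Lemma convex_free_opp D a b :
  convex_free dot Phi D -> a \in D -> b \in D -> b != - a.
Proof.
move=> [_ [u uD] _] aD bD; apply: contraTneq (uD b bD) => ->.
by rewrite dotNr oppr_gt0 lt_gtF // uD.
Qed.

(** The cone of two elements contains no further root, not even a multiple of one
    of the two, because the elements are positive on a common functional. *)
Lemma convex_free_cone2 D a b c (x y : R) :
  convex_free dot Phi D -> a \in D -> b \in D -> a != b -> c \in Phi ->
  0 < x -> 0 < y -> c = x *: a + y *: b -> False.
Proof.
move=> freeD aD bD ab cP x0 y0 cE; have [DPhi _ _] := freeD.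
have prop a1 b1 (x1 y1 : R) : a1 \in D -> b1 \in D -> a1 != b1 -> x1 != 0 ->
    b1 <> x1 *: a1 + y1 *: b1.
  move=> aD1 bD1 ab1 x10 bE.
  have aE : a1 = ((1 - y1) / x1) *: b1.
    by rewrite mulrC -scalerA scalerBl scale1r {1}bE addrK scalerA mulVf ?scale1r.
  have [aE'|aE'] := root_prop Phi_root (DPhi _ bD1) (DPhi _ aD1) aE.
    by rewrite aE' eqxx in ab1.
  by have := convex_free_opp freeD bD1 aD1; rewrite aE' eqxx.
pose s := [:: (x, a); (y, b)].
suff sP : forall p, p \in s -> [/\ 0 <= p.1, p.2 \in D & p.2 != c].
  have := convex_free_cone freeD cP sP.
  by rewrite !big_cons big_nil addr0 -cE eqxx.
move=> p; rewrite !inE => /orP[] /eqP -> /=; split; rewrite ?ltW //.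
  by apply/eqP => ac; apply: (prop b a y x bD aD); rewrite ?gt_eqF // 1?eq_sym // addrC -cE.
by apply/eqP => bc; apply: (prop a b x y aD bD); rewrite ?gt_eqF // -cE.
Qed.

(** If two elements made an obtuse angle, the mirror image of one in the other
    would be a root in their cone. *)
Lemma convex_free_acute D a b :
  convex_free dot Phi D -> a \in D -> b \in D -> a != b -> 0 <= dot a b.
Proof.
move=> freeD aD bD ab; rewrite leNgt; apply/negP => ab0.
have [DPhi _ _] := freeD; have [aP bP] := (DPhi a aD, DPhi b bD).
apply: (convex_free_cone2 (c := refl dot b a) (x := 1) (y := - (2 * dot a b / dot b b))
  freeD aD bD ab) => //; last by rewrite reflE scale1r scaleNr.
  exact: (root_refl_mem Phi_root).
by rewrite oppr_gt0 pmulr_llt0 ?invr_gt0 ?(root_dot_gt0 Phi_root) // pmulr_rlt0.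
Qed.
End Cones.

(** * Simple systems *)

Section SimpleSystem.
Variables (R : realType) (V : vectType R) (dot : {dot V for idfun}).
Variables (Phi : {fset V}) (Phi_root : root_system dot fullv Phi).
Variables (n : nat) (D : n.-tuple V) (D_simple : simple_system Phi D).
Implicit Types (u v : V).
Local Notation a i := (tnth D i).

Lemma simple_root i : a i \in Phi.
Proof. by have [DP _ _] := D_simple; apply: DP; exact: mem_tnth. Qed.

Lemma simple_free : free D.
Proof. by have [_ /basis_free] := D_simple. Qed.

Lemma coord_simple i j : coord D i (a j) = (i == j)%:R.
Proof. by rewrite (tnth_nth 0) coord_free ?simple_free // eq_sym. Qed.

Lemma simple_sum v : v = \sum_i coord D i v *: a i.
Proof.
have [_ Dbasis _] := D_simple; rewrite {1}(coord_basis Dbasis (memvf v)).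
by apply: eq_bigr => i _; rewrite (tnth_nth 0).
Qed.

Lemma root_sign b : b \in Phi ->
  (forall i, 0 <= coord D i b) \/ (forall i, coord D i b <= 0).
Proof. by have [_ _ H] := D_simple; exact: H. Qed.

Lemma coord_refl i j b : coord D j (refl dot (a i) b) =
  coord D j b - (2 * dot b (a i) / dot (a i) (a i)) * (j == i)%:R.
Proof. by rewrite reflE linearB linearZ /= coord_simple. Qed.

(** The reflection of a root in a simple root changes one coordinate only, so the
    two roots have the same sign unless they are multiples of the simple root. *)
Lemma positive_root_ind (X : V -> Prop) :
  (forall i, X (a i)) ->
  (forall i b, X b -> dot b (a i) < 0 -> X (refl dot (a i) b)) ->
  forall b, b \in Phi -> (forall i, 0 <= coord D i b) -> X b.
Proof.
move=> Xa Xr b; pose ht v := \sum_i coord D i v.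
have [m] := ubnP (count (fun c => ht c < ht b) Phi).
elim: m b => // m IH b; rewrite ltnS => bm bP b0.
have /existsP[i bi] : [exists i, 0 < dot b (a i)].
  apply: contraTT (root_dot_gt0 Phi_root bP) => /existsPn bn.
  rewrite -leNgt {2}(simple_sum b) dot_sumr sumr_le0 // => i _.
  by rewrite dotZr mulr_ge0_le0 // leNgt bn.
have aP := simple_root i; have aa := root_dot_gt0 Phi_root aP.
pose c := refl dot (a i) b; have cP : c \in Phi by exact: (root_refl_mem Phi_root).
have bc : b = refl dot (a i) c by rewrite reflK.
have k0 : 0 < 2 * dot b (a i) / dot (a i) (a i) by rewrite divr_gt0 // mulr_gt0.
have cb j : j != i -> coord D j c = coord D j b.
  by move=> ji; rewrite coord_refl (negPf ji) mulr0 subr0.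
have [/existsP[j /andP[ji bj]]|bn] := boolP [exists j, (j != i) && (0 < coord D j b)].
  have c0 : forall l, 0 <= coord D l c.
    have [//|cn] := root_sign cP.
    by have := cn j; rewrite cb // leNgt bj.
  rewrite bc; apply: Xr; last first.
    by rewrite /c dot_refl refl_self dotNr oppr_lt0.
  apply: IH => //; apply: leq_trans bm.
  have cltb : ht c < ht b.
    rewrite /ht -subr_gt0 -sumrB (bigD1 i) //= big1 => [|l li].
      by rewrite coord_refl eqxx mulr1 addr0 opprB addrC subrK.
    by rewrite cb ?subrr.
  have := count_predUI (fun x => ht x < ht c) (pred1 c) Phi.
  rewrite count_uniq_mem ?fset_uniq // cP addn1 => <-.
  rewrite (@eq_count _ (predI _ _) pred0) ?count_pred0 ?addn0.
    by apply: sub_count => x /= /orP[xc|/eqP-> //]; exact: lt_trans xc cltb.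
  by move=> x /=; case: eqP => [->|]; rewrite ?ltxx ?andbF.
have bE : b = coord D i b *: a i.
  rewrite {1}(simple_sum b) (bigD1 i) //= big1 ?addr0 // => j ji.
  move/existsPn/(_ j): bn; rewrite ji /= => bj; rewrite (_ : coord D j b = 0) ?scale0r //.
  by apply/eqP; rewrite eq_le b0 leNgt bj.
have bi0 : 0 < coord D i b.
  rewrite lt_neqAle b0 andbT eq_sym; apply: contraTneq (root_n0 Phi_root bP) => bi0.
  by rewrite bE bi0 scale0r eqxx.
by rewrite (root_propp Phi_root aP bP bi0 bE).
Qed.
End SimpleSystem.

(** * Angles between simple roots *)

Section CoxeterMatrix.
Variables (R : realType) (V : vectType R) (dot : {dot V for idfun}).
Variables (Phi : {fset V}) (Phi_root : root_system dot fullv Phi).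
Variables (n : nat) (D : n.-tuple V) (D_simple : simple_system Phi D).
Implicit Types (u v : V).
Local Notation a i := (tnth D i).

Lemma simple_obtuse i j : i != j -> dot (a i) (a j) <= 0.
Proof.
move=> ij; have [aP bP] := (simple_root D_simple i, simple_root D_simple j).
have [aa bb] := (root_dot_gt0 Phi_root aP, root_dot_gt0 Phi_root bP).
have cE l : coord D l (refl dot (a j) (a i)) =
    (l == i)%:R - (2 * dot (a i) (a j) / dot (a j) (a j)) * (l == j)%:R.
  by rewrite (coord_refl _ D_simple) (coord_simple D_simple).
have [c0|c0] := root_sign D_simple (root_refl_mem Phi_root bP aP).
  have := c0 j; rewrite cE eq_sym (negPf ij) eqxx mulr1 sub0r oppr_ge0.
  by rewrite pmulr_lle0 ?invr_gt0 // pmulr_rle0.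
by have := c0 i; rewrite cE eqxx (negPf ij) mulr0 subr0 ler10.
Qed.

Definition phi : R := (1 + Num.sqrt 5) / 2.

Lemma phi_sqr : phi * phi = phi + 1.
Proof.
have s5 : Num.sqrt 5 * Num.sqrt 5 = 5 :> R by rewrite -expr2 sqr_sqrtr.
rewrite /phi; move: (Num.sqrt _) s5 => s s5; lra.
Qed.

Lemma phi_gt1 : 1 < phi.
Proof.
have : 1 < Num.sqrt 5 :> R by rewrite -[ltLHS]sqrtr1 ltr_sqrt // ltr1n.
by rewrite /phi => s1; lra.
Qed.

(** [four_cos2 m] is 4 cos^2 (pi / m). *)
Definition four_cos2 (m : nat) : R :=
  match m with 3 => 1 | 4 => 2 | 5 => phi + 1 | _ => 0 end.

Definition rot_step (x y : R) (p : R * R) : R * R :=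
  (p.1 * (x * y - 1) + p.2 * y, - p.1 * x - p.2).

Lemma rotation_pow i j k p :
  let x := 2 * dot (a i) (a j) / dot (a j) (a j) in
  let y := 2 * dot (a i) (a j) / dot (a i) (a i) in
  let q := iter k (rot_step x y) p in
  val ((reflGL dot (a i) * reflGL dot (a j)) ^+ k)%g (p.1 *: a i + p.2 *: a j) =
  q.1 *: a i + q.2 *: a j.
Proof.
move=> x y; elim: k p => [|k IH] p; first by rewrite /= id_lfunE.
rewrite expgS /= comp_lfunE IH; move: (iter k _ p) => [q1 q2].
have biE : refl dot (a j) (a i) = a i - x *: a j by [].
have abE : refl dot (a i) (a j) = a j - y *: a i by rewrite reflE dotC.
have sb (c d : R) : refl dot (a j) (c *: a i + d *: a j) = c *: a i + (- c * x - d) *: a j.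
  by rewrite linearD !linearZ /= refl_self biE scalerBr scalerN scalerA -addrA
             -opprD -scalerDl mulNr -opprD scaleNr.
have sa (c d : R) : refl dot (a i) (c *: a i + d *: a j) = (- c - d * y) *: a i + d *: a j.
  by rewrite linearD !linearZ /= refl_self abE scalerBr scalerN scalerA addrCA addrC
             -opprD -scalerDl -scaleNr opprD.
rewrite comp_lfunE !lfunE /= sb sa; congr (_ *: _ + _).
by ring.
Qed.

(** The rotation [refl a * refl b] acts on the plane of [a] and [b] with trace
    4 cos^2 - 2; its order determines this trace up to Galois conjugation, and for
    order 5 the root [refl a b a] is a positive combination of [a] and [b] for one
    of the conjugates only. *)
Lemma order_four_cos2 i j m : i != j -> m \in [:: 2; 3; 4; 5]%N ->
  has_order (reflGL dot (a i) * reflGL dot (a j))%g m ->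
  4 * dot (a i) (a j) ^+ 2 = four_cos2 m * dot (a i) (a i) * dot (a j) (a j).
Proof.
move=> ij mP [_ gm g_min]; have [aP bP] := (simple_root D_simple i, simple_root D_simple j).
have [aa bb] := (root_dot_gt0 Phi_root aP, root_dot_gt0 Phi_root bP).
pose x := 2 * dot (a i) (a j) / dot (a j) (a j).
pose y := 2 * dot (a i) (a j) / dot (a i) (a i).
have y0 : (y == 0) = (x == 0).
  by rewrite /x /y !mulf_eq0 !invr_eq0 (gt_eqF aa) (gt_eqF bb) !orbF.
have indep (p q : R * R) : p.1 *: a i + p.2 *: a j = q.1 *: a i + q.2 *: a j -> p = q.
  move=> E; rewrite [p]surjective_pairing [q]surjective_pairing.
  have [/(congr1 (coord D i)) Ei /(congr1 (coord D j)) Ej] := (E, E); move: Ei Ej.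
  rewrite !linearD !linearZ /= !(coord_simple D_simple) !eqxx (eq_sym j) (negPf ij).
  by rewrite !mulr0 !mulr1 !addr0 !add0r => -> ->.
have : iter m (rot_step x y) (0, 1) = (0, 1).
  by apply: indep; rewrite -(rotation_pow i j m (0, 1)) gm /= id_lfunE.
have -> : 4 * dot (a i) (a j) ^+ 2 = x * y * dot (a i) (a i) * dot (a j) (a j).
  by rewrite /x /y; field; rewrite !gt_eqF.
move=> E; congr (_ * _ * _); move: E.
have x_le0 : x <= 0.
  by rewrite /x pmulr_lle0 ?invr_gt0 // pmulr_rle0 // simple_obtuse.
have xy1 : x != 0 -> 1 <= x * y.
  move=> x0; pose c := refl dot (a i) (refl dot (a j) (a i)).
  have cP : c \in Phi by rewrite !(root_refl_mem Phi_root).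
  have cE : c = (x * y - 1) *: a i + (- x) *: a j.
    have := rotation_pow i j 1 (1, 0).
    rewrite /= comp_lfunE !lfunE /= scale1r scale0r addr0 /c => ->.
    by rewrite mul1r mul0r addr0 mulN1r subr0.
  have cj : coord D j c = - x.
    rewrite cE linearD !linearZ /= !(coord_simple D_simple) eqxx (eq_sym j) (negPf ij).
    by rewrite mulr0 add0r mulr1.
  have ci : coord D i c = x * y - 1.
    rewrite cE linearD !linearZ /= !(coord_simple D_simple) eqxx (negPf ij).
    by rewrite mulr0 addr0 mulr1.
  have [c0|c0] := root_sign D_simple cP; first by rewrite -subr_ge0 -ci.
  by have := c0 j; rewrite cj oppr_le0 leNgt lt_neqAle x0 x_le0.
have x_y : (x == 0) = (y == 0) by rewrite y0.
move: mP; rewrite !inE => /or4P[] /eqP m_eq; move: gm g_min; rewrite m_eq /rot_step /= => gm g_min [Ep Eq].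
- by move: Eq; lra.
- have [x0|x0] := eqVneq x 0.
    by move: Eq; rewrite x0 !(mul0r, mulr0, mulr1, sub0r, oppr0, add0r, mulN1r, opprK, mulrN1); lra.
  have y_neq0 : y != 0 by rewrite -x_y.
  have : y * ((x * y - 1) * (x * y - 3)) = 0 by rewrite -[RHS]Ep; ring.
  move/eqP; rewrite mulf_eq0 (negPf y_neq0) /= mulf_eq0 !subr_eq0 => /orP[/eqP //|/eqP t3].
  have : 1 = - (x * y) * (x * y - 2) - 1 + x * y by rewrite -[LHS]Eq; ring.
  by rewrite t3; lra.
- have [x0|x0] := eqVneq x 0.
    have d0 : dot (a i) (a j) = 0.
      by move/eqP: x0; rewrite /x !mulf_eq0 invr_eq0 (gt_eqF bb) orbF pnatr_eq0 /= => /eqP.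
    case: (g_min 2) => //; apply: val_inj; apply/lfunP => v.
    rewrite expgS expg1 /= !comp_lfunE !lfunE /= ?id_lfunE.
    rewrite -[RHS](reflK dot (a i)) -[in RHS](reflK dot (a j) v); congr (refl dot _ _).
    by rewrite !reflE !dotE [dot (a j) (a i)]dotC d0 !(mulr0, mul0r, subr0, scale0r) addrAC.
  have y_neq0 : y != 0 by rewrite -x_y.
  have : y * ((x * y - 2) * ((x * y - 2) ^+ 2 - 2)) = 0 by rewrite -[RHS]Ep; ring.
  move/eqP; rewrite mulf_eq0 (negPf y_neq0) /= mulf_eq0 => /orP[/eqP|/eqP] t4; first by lra.
  have : 1 = - (x * y - 2) * ((x * y - 2) ^+ 2 - 2) - (x * y - 2) ^+ 2 + 1.
    by rewrite -[LHS]Eq; ring.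
  by rewrite t4 mulr0 => ?; nra.
have [x0|x0] := eqVneq x 0.
  by move: Eq; rewrite x0 !(mul0r, mulr0, mulr1, sub0r, oppr0, add0r, mulN1r, opprK, mulrN1); lra.
have y_neq0 : y != 0 by rewrite -x_y.
pose t := x * y - 2.
have t_ge : -1 <= t by rewrite /t; have := xy1 x0; lra.
have : y * ((t ^+ 2 - t - 1) * (t ^+ 2 + t - 1)) = 0 by rewrite -[RHS]Ep /t; ring.
move/eqP; rewrite mulf_eq0 (negPf y_neq0) /= => /eqP E1.
have E2 : (t - 1) * (t ^+ 2 + t - 1) = 0.
  have : 1 = - (t ^+ 2 - t - 1) * (t ^+ 2 + t - 1) - (t ^+ 3 - 2 * t).
    by rewrite -[LHS]Eq /t; ring.
  rewrite mulNr E1; move=> E3; have -> : (t - 1) * (t ^+ 2 + t - 1) = t ^+ 3 - 2 * t + 1 by ring.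
  by lra.
have E4 : t ^+ 2 + t - 1 = 0.
  move/eqP: E2; rewrite mulf_eq0 => /orP[/eqP t1|/eqP //].
  have t1' : t = 1 by lra.
  by move: E1; rewrite t1'; lra.
have : (t - (phi - 1)) * (t + phi) = 0.
  rewrite (_ : _ * _ = t ^+ 2 + t - (phi * phi - phi)); last by ring.
  by rewrite phi_sqr; lra.
move/eqP; rewrite mulf_eq0 => /orP[/eqP|/eqP] tE; first by rewrite /t in tE; lra.
by have := phi_gt1; lra.
Qed.
End CoxeterMatrix.

(** * Frames *)

Section Frames.
Variables (R : realType) (V : vectType R) (dot : {dot V for idfun}).
Variables (Phi : {fset V}) (Phi_root : root_system dot fullv Phi).
Implicit Types (u v : V).

(** A frame lists positive multiples of the simple roots, rescaled so that their
    Gram matrix is a given one; the last field says that every root is, up to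
    sign and scale, reached from the frame by reflections that raise it. *)
Record frame n (G : 'I_n -> 'I_n -> R) (b : 'I_n -> V) : Prop := Frame {
  frame_dot : forall i j, dot (b i) (b j) = G i j;
  frame_root : forall i, exists2 c : R, 0 < c & c *: b i \in Phi;
  frame_dual : forall f : 'I_n -> R, exists u, forall i, dot u (b i) = f i;
  frame_inj : forall u, (forall i, dot u (b i) = 0) -> u = 0;
  frame_ind : forall X : V -> Prop, (forall i, X (b i)) ->
    (forall i v, X v -> dot v (b i) < 0 -> X (refl dot (b i) v)) ->
    forall a, a \in Phi -> exists2 c : R, 0 < c & X (c *: a) \/ X (- (c *: a))
}.

Section Rescale.
Variables (n : nat) (D : n.-tuple V) (D_simple : simple_system Phi D).
Local Notation a i := (tnth D i).

Definition dual_row u : 'rV[R]_n := \row_i dot u (a i).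

Fact dual_row_linear : linear dual_row.
Proof. by move=> c u v; apply/rowP => i; rewrite !mxE dotDl dotZl. Qed.
HB.instance Definition _ := GRing.isLinear.Build R V 'rV[R]_n _ dual_row
  dual_row_linear.

Lemma simple_inj u : (forall i, dot u (a i) = 0) -> u = 0.
Proof.
move=> u0; apply/eqP; rewrite -[_ == _]negbK -(dot_gt0 dot) {2}(simple_sum D_simple u).
by rewrite dot_sumr big1 ?ltxx // => i _; rewrite dotZr u0 mulr0.
Qed.

Lemma simple_dual (f : 'I_n -> R) : exists u, forall i, dot u (a i) = f i.
Proof.
have [_ Dbasis _] := D_simple; pose F := linfun dual_row.
have kerF : (fullv :&: lker F = 0)%VS.
  apply/eqP; rewrite -subv0; apply/subvP => u; rewrite memv_cap memvf memv_ker lfunE /=.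
  move=> /eqP/rowP u0; rewrite memv0; apply/eqP/simple_inj => i.
  by have := u0 i; rewrite !mxE.
have imF : (F @: fullv)%VS = fullv.
  apply/eqP; rewrite eqEdim subvf (limg_dim_eq kerF).
  rewrite (size_basis (U := fullv) (X := D) Dbasis) dimvf /dim /=.
  by rewrite mul1n.
have /memv_imgP[u _ uE] : \row_i f i \in (F @: fullv)%VS by rewrite imF memvf.
by exists u => i; move/rowP/(_ i): uE; rewrite lfunE !mxE.
Qed.

(** The lengths of the simple roots can be chosen freely. Simple roots form no acute
    angle, so their inner products are determined by the squares of the cosines. *)
Lemma simple_frame (N : 'I_n -> R) (G : 'I_n -> 'I_n -> R) :
  (forall i, 0 < N i) -> (forall i, G i i = N i) -> (forall i j, G i j = G j i) ->
  (forall i j : 'I_n, (i < j)%N -> G i j <= 0 /\ exists2 m, m \in [:: 2; 3; 4; 5]%N &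
     has_order (reflGL dot (a i) * reflGL dot (a j))%g m /\
     4 * G i j ^+ 2 = four_cos2 R m * N i * N j) ->
  exists b, frame G b.
Proof.
move=> N0 GN GC Gord.
have aa i : 0 < dot (a i) (a i) by rewrite (root_dot_gt0 Phi_root) ?(simple_root D_simple).
pose c i := Num.sqrt (N i / dot (a i) (a i)).
have c0 i : 0 < c i by rewrite sqrtr_gt0 divr_gt0.
have c2 i : c i ^+ 2 * dot (a i) (a i) = N i.
  by rewrite sqr_sqrtr ?divfK ?gt_eqF // ltW // divr_gt0.
pose b i := c i *: a i.
have refl_b i v : refl dot (b i) v = refl dot (a i) v by rewrite reflZ ?gt_eqF.
exists b; split=> [i j|i|f|u u0|X Xb Xr x xP].
- rewrite dotZl dotZr; wlog ij : i j / (i <= j)%N => [H|].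
    by case/orP: (leq_total i j) => /H // E; rewrite GC -E dotC mulrCA.
  move: ij; rewrite leq_eqVlt => /orP[/eqP/val_inj ->|ij].
    by rewrite GN -c2 expr2 mulrA.
  have [G0 [m mP [ord GE]]] := Gord i j ij.
  have ij' : i != j by rewrite neq_ltn ij.
  have d0 : c i * (c j * dot (a i) (a j)) <= 0.
    by rewrite pmulr_rle0 // pmulr_rle0 // (simple_obtuse Phi_root D_simple).
  have := order_four_cos2 Phi_root D_simple ij' mP ord.
  move: d0; move=> d0 ordE.
  apply: oppr_inj; apply/eqP; rewrite -(@eqrXn2 _ 2) ?oppr_ge0 // !sqrrN.
  rewrite -(inj_eq (mulfI (_ : 4 != 0))) ?pnatr_eq0 // GE -(c2 i) -(c2 j).
  by apply/eqP; rewrite !exprMn; move: ordE; move: (_ ^+ 2) => *; nra.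
- by exists (c i)^-1; rewrite ?invr_gt0 // scalerA mulVf ?scale1r ?(simple_root D_simple) ?gt_eqF.
- have [u uE] := simple_dual (fun i => f i / c i); exists u => i.
  by rewrite dotZr uE mulrC divfK ?gt_eqF.
- apply: simple_inj => i; have := u0 i.
  by move/eqP; rewrite dotZr mulf_eq0 gt_eqF //= => /eqP.
pose X' v := exists2 c : R, 0 < c & X (c *: v).
have X'pos v : v \in Phi -> (forall i, 0 <= coord D i v) -> X' v.
  apply: (positive_root_ind Phi_root D_simple) => [i|i w [d d0 Xw] wi].
    by exists (c i); [exact: c0 | exact: Xb].
  exists d => //; rewrite -linearZ /= -refl_b; apply: Xr => //.
  by rewrite dotZl dotZr pmulr_rlt0 // pmulr_rlt0.
have [x0|x0] := root_sign D_simple xP.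
  by have [d d0 Xx] := X'pos x xP x0; exists d => //; left.
have [|i|d d0 Xx] := X'pos (- x); first exact: (root_opp Phi_root).
  by rewrite linearN oppr_ge0; exact: x0.
by exists d => //; right; rewrite -scalerN.
Qed.
End Rescale.
End Frames.

(** * Families of vectors on root rays *)

Section Families.
Variables (R : realType) (V : vectType R) (dot : {dot V for idfun}).
Variables (Phi : {fset V}) (Phi_root : root_system dot fullv Phi).
Variables (T : eqType) (P : pred T) (M : T -> V).
Hypothesis M_cover : forall a, a \in Phi ->
  exists2 c : R, 0 < c & exists2 t, P t & c *: a = M t.

(** Only the rays of the roots are under control, so roots are described by labels
    of vectors on their rays. *)
Lemma label_roots (t0 : T) : exists2 f : V -> T,
  {in Phi &, injective f} &
  forall a, a \in Phi -> P (f a) /\ exists2 c : R, 0 < c & c *: a = M (f a).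
Proof.
have H (a : V) : exists t, a \in Phi -> P t /\ exists2 c : R, 0 < c & c *: a = M t.
  have [aP|aN] := boolP (a \in Phi); last by exists t0.
  by have [c c0 [t Pt E]] := M_cover aP; exists t => _; split=> //; exists c.
have [f fP] := boolp.choice H; exists f => // a b aP bP fab.
have [[_ [c c0 cE]] [_ [d d0 dE]]] := (fP a aP, fP b bP).
apply: (@root_propp _ _ _ _ _ Phi_root b a (c^-1 * d)) => //; first by rewrite mulr_gt0 ?invr_gt0.
by rewrite -scalerA dE -fab -cE scalerA mulVf ?scale1r // gt_eqF.
Qed.

Lemma convex_free_family (S : seq T) : uniq S ->
  (forall s, s \in S -> exists2 c : R, 0 < c & c *: M s \in Phi) ->
  (exists u, forall s, s \in S -> 0 < dot u (M s)) ->
  (forall t, P t -> exists2 u, dot u (M t) < 0 &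
     forall s, s \in S -> s != t -> 0 < dot u (M s)) ->
  exists2 D, convex_free dot Phi D & #|` D| = size S.
Proof.
move=> uS S_root [u0 u0S] S_free.
have H (t : T) : exists c : R, t \in S -> 0 < c /\ c *: M t \in Phi.
  have [/S_root[c c0 cP]|tS] := boolP (t \in S); last by exists 0.
  by exists c.
have [c cP] := boolp.choice H; pose r t := c t *: M t.
have cover_sep a : a \in Phi -> exists2 t, P t & exists2 d : R, 0 < d & M t = d *: a.
  by move=> /M_cover[d d0 [t Pt E]]; exists t => //; exists d.
have r_inj : {in S &, injective r}.
  move=> s s' sS s'S E; apply/eqP/contraT => ss'.
  have [s0 rP] := cP s sS; have [s'0 _] := cP s' s'S.
  have [t Pt [d d0 Mt]] := cover_sep _ rP; have [u ut uS'] := S_free t Pt.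
  have us : dot u (M s) < 0.
    by move: ut; rewrite Mt /r !dotZr pmulr_rlt0 // pmulr_rlt0.
  have us' : dot u (M s') < 0.
    by move: ut; rewrite Mt -/(r s) E /r !dotZr pmulr_rlt0 // pmulr_rlt0.
  have st : s = t by apply/eqP/contraT => st; have := uS' s sS st; rewrite lt_gtF.
  have s't : s' = t by apply/eqP/contraT => st'; have := uS' s' s'S st'; rewrite lt_gtF.
  by rewrite st s't eqxx in ss'.
pose D := [fset x in map r S]%fset.
have DP a : a \in D -> exists2 s, s \in S & a = r s by rewrite inE => /mapP.
exists D; last first.
  rewrite card_fseq undup_id ?size_map // map_inj_in_uniq //.
split=> [a /DP[s sS ->]||b bP]; first by have [] := cP s sS.
  by exists u0 => a /DP[s sS ->]; rewrite dotZr mulr_gt0 ?u0S //; have [] := cP s sS.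
have [t Pt [d d0 Mt]] := cover_sep _ bP; have [u ut uS'] := S_free t Pt.
exists u => [|a /DP[s sS ->] rb].
  by move: ut; rewrite Mt dotZr pmulr_rlt0.
have [s0 rP] := cP s sS; rewrite dotZr mulr_gt0 // uS' //.
apply: contraNneq rb => st; apply/eqP.
by apply: (root_propp Phi_root bP rP (mulr_gt0 s0 d0)); rewrite /r st Mt scalerA.
Qed.
End Families.

Section Scaling.
Variables (R : realType) (V : vectType R) (dot : {dot V for idfun}).
Variables (Phi : {fset V}) (Phi_root : root_system dot fullv Phi).

Definition ray (v : V) : Prop := exists2 c : R, 0 < c & c *: v \in Phi.

Lemma ray_opp v : ray v -> ray (- v).
Proof.
by move=> [c c0 cP]; exists c => //; rewrite scalerN (root_opp Phi_root).
Qed.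

Lemma ray_refl a v : ray a -> ray v -> ray (refl dot a v).
Proof.
move=> [c c0 cP] [d d0 dP]; exists d => //.
by rewrite -linearZ /= -(@reflZ _ _ _ c) ?gt_eqF // (root_refl_mem Phi_root).
Qed.

Lemma ray_inj a c (x y : R) : a \in Phi -> c \in Phi -> 0 < x -> 0 < y ->
  x *: a = y *: c -> a = c.
Proof.
move=> aP cP x0 y0 E; apply: (@root_propp _ _ _ _ _ Phi_root c a (x^-1 * y)) => //.
  by rewrite mulr_gt0 ?invr_gt0.
by rewrite -scalerA -E scalerA mulVf ?scale1r ?gt_eqF.
Qed.

Section Free.
Variables (D : {fset V}) (freeD : convex_free dot Phi D).
Variables (a c : V) (x y : R).
Hypotheses (aD : a \in D) (cD : c \in D) (x0 : 0 < x) (y0 : 0 < y).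

Lemma convex_free_ray_opp : x *: a <> - (y *: c).
Proof.
have [DPhi _ _] := freeD; rewrite -scalerN.
move=> /(ray_inj (DPhi a aD) (root_opp Phi_root (DPhi c cD)) x0 y0) E.
by have := convex_free_opp freeD cD aD; rewrite E eqxx.
Qed.

Lemma convex_free_ray_acute : a != c -> 0 <= dot (x *: a) (y *: c).
Proof.
move=> ac; rewrite dotZl dotZr pmulr_rge0 // pmulr_rge0 //.
exact: (convex_free_acute Phi_root freeD).
Qed.

Lemma convex_free_ray_cone v z : a != c -> 0 < z -> ray v ->
  x *: a + y *: c <> z *: v.
Proof.
move=> ac z0 [d d0 dP] E.
apply: (convex_free_cone2 Phi_root freeD aD cD ac dP (x := d / z * x) (y := d / z * y)).
- by rewrite mulr_gt0 ?divr_gt0.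
- by rewrite mulr_gt0 ?divr_gt0.
- by rewrite -!scalerA -!scalerDr E !scalerA divfK ?gt_eqF.
Qed.
End Free.
End Scaling.

(** * Type A *)

Section TypeA.
Variables (R : realType) (V : vectType R) (dot : {dot V for idfun}).
Variables (Phi : {fset V}) (Phi_root : root_system dot fullv Phi).
Variable n : nat.

Definition path_gram (N : 'I_n -> R) (i j : 'I_n) : R :=
  if i == j then N i else if (j == i.+1 :> nat) || (i == j.+1 :> nat) then -1 else 0.

Variables (b : 'I_n -> V) (bP : frame dot Phi (path_gram (fun=> 2)) b).

Let lo (k : 'I_n) : 'I_n.+1 := widen_ord (leqnSn n) k.
Let hi (k : 'I_n) : 'I_n.+1 := lift ord0 k.

Let hiE k : hi k = k.+1 :> nat. Proof. by rewrite /hi lift0. Qed.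
Let loE k : lo k = k :> nat. Proof. by []. Qed.
Let eq_lo i k : (i == lo k) = (i == k :> nat). Proof. by []. Qed.
Let eq_hi i k : (i == hi k) = (i == k.+1 :> nat). Proof. by rewrite -hiE. Qed.
Let hi_lo k : (hi k == lo k) = false. Proof. by rewrite eq_lo hiE gtn_eqF. Qed.

(** The points are the images of the coordinate vectors of a space of dimension
    [n + 1] in the quotient by the all-one vector; they are found through their
    inner products with the frame. *)
Lemma typeA_points : exists x : 'I_n.+1 -> V,
  [/\ forall k, b k = x (lo k) - x (hi k) ,
      forall i k, refl dot (b k) (x i) = x (tperm (lo k) (hi k) i) &
      forall p : 'I_n.+1 -> R, exists u, forall i j, dot u (x i - x j) = p i - p j].
Proof.
have [x xE] := boolp.choice (fun i =>
  frame_dual bP (fun k => (i == lo k)%:R - (i == hi k)%:R)).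
have bE k : b k = x (lo k) - x (hi k).
  apply/eqP; rewrite -subr_eq0; apply/eqP/(frame_inj bP) => l.
  rewrite !dotBl !xE (frame_dot bP) /path_gram !(eq_lo, eq_hi) !(loE, hiE) eqSS -val_eqE.
  have [->|kl] := eqVneq k l; first by rewrite !eqxx ltn_eqF // gtn_eqF //=; lra.
  rewrite (_ : (k == l :> nat) = false) /=; last by apply/negbTE.
  rewrite (eq_sym (l : nat)); case: eqP => k1; case: eqP => k2 /=; by [lra | lia].
exists x; split=> // [i k|p].
  have Nk : dot (b k) (b k) = 2 by rewrite (frame_dot bP) /path_gram eqxx.
  rewrite reflE Nk mulrC mulKf ?pnatr_eq0 // xE; case: tpermP => [->|->|].
  - by rewrite eqxx eq_sym hi_lo subr0 scale1r bE opprB addrC subrK.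
  - by rewrite eqxx hi_lo sub0r scaleN1r opprK bE addrC subrK.
  - by move=> /eqP/negPf-> /eqP/negPf->; rewrite subrr scale0r subr0.
have [u uE] := frame_dual bP (fun k => p (lo k) - p (hi k)); exists u => i j.
suff E l : dot u (x l) - p l = dot u (x ord0) - p ord0.
  by have := E i; have := E j; rewrite dotBr; lra.
case: l => l; elim: l => [|l IH] lt_ln; first by congr (dot u (x _) - p _); exact: val_inj.
rewrite -(IH (ltnW lt_ln)); have := uE (Ordinal (lt_ln : (l < n)%N)).
rewrite bE dotBr.
have -> : lo (Ordinal (lt_ln : (l < n)%N)) = Ordinal (ltnW lt_ln) by exact: val_inj.
have -> : hi (Ordinal (lt_ln : (l < n)%N)) = Ordinal lt_ln by apply/val_inj/hiE.
by lra.
Qed.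

(** If [i -> j] and [j -> k] belong to a free set, then their sum [i -> k] is
    a root or zero, which is impossible. So tails and heads form disjoint sets of
    points, and the best choice of all arrows from one half of the points to the
    other is indeed free. *)
Lemma typeA_max N : N = ((n.+1 ^ 2) %/ 4)%N ->
  (forall D, convex_free dot Phi D -> (#|` D| <= N)%N) /\
  (exists2 D, convex_free dot Phi D & #|` D| = N).
Proof.
move=> NE; have [x [xb x_refl x_dual]] := typeA_points.
pose M (t : 'I_n.+1 * 'I_n.+1) := x t.1 - x t.2.
have M_cover a : a \in Phi ->
    exists2 c : R, 0 < c & exists2 t, t.1 != t.2 & c *: a = M t.
  pose X v := exists2 t, t.1 != t.2 & v = M t.
  case/(frame_ind bP (X := X)) => [k|k v [[i j] /= ij ->] _|c c0].
  - by exists (lo k, hi k); rewrite //= eq_sym hi_lo.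
  - exists (tperm (lo k) (hi k) i, tperm (lo k) (hi k) j) => /=.
      by rewrite (inj_eq perm_inj).
    by rewrite /M linearB /= !x_refl.
  - case=> [[t tP E]|[[i j] ij E]]; exists c => //; first by exists t.
    by exists (j, i); rewrite 1?eq_sym // -[LHS]opprK E /M opprB.
have ray_lt d (i j : 'I_n.+1) : j = (i + d.+1)%N :> nat -> ray Phi (x i - x j).
  elim: d i j => [|d IH] i j ijE.
    have lt_in : (i < n)%N by have := ltn_ord j; lia.
    have -> : i = lo (Ordinal lt_in) by exact: val_inj.
    have -> : j = hi (Ordinal lt_in) by apply: val_inj; rewrite [RHS]hiE /=; lia.
    by rewrite -xb; exact: frame_root bP _.
  have lt_jn : (j.-1 < n)%N by have := ltn_ord j; lia.
  pose k := Ordinal lt_jn; have jE : j = hi k by apply: val_inj; rewrite [RHS]hiE /=; lia.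
  have -> : x i - x j = refl dot (b k) (x i - x (lo k)).
    rewrite linearB /= !x_refl tpermL -jE tpermD //.
      by rewrite eq_sym eq_lo /=; lia.
    by apply/eqP => E; move: ijE; rewrite -E -?jE; lia.
  apply: (ray_refl Phi_root) (frame_root bP k) (IH _ _ _); rewrite loE /=; lia.
have ray_x (i j : 'I_n.+1) : i != j -> ray Phi (x i - x j).
  have [ij _|ij _|/val_inj->] := ltngtP i j; last by rewrite eqxx.
    by apply: (ray_lt (j - i.+1)%N); lia.
  by rewrite -opprB; apply: (ray_opp Phi_root); apply: (ray_lt (i - j.+1)%N); lia.
split=> [D freeD|].
  have [f f_inj fP] := label_roots Phi_root M_cover (ord0, ord0).
  have [DPhi _ _] := freeD.
  pose S := [seq f a | a <- D].
  have S_uniq : uniq S.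
    by rewrite map_inj_in_uniq ?fset_uniq // => a c /DPhi aP /DPhi cP; exact: f_inj.
  pose src := [set t.1 | t in S]; pose tgt := [set t.2 | t in S].
  have disj : [disjoint src & tgt].
    apply/pred0P => j; apply/negP => /andP[/imsetP[s sS js] /imsetP[t tS jt]].
    move: sS tS => /mapP[g gD sE] /mapP[a aD tE].
    have [s12 [c c0 cE]] := fP g (DPhi g gD); have [t12 [d d0 dE]] := fP a (DPhi a aD).
    rewrite -sE /M -js in cE s12; rewrite -tE /M -jt in dE t12.
    have ga : a != g.
      by apply: contraNneq s12 => ag; rewrite {1}jt tE ag -sE.
    have [tis|tis] := eqVneq t.1 s.2.
      by apply: (convex_free_ray_opp Phi_root freeD aD gD d0 c0); rewrite dE cE tis opprB.
    apply: (convex_free_ray_cone Phi_root freeD aD gD d0 c0 ga ltr01 (ray_x _ _ tis)).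
    by rewrite dE cE scale1r addrA subrK.
  have : (#|` D| <= #|src| * #|tgt|)%N.
    rewrite -(size_map f) -(card_uniqP S_uniq) -cardsX; apply: subset_leq_card.
    by apply/fintype.subsetP => t tS; rewrite inE !imset_f.
  have : (#|src| + #|tgt| <= n.+1)%N.
    rewrite -[X in (_ <= X)%N]card_ord -cardsUI.
    by rewrite (disjoint_setI0 disj) cards0 addn0 max_card.
  move: #|src| #|tgt| => p q pq /leq_trans; apply.
  rewrite NE leq_divRL // mulnC; apply: leq_trans (nat_AGM2 _ _).1 _.
  by rewrite leq_exp2r.
pose m := (n.+1 %/ 2)%N.
pose A := [set i : 'I_n.+1 | (i < m)%N].
pose S := [seq (i, j) | i <- enum A, j <- enum (~: A)].
have SP t : (t \in S) = (t.1 \in A) && (t.2 \notin A).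
  case: t => i j; rewrite /S; apply/allpairsP/andP => [[[i' j'] /=]|[/= iA jA]].
    by rewrite !mem_enum finset.in_setC => -[iA jA [-> ->]].
  by exists (i, j); rewrite !mem_enum finset.in_setC.
have cardA : #|A| = m.
  have mn : (m <= n.+1)%N by rewrite /m leq_div.
  rewrite -sum1_card (eq_bigl (fun i : 'I_n.+1 => (i < m)%N)) => [|i]; last by rewrite inE.
  by rewrite (big_ord_narrow mn) sum_nat_const card_ord muln1.
have sizeS : size S = N.
  rewrite size_allpairs -!cardE [#|~: A|]cardsCs finset.setCK card_ord cardA NE.
  have := divn_eq n.+1 2; have := ltn_pmod n.+1 (isT : 0 < 2)%N; rewrite -/m.
  move: (n.+1 %% 2)%N {A S SP cardA}(m) => r k r2 ->; rewrite (_ : (_ ^ 2 = k * (k * 2 + r - k) * 4 + r ^ 2)%N); last by nia.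
  by rewrite divnMDl // divn_small ?addn0 // (ltn_exp2r _ 2).
rewrite -sizeS; apply: (convex_free_family Phi_root M_cover).
- by apply: allpairs_uniq; rewrite ?enum_uniq // => -[i j] [i' j'] _ _ /= [-> ->].
- by move=> [i j]; rewrite SP /= => /andP[iA jA]; apply: ray_x; apply: contraNneq jA => /= <-.
- have [u uE] := x_dual (fun i => (i \in A)%:R); exists u => t; rewrite SP uE.
  by move=> /andP[-> /negPf->]; rewrite subr0 ltr01.
(* The potential is 3 on [A] and 0 elsewhere, so that all elements of [S] are
   positive, except for the values 1 and 2 at the two points of the given root,
   which make this root negative and leave the other elements positive. *)
move=> [p q] /= pq.
pose pot i : R := if i == p then 1 else if i == q then 2 else if i \in A then 3 else 0.
have [u uE] := x_dual pot; exists u => [|[i j]]; rewrite uE /pot /=.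
  by rewrite eqxx (eq_sym q) (negPf pq) eqxx; lra.
rewrite SP /= xpair_eqE => /andP[iA jA].
have ij : i != j by apply: contraNneq jA => <-.
move: ij; case: (eqVneq i p) => [->|ip]; case: (eqVneq j q) => [->|jq] //=.
- by rewrite eq_sym => /negPf->; rewrite (negPf jA); lra.
- by rewrite (eq_sym q) (negPf pq); case: (eqVneq i q) => [//|_]; rewrite iA; lra.
- move=> ij _; case: (eqVneq j p) => _; rewrite ?(negPf jA) ?iA; case: eqP => _; lra.
Qed.
End TypeA.

(** * Signed pairs of coordinate vectors *)

Lemma card_lt_pairs n :
  #|[set p : 'I_n * 'I_n | (p.1 < p.2)%N]| = 'C(n, 2).
Proof.
rewrite -sum1_card (eq_bigl (fun p : 'I_n * 'I_n => predT p.2 && (p.1 < p.2)%N)) => [|p]; last by rewrite inE.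
rewrite -(pair_big_dep (fun=> true) (fun i j : 'I_n => (i < j)%N) (fun=> fun=> 1%N)) /=.
rewrite (exchange_big_dep predT) //= -bin2_sum big_mkord; apply: eq_bigr => j _.
by rewrite (big_ord_narrow (ltnW (ltn_ord j))) sum_nat_const card_ord muln1.
Qed.

(** [(i, j, s, t)] stands for the vector with entries [(-1) ^+ s] in position
    [i] and [(-1) ^+ t] in position [j], or just for the first of these entries
    when [i = j]. *)
Notation label n := ('I_n * 'I_n * bool * bool)%type.

Section Coordinates.
Variables (R : realType) (V : vectType R) (dot : {dot V for idfun}).
Variables (Phi : {fset V}) (Phi_root : root_system dot fullv Phi).
Variable m : nat.
Local Notation n := m.+1.
Variables (e : 'I_n -> V) (e_dot : forall i j, dot (e i) (e j) = (i == j)%:R).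

Definition vec (t : label n) : V :=
  let: (i, j, s, s') := t in
  (-1) ^+ s *: e i + (if i == j then 0 else (-1) ^+ s' *: e j).

Lemma vec_functional (w : 'I_n -> R) : exists u, forall t : label n,
  dot u (vec t) = let: (i, j, s, s') := t in
    (-1) ^+ s * w i + (if i == j then 0 else (-1) ^+ s' * w j).
Proof.
have uE i : dot (\sum_k w k *: e k) (e i) = w i.
  rewrite dot_suml (bigD1 i) //= dotZl e_dot eqxx mulr1 big1 ?addr0 // => k ki.
  by rewrite dotZl e_dot (negPf ki) mulr0.
exists (\sum_k w k *: e k) => -[[[i j] s] s'] /=; rewrite dotDr dotZr uE.
by case: eqP => _; rewrite ?dot0r ?dotZr ?uE.
Qed.

Definition monomial (a : V) : Prop := exists s : 'I_n -> bool, exists2 p : 'I_n -> 'I_n,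
  injective p & forall i, refl dot a (e i) = (-1) ^+ s i *: e (p i).

Lemma monomial_vec a t : monomial a -> exists2 t' : label n,
  (t'.1.1.1 == t'.1.1.2) = (t.1.1.1 == t.1.1.2) & refl dot a (vec t) = vec t'.
Proof.
case: t => -[[i j] s] s' [c [p p_inj pE]].
exists (p i, p j, s (+) c i, s' (+) c j) => /=; first exact: inj_eq.
rewrite linearD linearZ /= pE scalerA (inj_eq p_inj) signr_addb; congr (_ + _).
case: eqP => _; first by rewrite linear0.
by rewrite linearZ /= pE scalerA signr_addb.
Qed.

Lemma refl_diff k l i : k != l -> refl dot (e k - e l) (e i) = e (tperm k l i).
Proof.
move=> kl; rewrite reflE !dotBl !dotBr !e_dot !eqxx (eq_sym l) (negPf kl).
rewrite !subr0 !sub0r opprK -[1 + 1]/(2%:R) mulrC mulKf ?pnatr_eq0 //.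
case: tpermP => [->|->|/eqP/negPf-> /eqP/negPf->].
- by rewrite eqxx (negPf kl) subr0 scale1r opprB addrC subrK.
- by rewrite eqxx eq_sym (negPf kl) sub0r scaleN1r opprK addrC subrK.
- by rewrite subrr scale0r subr0.
Qed.

Lemma refl_sum k l i : k != l -> refl dot (e k + e l) (e i) =
  (-1) ^+ ((i == k) || (i == l)) *: e (tperm k l i).
Proof.
move=> kl; rewrite reflE !dotDl !dotDr !e_dot !eqxx (eq_sym l) (negPf kl).
rewrite !addr0 !add0r -[1 + 1]/(2%:R) mulrC mulKf ?pnatr_eq0 //.
case: tpermP => [->|->|/eqP/negPf-> /eqP/negPf->].
- by rewrite eqxx (negPf kl) addr0 scale1r expr1 scaleN1r opprD addrA subrr add0r.
- by rewrite eqxx eq_sym (negPf kl) add0r scale1r orbT expr1 scaleN1r opprD addrCA subrr addr0.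
- by rewrite add0r scale0r subr0 expr0 scale1r.
Qed.

Lemma refl_unit k i : refl dot (e k) (e i) = (-1) ^+ (i == k) *: e i.
Proof.
rewrite reflE !e_dot eqxx divr1; case: eqP => [->|_].
  by rewrite mulr1 scaler_nat mulr2n opprD addrA subrr add0r expr1 scaleN1r.
by rewrite mulr0 scale0r subr0 expr0 scale1r.
Qed.

Lemma monomial_diff k l : k != l -> monomial (e k - e l).
Proof.
move=> kl; exists (fun=> false), (tperm k l); first exact: perm_inj.
by move=> i; rewrite refl_diff // expr0 scale1r.
Qed.

Lemma monomial_sum k l : k != l -> monomial (e k + e l).
Proof.
move=> kl; exists (fun i => (i == k) || (i == l)), (tperm k l); first exact: perm_inj.
by move=> i; rewrite refl_sum.
Qed.

Lemma monomial_unit k : monomial (e k).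
Proof. by exists (fun i => i == k), id => // i; rewrite refl_unit. Qed.

Lemma ray_diff : (forall k l : 'I_n, l = k.+1 :> nat -> ray Phi (e k - e l)) ->
  forall k l, k != l -> ray Phi (e k - e l).
Proof.
move=> ray1; suff ray_lt d (i j : 'I_n) : j = (i + d.+1)%N :> nat -> ray Phi (e i - e j).
  move=> i j; have [ij _|ij _|/val_inj->] := ltngtP i j; last by rewrite eqxx.
    by apply: (ray_lt (j - i.+1)%N); lia.
  by rewrite -opprB; apply: (ray_opp Phi_root); apply: (ray_lt (i - j.+1)%N); lia.
elim: d i j => [|d IH] i j ijE; first by apply: ray1; lia.
have lt_jn : (j.-1 < n)%N by have := ltn_ord j; lia.
pose k := Ordinal lt_jn; have jk : j = k.+1 :> nat by rewrite /=; lia.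
have kj : k != j by rewrite -val_eqE /=; lia.
have ik : i != k by rewrite -val_eqE /=; lia.
have ij : i != j by rewrite -val_eqE /=; lia.
have -> : e i - e j = refl dot (e k - e j) (e i - e k).
  by rewrite linearB /= !refl_diff // tpermL tpermD // eq_sym.
by apply: (ray_refl Phi_root); [exact: ray1 | apply: IH; rewrite /=; lia].
Qed.
End Coordinates.

(** * Type B *)

Section TypeB.
Variables (R : realType) (V : vectType R) (dot : {dot V for idfun}).
Variables (Phi : {fset V}) (Phi_root : root_system dot fullv Phi).
Variable m : nat.
Local Notation n := m.+1.
Definition typeB_norm (i : 'I_n) : R := if i == ord_max then 1 else 2.
Variables (b : 'I_n -> V) (bP : frame dot Phi (path_gram typeB_norm) b).

(** The basis is found through its inner products with the frame, extended by
    [e n = 0] so that the last vector of the frame needs no separate treatment. *)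
Lemma typeB_basis : exists e : 'I_n -> V,
  [/\ forall i j, dot (e i) (e j) = (i == j)%:R,
      forall k l : 'I_n, l = k.+1 :> nat -> b k = e k - e l &
      b ord_max = e ord_max].
Proof.
have [e eE] := boolp.choice (fun j : nat => frame_dual bP (fun k : 'I_n =>
  if (j < n)%N then (j == k)%:R - (j == k.+1)%:R else 0)).
have en : e n = 0 by apply: (frame_inj bP) => k; rewrite eE ltnn.
have bE (k : 'I_n) : b k = e k - e k.+1.
  apply/eqP; rewrite -subr_eq0; apply/eqP/(frame_inj bP) => l.
  rewrite !dotBl !eE (frame_dot bP) /path_gram /typeB_norm ltn_ord eqSS.
  have := ltn_ord l; rewrite -!(inj_eq val_inj) /= => ln.
  have [kn|kn] := ltnP k.+1 n; have := ltn_ord k => ?.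
    have [km|_] := eqVneq (k : nat) m; first by lia.
    have [->|kl] := eqVneq (k : nat) l; first by rewrite ltn_eqF // gtn_eqF //=; lra.
    by rewrite (eq_sym (l : nat)); case: eqP => k1; case: eqP => k2 /=; by [lra | lia].
  have km : k = m :> nat by lia.
  rewrite km eqxx (eq_sym m l) -(eq_sym l.+1).
  have [->|ml] := eqVneq (l : nat) m; first by rewrite gtn_eqF //=; lra.
  by rewrite (_ : (l == m.+1 :> nat) = false) /=; [case: eqP => _ /=; lra | lia].
have e_dot i j : (i < n)%N -> (j <= n)%N -> dot (e i) (e j) = (i == j)%:R.
  move=> lt_in le_jn; rewrite -(subKn le_jn).
  elim: (n - j)%N (leq_subr j n) => [|d IH] dn.
    by rewrite subn0 en dot0r ltn_eqF.
  have lt_n : (n - d.+1 < n)%N by lia.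
  have -> : e (n - d.+1)%N = b (Ordinal lt_n) + e (n - d)%N.
    by rewrite bE /= (_ : (n - d.+1).+1 = n - d)%N ?subrK //; lia.
  rewrite dotDr eE lt_in IH ?(ltnW dn) //= (_ : (n - d.+1).+1 = n - d)%N ?subrK //; lia.
exists (fun i => e i); split=> [i j|k l lk|].
- by rewrite e_dot // ltnW.
- by rewrite bE lk.
- by rewrite bE en subr0.
Qed.

(** Two elements with the same support, and likewise two short elements, are opposite
    or add up to a multiple of a root; hence the supports are distinct and at most
    one is a singleton. *)
Lemma typeB_max : (0 < m)%N ->
  (forall D, convex_free dot Phi D -> (#|` D| <= 'C(n, 2) + 1)%N) /\
  (exists2 D, convex_free dot Phi D & #|` D| = ('C(n, 2) + 1)%N).
Proof.
move=> m0; have [e [e_dot b_diff b_max]] := typeB_basis.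
have lt_hi k : k != ord_max :> 'I_n -> (k.+1 < n)%N.
  by rewrite -(inj_eq val_inj) /= => km; have := ltn_ord k; lia.
have b_mono k : monomial dot e (b k).
  have [->|km] := eqVneq k ord_max; first by rewrite b_max; exact: monomial_unit.
  rewrite (b_diff k (Ordinal (lt_hi k km))) //; apply: monomial_diff => //.
  by rewrite -val_eqE /= ltn_eqF.
pose normal (t : label n) := (t.1.1.1 <= t.1.1.2)%N && ((t.1.1.1 == t.1.1.2) ==> ~~ t.2).
have M_cover a : a \in Phi ->
    exists2 c : R, 0 < c & exists2 t : label n, normal t & c *: a = vec e t.
  pose X v := exists t : label n, v = vec e t.
  have sortX v : X v -> exists2 t : label n, normal t & v = vec e t.
    move=> [[[[i j] s] s'] ->]; have [ij|ji] := leqP i j.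
      exists (i, j, s, s' && (i != j)); rewrite /normal /= ?ij; case: eqVneq => //=.
        by rewrite andbF.
      by rewrite andbT.
    exists (j, i, s', s); first by rewrite /normal /= ltnW // -(inj_eq val_inj) /= ltn_eqF.
    by rewrite /= -!(inj_eq val_inj) /= (ltn_eqF ji) (gtn_eqF ji) addrC.
  case/(frame_ind bP (X := X)) => [k|k v [t ->] _|c c0].
  - have [->|km] := eqVneq k ord_max.
      by exists (ord_max, ord_max, false, false); rewrite /= eqxx addr0 scale1r.
    exists (k, Ordinal (lt_hi k km), false, true).
    rewrite /= (b_diff k (Ordinal (lt_hi k km))) // -val_eqE /= ltn_eqF //.
    by rewrite scale1r expr1 scaleN1r.
  - by have [t' _ ->] := monomial_vec t (b_mono k); exists t'.
  - move=> H; exists c => //; apply: sortX; case: H => [//|[[[[i j] s] s'] E]].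
    exists (i, j, ~~ s, ~~ s'); rewrite -[LHS]opprK E /= opprD !signrN scaleNr.
    by case: eqP; rewrite ?oppr0 // scaleNr.
have ray_d : forall k l, k != l -> ray Phi (e k - e l).
  apply: (ray_diff Phi_root e_dot) => k l lk; rewrite -b_diff //.
  exact: frame_root bP k.
have ray_u k : ray Phi (e k).
  have um : ray Phi (e ord_max) by rewrite -b_max; exact: frame_root bP _.
  have [->//|km] := eqVneq k ord_max.
  have -> : e k = refl dot (e k - e ord_max) (e ord_max) by rewrite (refl_diff e_dot) // tpermR.
  by apply: (ray_refl Phi_root) um; exact: ray_d.
have ray_sgn (s : bool) v : ray Phi v -> ray Phi ((-1) ^+ s *: v).
  by case: s => rv; rewrite ?expr1 ?scaleN1r ?scale1r //; exact: (ray_opp Phi_root).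
have ray_vec (t : label n) : ray Phi (vec e t).
  case: t => -[[i j] s] s' /=; case: eqP => [_|/eqP ij]; first by rewrite addr0; exact: ray_sgn.
  have rd : ray Phi (e i + e j).
    have -> : e i + e j = refl dot (e j) (e i - e j).
      by rewrite linearB /= !(refl_unit e_dot) (negPf ij) eqxx scale1r expr1 scaleN1r opprK.
    by apply: (ray_refl Phi_root); [exact: ray_u | exact: ray_d].
  case: s s' => -[]; rewrite ?expr0 ?expr1 ?scale1r ?scaleN1r -?opprD.
  - exact: (ray_opp Phi_root).
  - by rewrite addrC; apply: ray_d; rewrite eq_sym.
  - exact: ray_d.
  - exact: rd.
split=> [D freeD|].
  have [f f_inj fP] := label_roots Phi_root M_cover (ord0, ord0, false, false).
  have [DPhi _ _] := freeD.
  pose key (t : label n) := if t.1.1.1 == t.1.1.2 then None else Some t.1.1.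
  have sum_ray a c v (x : R) : a \in D -> c \in D -> a != c -> 0 < x ->
      vec e (f a) + vec e (f c) = x *: v -> ray Phi v -> False.
    move=> aD cD ac x0 E rv; have [[_ [y y0 yE]] [_ [z z0 zE]]] := (fP a (DPhi a aD), fP c (DPhi c cD)).
    by apply: (convex_free_ray_cone Phi_root freeD aD cD y0 z0 ac x0 rv); rewrite yE zE.
  have opp_vec a c : a \in D -> c \in D -> vec e (f a) <> - vec e (f c).
    move=> aD cD; have [[_ [y y0 <-]] [_ [z z0 <-]]] := (fP a (DPhi a aD), fP c (DPhi c cD)).
    exact: (convex_free_ray_opp Phi_root freeD).
  have key_inj : {in D &, injective (key \o f)}.
    move=> a c aD cD /= kE; apply/eqP/contraT => ac; exfalso.
    have fac : vec e (f a) <> vec e (f c).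
      have [[_ [y y0 <-]] [_ [z z0 <-]]] := (fP a (DPhi a aD), fP c (DPhi c cD)).
      by move/(ray_inj Phi_root (DPhi a aD) (DPhi c cD) y0 z0)/eqP; rewrite (negPf ac).
    have := opp_vec a c aD cD; have := fun v x => sum_ray a c v x aD cD ac.
    move: fac kE; rewrite /key; case: (f a) (f c) => -[[i j] s] s' [[[i' j'] t] t'] /=.
    case: (eqVneq i j) => [ij|ij]; case: (eqVneq i' j') => [ij'|ij'] //.
      rewrite !addr0 => fac _; have [ii|ii] := eqVneq i i'.
        have [st|st] := eqVneq s t; first by case: fac; rewrite ii st.
        have -> : t = ~~ s by case: s t st {fac} => -[].
        by move=> _ []; rewrite ii signrN scaleNr opprK.
      move=> H _; apply: (H (vec e (i, i', s, t)) 1) => //.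
      by rewrite /= (negPf ii) scale1r.
    move=> fac [ii jj]; rewrite -ii -jj in fac *.
    have [st|st] := eqVneq s t; have [st'|st'] := eqVneq s' t'.
    - by case: fac; rewrite st st'.
    - have -> : t' = ~~ s' by case: s' t' st' {fac} => -[].
      move=> H _; apply: (H ((-1) ^+ s *: e i) 2) => //; last exact: ray_sgn.
      by rewrite -st signrN scaleNr addrACA subrr addr0 scaler_nat mulr2n.
    - have -> : t = ~~ s by case: s t st {fac} => -[].
      move=> H _; apply: (H ((-1) ^+ s' *: e j) 2) => //; last exact: ray_sgn.
      by rewrite -st' signrN scaleNr addrACA subrr add0r scaler_nat mulr2n.
    - have -> : t = ~~ s by case: s t st {fac} => -[].
      have -> : t' = ~~ s' by case: s' t' st' {fac} => -[].
      by move=> _ []; rewrite !signrN !scaleNr -opprD opprK.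
  have K_uniq : uniq [seq key (f a) | a <- D].
    by rewrite (map_inj_in_uniq key_inj) fset_uniq.
  pose pairs := [set p : 'I_n * 'I_n | (p.1 < p.2)%N].
  have -> : #|` D| = size [seq key (f a) | a <- D] by rewrite size_map.
  have -> : ('C(n, 2) + 1)%N = size (None :: map Some (enum pairs)).
    by rewrite /= size_map -cardE card_lt_pairs addn1.
  apply: (@uniq_leq_size _ _ (None :: map Some (enum pairs))) => // _ /mapP[a aD ->].
  have [/andP[ij _] _] := fP a (DPhi a aD).
  rewrite /key; case: (eqVneq (f a).1.1.1 (f a).1.1.2) => ij'; first exact: mem_head.
  rewrite inE /=.
  apply/mapP; exists (f a).1.1 => //.
  by rewrite mem_enum inE ltn_neqAle ij andbT; move: ij'; rewrite -val_eqE.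
pose S := (ord0, ord0, false, false) ::
  [seq (p, false, false) | p <- enum [set p : 'I_n * 'I_n | (p.1 < p.2)%N]].
have SP (t : label n) : t \in S -> t = (ord0, ord0, false, false) \/
    (t.1.1.1 < t.1.1.2)%N /\ t = (t.1.1, false, false).
  rewrite inE => /orP[/eqP|/mapP[p]]; first by left.
  by rewrite mem_enum inE => lt_p ->; right.
have sizeS : size S = ('C(n, 2) + 1)%N by rewrite /= size_map -cardE card_lt_pairs addn1.
rewrite -sizeS; apply: (convex_free_family Phi_root M_cover).
- rewrite /= map_inj_uniq ?enum_uniq ?andbT; last by move=> p q [].
  by apply/mapP => -[[p q]]; rewrite mem_enum inE /= => lt_p [p0 q0]; rewrite -p0 -q0 in lt_p.
- by move=> t _; exact: ray_vec.
- have [u uE] := vec_functional e_dot (fun=> 1); exists u => t /SP[->|[lt_t ->]]; rewrite uE /=.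
    by rewrite ?eqxx; lra.
  by move: lt_t; case: t => -[[i j] s] s' /= lt_t; rewrite -val_eqE /= ltn_eqF //; lra.
move=> [[[p q] s] s'] /andP[pq pqs]; rewrite /= in pq pqs.
pose w (k : 'I_n) : R :=
  if p == q then if s then 1 else if k == p then -1 else 2
  else if s && s' then 1
  else if s then if k == p then 2 else 1
  else if s' then if k == q then 2 else 1
  else if p == ord0 then if k == ord0 then 1 else if k == q then -2 else 3
  else if (k == p) || (k == q) then -1 else 2.
have [u uE] := vec_functional e_dot w.
have u0 : dot u (vec e (ord0, ord0, false, false)) = w ord0.
  by rewrite uE /= expr0 mul1r addr0.
have uij (i j : 'I_n) : (i < j)%N -> dot u (vec e (i, j, false, false)) = w i + w j.
  by move=> ij; rewrite uE /= -val_eqE /= ltn_eqF // expr0 !mul1r.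
exists u => [|t /SP[->|[lt_t ->]]].
- rewrite uE /w; clear w uE u0 uij.
  have [_|pq'] := eqVneq p q; first by rewrite eqxx; case: s; rewrite ?expr1 ?expr0; lra.
  case: s s' {pqs} => -[] /=; rewrite ?eqxx ?(eq_sym q) ?(negPf pq') ?expr1 ?expr0 ?mul1r ?mulN1r; try lra.
  by case: (eqVneq p ord0) => [p0|_]; rewrite -?p0 ?(eq_sym q) ?(negPf pq') ?eqxx ?orbT /=; lra.
- rewrite u0 /w !(eq_sym ord0); clear w uE u0 uij => t0.
  have [pq'|pq'] := eqVneq p q.
    case: s t0 => t0; first by lra.
    case: eqP => p0; last by lra.
    by case/eqP: t0; move: pqs; rewrite -pq' p0 eqxx /=; case: s'.
  case: s {t0} => /=; first by case: s' {pqs} => /=; [|case: eqP => _]; lra.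
  case: s' {pqs} => /=; first by case: eqP => _; lra.
  case: eqP => p0 /=; first by lra.
  case: eqP => q0; last by lra.
  by case: p0; apply/val_inj; move: pq; rewrite q0 leqn0 => /eqP.
case: t lt_t => -[[i j] ? ?] /= lt_ij t0.
have ij : (i == j) = false by rewrite -val_eqE /= ltn_eqF.
rewrite uij // /w; clear w uE u0 uij.
have [pq'|pq'] := eqVneq p q.
  case: s {t0} => /=; first by lra.
  case: (eqVneq i p) => [ip|_]; case: (eqVneq j p) => [jp|_]; try lra.
  by rewrite ip jp eqxx in ij.
case: s t0 => /=.
  by case: s' {pqs} => /=; do ?[case: eqP => _]; lra.
case: s' {pqs} => /= t0; first by do 2 case: eqP => _; lra.
have t0' : (i, j) != (p, q) by apply: contraNneq t0 => ->.
case: (eqVneq p ord0) => p0.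
  case: (eqVneq j ord0) => [j0|_]; first by rewrite j0 in lt_ij.
  case: (eqVneq j q) => [jq|jq]; case: (eqVneq i ord0) => [i0|i0]; case: (eqVneq i q) => [iq|iq]; try lra.
  - by rewrite jq i0 p0 eqxx in t0'.
  - by rewrite jq i0 p0 eqxx in t0'.
  - by rewrite jq iq eqxx in ij.
case: (eqVneq i p) => [ip|ip]; case: (eqVneq j q) => [jq|jq]; case: (eqVneq i q) => [iq|iq]; case: (eqVneq j p) => [jp|jp] /=; try lra.
all: try by rewrite ip jq eqxx in t0'.
all: try by rewrite ip jp eqxx in ij.
all: try by rewrite iq jq eqxx in ij.
all: by move: lt_ij; rewrite iq jp ltnNge pq.
Qed.
End TypeB.

(** * Counting signed pairs *)

Section SignedPairs.
Variable n : nat.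
Implicit Types (t : label n) (S : seq (label n)) (i j k l : 'I_n).

Definition on t i k : bool := ((t.1.1.1 == i) && (t.1.1.2 == k)) || ((t.1.1.1 == k) && (t.1.1.2 == i)).
Definition sign t i : bool := if i == t.1.1.1 then t.1.2 else t.2.

Variable S : seq (label n).
Hypotheses (S_uniq : uniq S) (S_lt : forall t, t \in S -> (t.1.1.1 < t.1.1.2)%N).
Hypothesis S_opp : forall i k t t', t \in S -> t' \in S -> on t i k -> on t' i k ->
  sign t i != sign t' i -> sign t k != sign t' k -> False.
Hypothesis S_agree : forall i k l t t', t \in S -> t' \in S -> on t i k -> on t' i l ->
  k != l -> sign t i = sign t' i.

Let mult i k : nat := count (fun t => on t i k) S.
(* By [S_agree], no other pair then carries an element at [i]. *)
Let leaf i k : bool := has (fun t => has (fun t' =>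
  [&& on t i k, on t' i k & sign t i != sign t' i]) S) S.

Lemma onC t i k : on t i k = on t k i.
Proof. by rewrite /on orbC. Qed.

Lemma on_neq t i k : t \in S -> on t i k -> i != k.
Proof.
move=> /S_lt lt_t; apply: contraTneq => ->; rewrite /on orbb; apply/andP => -[/eqP ti /eqP tk].
by rewrite ti tk ltnn in lt_t.
Qed.

Lemma on_inj t t' i k : t \in S -> t' \in S -> on t i k -> on t' i k ->
  sign t i = sign t' i -> sign t k = sign t' k -> t = t'.
Proof.
case: t t' => -[[a c] s] s' [[[a' c'] r] r'] tS t'S ti t'i Ei Ek.
have /= lt := S_lt tS; have /= lt' := S_lt t'S.
have ac : (c == a) = false by rewrite -val_eqE /= (gtn_eqF lt).
have [aE cE] : a = a' /\ c = c'.
  case/orP: ti => /andP[/eqP /= ai /eqP /= ck]; case/orP: t'i => /andP[/eqP /= a'i /eqP /= c'k].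
  - by rewrite ai ck a'i c'k.
  - by move: lt lt'; rewrite ai ck a'i c'k => lt /(ltn_trans lt); rewrite ltnn.
  - by move: lt lt'; rewrite ai ck a'i c'k => lt /(ltn_trans lt); rewrite ltnn.
  - by rewrite ai ck a'i c'k.
rewrite -aE -cE in Ei Ek *; move: Ei Ek; rewrite /sign /=.
by case/orP: ti => /andP[/eqP /= <- /eqP /= <-]; rewrite eqxx ac => -> ->.
Qed.

Lemma mult_le2 i k : (mult i k <= 2)%N /\ (mult i k <= 1 + leaf i k + leaf k i)%N.
Proof.
pose F := [seq t <- S | on t i k].
have FP t : t \in F -> t \in S /\ on t i k by rewrite mem_filter => /andP[].
have F_uniq : uniq F by rewrite filter_uniq.
have mE : mult i k = size F by rewrite size_filter.
have g_inj : {in F &, injective (fun t => sign t i (+) sign t k)}.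
  move=> t t' /FP[tS ti] /FP[t'S t'i] E.
  have [Ei|Ei] := eqVneq (sign t i) (sign t' i).
    by apply: (on_inj tS t'S ti t'i Ei); move: E; rewrite Ei => /addbI.
  case: (S_opp tS t'S ti t'i Ei).
  by move: E Ei; do 4 case: (sign _ _).
have F2 : (size F <= 2)%N.
  rewrite -(size_map (fun t => sign t i (+) sign t k)) -card_bool.
  apply: leq_trans (max_card (mem (map (fun t => sign t i (+) sign t k) F))).
  by rewrite (card_uniqP _) // map_inj_in_uniq.
split; rewrite mE //.
case EF : F => [//|t [|t' F']]; first by rewrite /= -addnA leq_addr.
rewrite /=.
have tF : t \in F by rewrite EF mem_head.
have t'F : t' \in F by rewrite EF !inE eqxx orbT.
have F'0 : size F' = 0%N by move: F2; rewrite EF /= => ?; lia.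
have tt' : t != t' by move: F_uniq; rewrite EF /= inE negb_or => /andP[/andP[]].
have [[tS ti] [t'S t'i]] := (FP t tF, FP t' t'F).
rewrite F'0; have [Ei|Ei] := eqVneq (sign t i) (sign t' i).
  suff -> : leaf k i by case: (leaf i k).
  apply/hasP; exists t => //; apply/hasP; exists t' => //; rewrite -!(onC _ i) ti t'i /=.
  by apply: contraNneq tt' => Ek; apply/eqP; exact: on_inj Ei Ek.
suff -> : leaf i k by [].
by apply/hasP; exists t => //; apply/hasP; exists t' => //; rewrite ti t'i.
Qed.

Lemma leaf_mult i k j : leaf i k -> j != k -> mult i j = 0%N.
Proof.
move=> /hasP[t tS /hasP[t' t'S /and3P[ti t'i ne]]] jk.
apply/eqP; rewrite -leqn0 leqNgt -has_count; apply/hasP => -[r rS ri].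
have kj : k != j by rewrite eq_sym.
by move: ne; rewrite (S_agree tS rS ti ri kj) (S_agree t'S rS t'i ri kj) eqxx.
Qed.

(** A leaf [i] lies on the pair with its head only, which carries two elements; the
    head passes one unit of their contribution to the leaf. Then a leaf has 3 units
    and any other index at most one unit for each of the others. *)
Lemma size_signed_pairs : (3 < n)%N -> (2 * size S <= n * n.-1)%N.
Proof.
move=> n3.
have sum_mult : (\sum_i \sum_k mult i k = 2 * size S)%N.
  have -> : (2 * size S = \sum_(t <- S) 2)%N by rewrite big_const_seq count_predT iter_addn_0.
  rewrite /mult; under eq_bigr do under eq_bigr do rewrite -sum1_count big_mkcond /=.
  under eq_bigr do rewrite exchange_big /=.
  rewrite exchange_big /= !big_seq; apply: eq_bigr => -[[[a c] s] s'] tS.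
  have /= ac := on_neq tS (_ : on (a, c, s, s') a c).
  rewrite pair_big /= -big_mkcond /= sum1_card.
  rewrite (@eq_card _ _ (mem [:: (a, c); (c, a)])) => [|[i k]].
    rewrite (card_uniqP _) //= inE andbT xpair_eqE negb_and.
    by rewrite ac // /on /= !eqxx.
  by rewrite [RHS]inE !inE unfold_in /= /on /= !xpair_eqE !(eq_sym _ i) !(eq_sym _ k) [(k == a) && _]andbC.
have row i : (\sum_k (mult i k + leaf i k) <= n.-1 + \sum_k leaf k i)%N.
  have multii : mult i i = 0%N.
    apply/eqP; rewrite -leqn0 leqNgt -has_count; apply/hasP => -[t tS /(on_neq tS)].
    by rewrite eqxx.
  have leafii : leaf i i = false.
    apply/negP => /hasP[t tS /hasP[t' _ /and3P[/(on_neq tS)]]]; by rewrite eqxx.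
  have [/existsP[k ik]|/existsPn no_leaf] := boolP [exists k, leaf i k].
    rewrite (bigD1 k) //= big1 => [|j jk].
      rewrite addn0 ik; have [m2 _] := mult_le2 i k.
      by apply: leq_trans (leq_addr _ _); rewrite addn1; lia.
    rewrite (leaf_mult ik jk) add0n; apply/eqP; rewrite eqb0; apply/negP => ij.
    have : (0 < mult i j)%N.
      move: ij => /hasP[t tS /hasP[t' _ /and3P[ti _ _]]].
      by rewrite -has_count; apply/hasP; exists t.
    by rewrite (leaf_mult ik jk).
  rewrite (bigD1 i) //= multii leafii add0n.
  apply: (@leq_trans (\sum_(k | k != i) (1 + leaf k i))%N).
    apply: leq_sum => k ki; rewrite (negPf (no_leaf k)) addn0.
    by have [_] := mult_le2 i k; rewrite (negPf (no_leaf k)) addn0.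
  rewrite big_split /= sum1_card leq_add //.
    by rewrite (cardC1 i) card_ord.
  by rewrite [X in (_ <= X)%N](bigD1 i) //= leafii.
have : (\sum_i \sum_k (mult i k + leaf i k) <= \sum_(i < n) (n.-1 + \sum_k leaf k i))%N.
  by apply: leq_sum => i _; exact: row.
under eq_bigr do rewrite big_split /=.
rewrite !big_split /= sum_mult [X in (_ <= _ + X)%N]exchange_big leq_add2r.
by rewrite sum_nat_const card_ord.
Qed.
End SignedPairs.

(** * Type D *)

Section TypeD.
Variables (R : realType) (V : vectType R) (dot : {dot V for idfun}).
Variables (Phi : {fset V}) (Phi_root : root_system dot fullv Phi).
Variable m : nat.
Local Notation n := m.+1.
Definition typeD_adj (i j : nat) : bool :=
  (j == i.+1) && (j < m)%N || (i == m - 2)%N && (j == m).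
Definition typeD_gram (i j : 'I_n) : R :=
  if i == j then 2 else if typeD_adj i j || typeD_adj j i then -1 else 0.
Variables (b : 'I_n -> V) (bP : frame dot Phi typeD_gram b).
Hypothesis m3 : (2 < m)%N.

(** All basis vectors but the last are differences as in type A; the branch of the
    diagram forces the last vector of the frame to be [e m.-1 + e m]. *)
Lemma typeD_basis : exists e : 'I_n -> V,
  [/\ forall i j, dot (e i) (e j) = (i == j)%:R,
      forall k l : 'I_n, l = k.+1 :> nat -> b k = e k - e l &
      forall k l : 'I_n, m = k.+1 -> m = l -> b l = e k + e l].
Proof.
have [e eE] := boolp.choice (fun j : nat => frame_dual bP (fun k : 'I_n =>
  if (k == m :> nat) then (j.+1 == m)%:R + (j == m)%:R
  else (j == k)%:R - (j == k.+1)%:R)).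
have bE (k : 'I_n) : b k = if (k == m :> nat) then e m.-1 + e m else e k - e k.+1.
  apply/eqP; rewrite -subr_eq0; apply/eqP/(frame_inj bP) => l.
  rewrite dotBl (frame_dot bP) /typeD_gram /= -(inj_eq val_inj) /=.
  have [lt_k lt_l] := (ltn_ord k, ltn_ord l).
  have [km|km] := eqVneq (k : nat) m; have [lm|lm] := eqVneq (l : nat) m;
    rewrite ?dotDl ?dotNl !eE /typeD_adj.
  - by do ?[case: eqP => ?; try by exfalso; lia]; do ?[case: ltnP => ?; try by exfalso; lia] => /=; lra.
  - by do ?[case: eqP => ?; try by exfalso; lia]; do ?[case: ltnP => ?; try by exfalso; lia] => /=; lra.
  - by do ?[case: eqP => ?; try by exfalso; lia]; do ?[case: ltnP => ?; try by exfalso; lia] => /=; lra.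
  - by do ?[case: eqP => ?; try by exfalso; lia]; do ?[case: ltnP => ?; try by exfalso; lia] => /=; lra.
have e_last i : dot (e i) (e m) = (i == m)%:R.
  have lt_m : (m.-1 < n)%N by lia.
  have := bE ord_max; have := bE (Ordinal lt_m); rewrite /= eqxx prednK; last by lia.
  rewrite ifN; last by apply/eqP; lia.
  move=> b1 b2; have : dot (e i) (b ord_max) - dot (e i) (b (Ordinal lt_m)) = 2 * dot (e i) (e m).
    by rewrite b1 b2 dotDr dotBr; lra.
  rewrite !eE /= eqxx; do ?[case: eqP => ?] => /=; (lra || lia).
have e_dot i j : (j < n)%N -> dot (e i) (e j) = (i == j)%:R.
  move=> lt_jn; have -> : j = (m - (m - j))%N by lia.
  elim: (m - j)%N (leq_subr j m) => [|d IH] dm; first by rewrite subn0 e_last.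
  have lt_n : (m - d.+1 < n)%N by lia.
  have jE : ((m - d.+1).+1 = m - d)%N by lia.
  have := bE (Ordinal lt_n); rewrite /= ifN => [bj|]; last by apply/eqP; lia.
  have -> : e (m - d.+1)%N = b (Ordinal lt_n) + e (m - d)%N by rewrite bj jE subrK.
  rewrite dotDr eE /= IH ?(ltnW dm) // jE ifN; last by apply/eqP; lia.
  by rewrite subrK.
exists (fun i => e i); split=> [i j|k l lk|k l mk ml].
- by rewrite e_dot.
- by rewrite bE ifN ?lk //; have := ltn_ord l; rewrite lk; lia.
- by rewrite bE -ml eqxx; congr (e _ + _); lia.
Qed.

Lemma typeD_cover (e : 'I_n -> V) :
  (forall i j, dot (e i) (e j) = (i == j)%:R) ->
  (forall k l : 'I_n, l = k.+1 :> nat -> b k = e k - e l) ->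
  (forall k l : 'I_n, m = k.+1 -> m = l -> b l = e k + e l) ->
  (forall a, a \in Phi -> exists2 c : R, 0 < c &
     exists2 t : label n, (t.1.1.1 < t.1.1.2)%N & c *: a = vec e t) /\
  (forall i j, i != j -> ray Phi (e i + e j)).
Proof.
move=> e_dot b_diff b_last.
have [p pm] : exists p : 'I_n, m = p.+1 by exists (inord m.-1); rewrite inordK; lia.
have b_max : b ord_max = e p + e ord_max by exact: b_last.
have p_max : p != ord_max by rewrite -val_eqE /=; lia.
have b_mono k : monomial dot e (b k).
  have [->|km] := eqVneq k ord_max; first by rewrite b_max; exact: monomial_sum.
  have lt_k : (k.+1 < n)%N by move: km; rewrite -val_eqE /=; have := ltn_ord k; lia.
  rewrite (b_diff k (Ordinal lt_k)) //; apply: monomial_diff => //.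
  by rewrite -val_eqE /= ltn_eqF.
have ray_d : forall k l, k != l -> ray Phi (e k - e l).
  apply: (ray_diff Phi_root e_dot) => k l lk; rewrite -b_diff //.
  exact: frame_root bP k.
have ray_s k i j : k != j -> i != j -> ray Phi (e k + e j) -> ray Phi (e i + e j).
  move=> kj ij; have [->//|ki] := eqVneq k i.
  have -> : e i + e j = refl dot (e k - e i) (e k + e j).
    by rewrite linearD /= !(refl_diff e_dot) // tpermL tpermD.
  exact: (ray_refl Phi_root) (ray_d _ _ ki).
split=> [a|i j ij].
  pose X v := exists2 t : label n, t.1.1.1 != t.1.1.2 & v = vec e t.
  case/(frame_ind bP (X := X)) => [k|k v [t tP ->] _|c c0 H].
  - have [->|km] := eqVneq k ord_max.
      by exists (p, ord_max, false, false); rewrite //= (negPf p_max) b_max !scale1r.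
    have lt_k : (k.+1 < n)%N by move: km; rewrite -val_eqE /=; have := ltn_ord k; lia.
    have kk : k != Ordinal lt_k by rewrite -val_eqE /= ltn_eqF.
    exists (k, Ordinal lt_k, false, true) => //=.
    by rewrite (negPf kk) (b_diff k (Ordinal lt_k)) // scale1r expr1 scaleN1r.
  - by have [t' t'E ->] := monomial_vec t (b_mono k); exists t'; rewrite // t'E.
  exists c => //; have {H} [t tP ->] : X (c *: a).
    case: H => // -[[[[i j] s] s'] /= ij E]; exists (i, j, ~~ s, ~~ s') => //.
    by rewrite -[LHS]opprK E /= (negPf ij) opprD !signrN !scaleNr.
  case: t tP => -[[i j] s] s' /=; rewrite -val_eqE neq_ltn => /orP[] ij.
    by exists (i, j, s, s').
  exists (j, i, s', s) => //=.
  by rewrite -!(inj_eq val_inj) /= (ltn_eqF ij) (gtn_eqF ij) addrC.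
have r0 : ray Phi (e p + e ord_max) by rewrite -b_max; exact: frame_root bP _.
have [jm|jm] := eqVneq j ord_max.
  by rewrite jm in ij *; exact: ray_s r0.
have [im|im] := eqVneq i ord_max.
  by rewrite im addrC; apply: ray_s r0 => //; rewrite -im.
have r1 : ray Phi (e j + e ord_max) by apply: ray_s r0.
by apply: (ray_s ord_max) => //; [rewrite eq_sym | rewrite addrC].
Qed.

(** Two elements supported on the same pair differ in exactly one sign, and
    acuteness forces elements on different pairs with a common index [i] to have
    the same sign at [i]. This leaves the count of [size_signed_pairs]. *)
Lemma typeD_max :
  (forall D, convex_free dot Phi D -> (#|` D| <= 'C(n, 2))%N) /\
  (exists2 D, convex_free dot Phi D & #|` D| = 'C(n, 2)).
Proof.
have [e [e_dot b_diff b_last]] := typeD_basis.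
have [M_cover ray_s] := typeD_cover e_dot b_diff b_last.
split=> [D freeD|].
  have [f f_inj fP] := label_roots Phi_root M_cover (ord0, ord0, false, false).
  have [DPhi _ _] := freeD; pose S := [seq f a | a <- D].
  have S_uniq : uniq S.
    by rewrite map_inj_in_uniq ?fset_uniq // => a c /DPhi aP /DPhi cP; exact: f_inj.
  have S_lt t : t \in S -> (t.1.1.1 < t.1.1.2)%N.
    by move=> /mapP[a aD ->]; have [] := fP a (DPhi a aD).
  have vecE t i k : t \in S -> on t i k ->
      vec e t = (-1) ^+ sign t i *: e i + (-1) ^+ sign t k *: e k.
    case: t => -[[p q] s] s' /S_lt /= pq.
    have pq' : (p == q) = false by rewrite -val_eqE /= ltn_eqF.
    by case/orP => /andP[/eqP /= <- /eqP /= <-]; rewrite /sign /= eqxx (eq_sym q) pq' // addrC.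
  have S_opp i k t t' : t \in S -> t' \in S -> on t i k -> on t' i k ->
      sign t i != sign t' i -> sign t k != sign t' k -> False.
    move=> tS t'S ti t'i; have := vecE t i k tS ti; have := vecE t' i k t'S t'i.
    move: tS t'S => /mapP[a aD ->] /mapP[c cD ->].
    have [[_ [y y0 <-]] [_ [z z0 <-]]] := (fP a (DPhi a aD), fP c (DPhi c cD)).
    move=> E1 E2 si sk; apply: (convex_free_ray_opp Phi_root freeD aD cD y0 z0).
    rewrite E1 E2 opprD -!scaleNr -!signrN; congr ((-1) ^+ _ *: _ + (-1) ^+ _ *: _).
      by move: si; do 2 case: (sign _ _).
    by move: sk; do 2 case: (sign _ _).
  have S_agree i k l t t' : t \in S -> t' \in S -> on t i k -> on t' i l ->
      k != l -> sign t i = sign t' i.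
    move=> tS t'S ti t'i kl; have ik := on_neq S_lt tS ti; have il := on_neq S_lt t'S t'i.
    have := vecE t i k tS ti; have := vecE t' i l t'S t'i.
    move: tS t'S => /mapP[a aD ->] /mapP[c cD ->].
    have [->//|ac] := eqVneq a c.
    have [[_ [y y0 <-]] [_ [z z0 <-]]] := (fP a (DPhi a aD), fP c (DPhi c cD)).
    move=> E1 E2; have := convex_free_ray_acute Phi_root freeD aD cD y0 z0 ac.
    rewrite E1 E2 !dotDl !dotDr !dotZl !dotZr !e_dot eqxx (negPf kl) (negPf il) (eq_sym k) (negPf ik).
    by do 2 case: (sign _ _); rewrite //= ?expr0 ?expr1; lra.
  have := size_signed_pairs S_uniq S_lt S_opp S_agree m3.
  by rewrite size_map bin2 -divn2 leq_divRL // mulnC.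
pose S : seq (label n) := [seq (p, false, false) | p <- enum [set p : 'I_n * 'I_n | (p.1 < p.2)%N]].
have SP (t : label n) : t \in S -> (t.1.1.1 < t.1.1.2)%N /\ t = (t.1.1, false, false).
  by move=> /mapP[p]; rewrite mem_enum inE => lt_p ->.
have sizeS : size S = 'C(n, 2) by rewrite size_map -cardE card_lt_pairs.
rewrite -sizeS; apply: (convex_free_family Phi_root M_cover).
- by rewrite map_inj_uniq ?enum_uniq // => p q [].
- move=> [[[i j] s] s'] /SP[/= lt_ij [-> ->]].
  have ij : i != j by rewrite -val_eqE /= ltn_eqF.
  by rewrite (negPf ij) !scale1r; exact: ray_s.
- have [u uE] := vec_functional e_dot (fun=> 1); exists u => -[[[i j] s] s'] /SP[/= lt_ij [-> ->]].
  by rewrite (uE (i, j, false, false)) /= -val_eqE /= ltn_eqF //; lra.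
move=> [[[p q] s] s'] lt_pq; rewrite /= in lt_pq.
have pq : p != q by rewrite -val_eqE /= ltn_eqF.
pose w (k : 'I_n) : R :=
  if s && s' then 1
  else if s then if k == p then 2 else 1
  else if s' then if k == q then 2 else 1
  else if (k == p) || (k == q) then -1 else 2.
have [u uE] := vec_functional e_dot w.
have uij (i j : 'I_n) : (i < j)%N -> dot u (vec e (i, j, false, false)) = w i + w j.
  by move=> ij; rewrite uE /= -val_eqE /= ltn_eqF // expr0 !mul1r.
exists u => [|t /SP[lt_t ->]].
  rewrite uE /= (negPf pq) /w; clear w uE uij.
  have qp : (q == p) = false by rewrite eq_sym (negPf pq).
  by case: s s' => -[] /=; rewrite ?eqxx ?qp ?(negPf pq) ?orbT /= ?expr1 ?expr0 ?mul1r ?mulN1r; lra.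
case: t lt_t => -[[i j] ? ?] /= lt_ij t0.
have ij : i != j by rewrite -val_eqE /= ltn_eqF.
rewrite uij // /w; clear w uE uij.
case: s t0 => /=; first by case: s' => /=; do ?[case: eqP => _]; lra.
case: s' => /= t0; first by do 2 case: eqP => _; lra.
have t0' : (i, j) != (p, q) by apply: contraNneq t0 => ->.
case: (eqVneq i p) => [ip|ip]; case: (eqVneq j q) => [jq|jq]; case: (eqVneq i q) => [iq|iq]; case: (eqVneq j p) => [jp|jp] /=; try lra.
all: try by rewrite ip jq eqxx in t0'.
all: try by rewrite ip jp eqxx in ij.
all: try by rewrite iq jq eqxx in ij.
all: by move: lt_ij; rewrite iq jp ltnNge ltnW.
Qed.
End TypeD.

(** * Rank two *)

Section RankTwo.
Variables (R : realType) (V : vectType R) (dot : {dot V for idfun}).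
Variables (Phi : {fset V}) (Phi_root : root_system dot fullv Phi).
Variables (D : 2.-tuple V) (D_simple : simple_system Phi D).
Local Notation a i := (tnth D i).
Local Notation i0 := (ord0 : 'I_2).
Local Notation i1 := (lift ord0 ord0 : 'I_2).

(** Of three vectors of a half-plane, one lies in the cone of the other two. *)
Lemma rank2_le F : convex_free dot Phi F -> (#|` F| <= 2)%N.
Proof.
move=> freeF; rewrite leqNgt; apply/negP => F3.
have [FPhi [u uF] _] := freeF.
pose x (i : 'I_3) := nth 0 F i.
have xF i : x i \in F by apply: mem_nth; exact: leq_trans (ltn_ord i) F3.
have x_neq i j : i != j -> x i != x j.
  by rewrite nth_uniq ?fset_uniq //; exact: leq_trans (ltn_ord _) F3.
have [_ Dbasis _] := D_simple.
have /freeP nfree : ~~ free [tuple x i | i < 3].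
  apply/negP => /eqP; rewrite size_tuple => dim3.
  have := dimvS (subvf <<[tuple x i | i < 3]>>%VS).
  by rewrite dim3 (size_basis (U := fullv) (X := D) Dbasis).
have [k k0 [i ki]] : exists2 k : 'I_3 -> R, \sum_i k i *: x i = 0 & exists i, k i != 0.
  apply: contrapT => H; apply: nfree => k k0 i; apply/eqP/contraT => ki; case: H.
  exists k; last by exists i.
  by rewrite -[RHS]k0; apply: eq_bigr => j _; rewrite -tnth_nth tnth_mktuple.
(* A relation with one positive coefficient writes that vector as a nonnegative
   combination of the others. *)
have absurd (l : 'I_3 -> R) j : \sum_i l i *: x i = 0 -> 0 < l j -> 
    (forall i, i != j -> l i <= 0) -> False.
  move=> l0 lj ln.
  pose s := [seq (- l i / l j, x i) | i <- enum 'I_3 & i != j].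
  have sP p : p \in s -> [/\ 0 <= p.1, p.2 \in F & p.2 != x j].
    move=> /mapP[h]; rewrite mem_filter => /andP[hj _] -> /=; split=> //; last exact: x_neq.
    by rewrite divr_ge0 ?oppr_ge0 ?ln // ltW.
  have /eqP[] := convex_free_cone freeF (FPhi _ (xF j)) sP.
  rewrite big_map big_filter big_enum_cond /=.
  move: l0; rewrite (bigD1 j) //= => /eqP; rewrite addr_eq0 => /eqP E.
  have lj0 : l j != 0 by rewrite gt_eqF.
  apply: (scalerI lj0); rewrite E scaler_sumr -sumrN.
  by apply: eq_bigr => h _; rewrite scalerA mulrC divfK ?gt_eqF // scaleNr.
have u_sum : \sum_i k i * dot u (x i) = 0.
  by rewrite -[RHS](dot0r dot u) -k0 dot_sumr; apply: eq_bigr => j _; rewrite dotZr.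
have ux j : 0 < dot u (x j) by exact: uF.
have one_pos (l : 'I_3 -> R) : \sum_i l i * dot u (x i) = 0 -> l i != 0 -> exists j, 0 < l j.
  move=> lsum li; apply/existsP; apply: contraLR li => /existsPn ln; rewrite negbK.
  have ln0 j : true -> l j * dot u (x j) <= 0 by rewrite pmulr_lle0 // leNgt.
  have := lsum; move/eqP; rewrite -oppr_eq0 -sumrN psumr_eq0 => [/allP/(_ i)|j _].
    by rewrite mem_index_enum oppr_eq0 mulf_eq0 (gt_eqF (ux i)) orbF; apply.
  by rewrite oppr_ge0 ln0.
have [p kp] := one_pos k u_sum ki.
have [q] : exists q, 0 < - k q.
  apply: (one_pos (fun j => - k j)); last by rewrite oppr_eq0.
  by under eq_bigr do rewrite mulNr; rewrite sumrN u_sum oppr0.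
rewrite oppr_gt0 => kq.
have [/existsP[p' /andP[pp' kp']]|/existsPn one] := boolP [exists j, (j != p) && (0 < k j)]; last first.
  apply: (absurd k p) => // j jp; have := one j; rewrite jp /= => ?; by rewrite leNgt.
apply: (absurd (fun j => - k j) q); rewrite ?oppr_gt0 //.
  by under eq_bigr do rewrite scaleNr; rewrite sumrN k0 oppr0.
move=> j jq; rewrite oppr_le0 leNgt; apply/negP => kj.
have : uniq [:: p; p'; q; j].
  have ne h l : 0 < k h -> k l < 0 -> h != l.
    by move=> kh kl; apply: contraTneq kh => ->; rewrite lt_gtF.
  by rewrite /= !inE !negb_or (eq_sym p) pp' (eq_sym q) jq !ne.
by move=> /card_uniqP E; have := max_card (mem [:: p; p'; q; j]); rewrite E card_ord.
Qed.

(** A simple root and the positive root nearest to it form a free set. *)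
Lemma rank2_max : (forall F, convex_free dot Phi F -> (#|` F| <= 2)%N) /\
  (exists2 F, convex_free dot Phi F & #|` F| = 2%N).
Proof.
split; first exact: rank2_le.
have aP i := simple_root D_simple i.
have c_simple := coord_simple D_simple.
have c_sum v : v = coord D i0 v *: a i0 + coord D i1 v *: a i1.
  by rewrite {1}(simple_sum D_simple v) big_ord_recl big_ord1.
have functional (p q : R) : exists u, forall v, dot u v = coord D i0 v * p + coord D i1 v * q.
  have [u uE] := simple_dual dot D_simple (fun i => if i == i0 then p else q).
  by exists u => v; rewrite {1}(c_sum v) dotDr !dotZr !uE eqxx.
pose slope v := coord D i0 v / coord D i1 v.
pose P (v : Phi) := 0 < coord D i1 (val v).
have P1 : P [` aP i1]%fset by rewrite /P /= c_simple eqxx ltr01.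
case: (arg_maxP (fun v : Phi => slope (val v)) P1) => -[b bP] /=; rewrite /P /= => b1 b_max.
have b0 : 0 <= coord D i0 b.
  by have [//|bn] := root_sign D_simple bP; have := bn i1; rewrite leNgt b1.
have ba : b != a i0 by apply: contraTneq b1 => ->; rewrite c_simple /= ltxx.
have prop v : v \in Phi -> 0 < coord D i1 v -> slope v = slope b -> v = b.
  move=> vP v1 E; apply: (root_propp Phi_root bP vP (c := coord D i1 v / coord D i1 b)).
    exact: divr_gt0.
  rewrite {1}(c_sum v) [X in _ = _ *: X](c_sum b) scalerDr !scalerA divfK ?gt_eqF //.
  by congr (_ *: _ + _); rewrite mulrAC -mulrA -/(slope b) -E mulrC divfK ?gt_eqF.
exists [fset a i0; b]%fset; last by rewrite cardfs2 eq_sym ba.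
have inF v : v \in [fset a i0; b]%fset -> v = a i0 \/ v = b.
  by rewrite !inE => /orP[]/eqP ->; [left | right].
have ca0 : coord D i0 (a i0) = 1 by rewrite c_simple.
have ca1 : coord D i1 (a i0) = 0 by rewrite c_simple.
split=> [v /inF[]-> //||c cP].
  have [u uE] := functional 1 1; exists u => v /inF[]->; rewrite uE ?ca0 ?ca1; first by lra.
  by rewrite !mulr1 ltr_wpDl.
set p := coord D i0 b in b0 *; set q := coord D i1 b in b1 *.
have qE : q * ((p + 1) / q) = p + 1 by rewrite mulrC divfK ?gt_eqF.
have [->|cb] := eqVneq c b.
  have [u uE] := functional 1 (- ((p + 1) / q)); exists u => [|v /inF[]->].
  - by rewrite uE -/p -/q mulrN qE; lra.
  - by rewrite uE ca0 ca1; lra.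
  - by rewrite eqxx.
have [->|ca] := eqVneq c (a i0).
  have [u uE] := functional (-1) ((p + 1) / q); exists u => [|v /inF[]->].
  - by rewrite uE ca0 ca1; lra.
  - by rewrite eqxx.
  - by rewrite uE -/p -/q qE; lra.
have [c0|c0] := root_sign D_simple cP; last first.
  have [u uE] := functional 1 1; exists u => [|v /inF[]-> _]; rewrite uE ?ca0 ?ca1 -/p -/q; try lra.
  rewrite lt_neqAle; apply/andP; split; last by have := c0 i0; have := c0 i1; lra.
  apply/eqP => E; have [c00 c01] : coord D i0 c = 0 /\ coord D i1 c = 0.
    by have := c0 i0; have := c0 i1; split; lra.
  by have := root_n0 Phi_root cP; rewrite (c_sum c) c00 c01 !scale0r addr0 eqxx.
have c1 : 0 < coord D i1 c.
  rewrite lt_neqAle c0 andbT; apply/eqP => c10.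
  have cE : c = coord D i0 c *: a i0 by rewrite {1}(c_sum c) -c10 scale0r addr0.
  have c00 : 0 < coord D i0 c.
    rewrite lt_neqAle c0 andbT eq_sym; apply/eqP => E.
    by have := root_n0 Phi_root cP; rewrite cE E scale0r eqxx.
  by case/eqP: ca; exact: (root_propp Phi_root (aP i0) cP c00 cE).
have lt_s : slope c < slope b.
  rewrite lt_neqAle; apply/andP; split; last by apply: (b_max [` cP]%fset).
  by apply: contraNneq cb => E; apply/eqP/prop.
have [s /andP[cs sb]] : exists s, slope c < s < slope b.
  by exists ((slope c + slope b) / 2); rewrite !midf_lt.
have [u uE] := functional 1 (- s); exists u => [|v /inF[]-> _]; rewrite uE ?ca0 ?ca1 -/p -/q.
- by move: cs; rewrite /slope ltr_pdivrMr //; lra.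
- by lra.
- by move: sb; rewrite /slope -/p -/q ltr_pdivlMr //; lra.
Qed.
End RankTwo.

(** * Root coordinates over the golden integers *)

(** [(a, b)] stands for [a + b phi]. *)
Notation gold := (Z * Z)%type.

Definition g0 : gold := (Z0, Z0).
Definition g1 : gold := (Zpos 1, Z0).
Definition g2 : gold := (Zpos 2, Z0).
Definition gphi : gold := (Z0, Zpos 1).
Definition gadd (x y : gold) : gold := (Z.add x.1 y.1, Z.add x.2 y.2).
Definition gopp (x : gold) : gold := (Z.opp x.1, Z.opp x.2).
Definition gmul (x y : gold) : gold :=
  let t := Z.mul x.2 y.2 in
  (Z.add (Z.mul x.1 y.1) t, Z.add (Z.add (Z.mul x.1 y.2) (Z.mul x.2 y.1)) t).
Definition geq (x y : gold) : bool := Z.eqb x.1 y.1 && Z.eqb x.2 y.2.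

(** The sign of [a + b phi] is decided by its norm [a^2 + a b - b^2] when [a] and
    [b] have opposite signs, since the conjugate of [phi] is negative. *)
Definition gpos (x : gold) : bool :=
  let: (a, b) := x in
  let norm := Z.sub (Z.add (Z.mul a a) (Z.mul a b)) (Z.mul b b) in
  if Z.leb 0 a then
    if Z.leb 0 b then Z.ltb 0 a || Z.ltb 0 b else Z.ltb 0 norm
  else if Z.leb 0 b then Z.ltb norm 0 else false.
Definition gneg (x : gold) : bool := gpos (gopp x).

Section Embedding.
Variable R : realType.

Definition emb (x : gold) : R :=
  (int_of_Z x.1)%:~R + (int_of_Z x.2)%:~R * phi R.

Lemma emb_add x y : emb (gadd x y) = emb x + emb y.
Proof. rewrite /emb /= !(rmorphD int_of_Z) !intrD; ring. Qed.

Lemma emb_opp x : emb (gopp x) = - emb x.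
Proof. rewrite /emb /= !(rmorphN int_of_Z) !intrN; ring. Qed.

Lemma emb_mul x y : emb (gmul x y) = emb x * emb y.
Proof.
case: x y => x1 x2 [y1 y2]; rewrite /emb /=.
rewrite !(rmorphD int_of_Z) !(rmorphM int_of_Z) !intrD !intrM.
move: (int_of_Z x1)%:~R (int_of_Z x2)%:~R (int_of_Z y1)%:~R (int_of_Z y2)%:~R => a b c d.
rewrite [RHS](_ : _ = a * c + (a * d + b * c) * phi R + b * d * (phi R * phi R)); last by ring.
by rewrite phi_sqr; ring.
Qed.

Lemma emb0 : emb g0 = 0.
Proof. by rewrite /emb /= mul0r addr0. Qed.

Lemma emb1 : emb g1 = 1.
Proof. by rewrite /emb /= mul0r addr0. Qed.

Lemma emb2 : emb g2 = 2.
Proof. by rewrite /emb /= mul0r addr0. Qed.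

Lemma geqP x y : reflect (x = y) (geq x y).
Proof.
apply: (iffP andP) => [[/Z.eqb_spec + /Z.eqb_spec]|-> //]; last by rewrite !Z.eqb_refl.
by case: x y => a b [c d] /= -> ->.
Qed.

Lemma gposE x : gpos x = (0 < emb x).
Proof.
case: x => a b; rewrite /gpos /emb /=.
have sgn (z : Z) : (Z.leb 0 z = (0 <= (int_of_Z z)%:~R :> R)) /\ (Z.ltb 0 z = (0 < (int_of_Z z)%:~R :> R)).
  rewrite ler0z ltr0z; split; lia.
have [a1 a2] := sgn a; have [b1 b2] := sgn b.
set N := Z.sub _ _; have [_ n1] := sgn N.
have n2 : Z.ltb N 0 = ((int_of_Z N)%:~R < 0 :> R) by rewrite ltrz0; lia.
have NE : (int_of_Z N)%:~R = (int_of_Z a)%:~R ^+ 2 + (int_of_Z a)%:~R * (int_of_Z b)%:~R - (int_of_Z b)%:~R ^+ 2 :> R.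
  by rewrite /N !(rmorphB int_of_Z, rmorphD int_of_Z, rmorphM int_of_Z) !(intrB, intrD, intrM) !expr2.
rewrite a1 a2 b1 b2 n1 n2 NE {a1 a2 b1 b2 n1 n2 NE N sgn}.
move: (_ a)%:~R (_ b)%:~R => {}a {}b; have := phi_sqr R; have := phi_gt1 R.
move: (phi R) => p p1 pE.
have norm : (a + b * p) * (a + b - b * p) = a ^+ 2 + a * b - b ^+ 2.
  rewrite (_ : _ * _ = a ^+ 2 + a * b + b ^+ 2 * p - b ^+ 2 * (p * p)); last by ring.
  by rewrite pE; ring.
rewrite -norm; have [a0|a0] := lerP 0 a; have [b0|b0] := lerP 0 b.
- have [a_gt|a_le] := ltrP 0 a; first by symmetry; rewrite orTb; nra.
  have -> : a = 0 by lra.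
  by rewrite add0r /= pmulr_lgt0 //; lra.
- by rewrite pmulr_lgt0 //; nra.
- by rewrite nmulr_llt0 //; nra.
- by symmetry; apply/negbTE; rewrite -leNgt; nra.
Qed.

Lemma gnegE x : gneg x = (emb x < 0).
Proof. by rewrite /gneg gposE emb_opp oppr_gt0. Qed.
End Embedding.

Notation coords := (seq gold).

Fixpoint gdot (r s : coords) : gold :=
  match r, s with x :: r', y :: s' => gadd (gmul x y) (gdot r' s') | _, _ => g0 end.

(** A frame is described by its Cartan matrix [K] and by half the squared norms
    [h] of its vectors. *)
Definition coroot (K : seq coords) (i : nat) (r : coords) : gold := gdot (nth [::] K i) r.
Definition reflect (K : seq coords) (i : nat) (r : coords) : coords :=
  set_nth g0 r i (gadd (nth g0 r i) (gopp (coroot K i r))).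
Definition covec (h : coords) (K : seq coords) (r : coords) : coords :=
  [seq gmul p.1 (gdot p.2 r) | p <- zip h K].
Definition gram (h : coords) (K : seq coords) (r s : coords) : gold := gdot r (covec h K s).
Definition height (r : coords) : gold := gdot r (nseq (size r) g1).
Definition gneg_vec (r : coords) : coords := map gopp r.
Definition simple (n i : nat) : coords := mkseq (fun j => if j == i then g1 else g0) n.

Definition raise (K : seq coords) (L : seq coords) : seq coords :=
  undup (flatten [seq [seq reflect K i r | i <- iota 0 (size K) & gneg (coroot K i r)] | r <- L]).

(** The list is by depth, the number of raising reflections, and it is complete if no
    root of depth [m] is left ([pos_roots_cover]). *)
Definition pos_roots (K : seq coords) (m : nat) : seq coords :=
  flatten (traject (raise K) [seq simple (size K) i | i <- iota 0 (size K)] m).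

Definition cartan_ok (h : coords) (K : seq coords) : bool :=
  [&& size h == size K, all (fun r => size r == size K) K, all gpos h &
      all (fun i => nth g0 (nth [::] K i) i == g2) (iota 0 (size K))].

Section Evaluation.
Variables (R : realType) (V : vectType R) (dot : {dot V for idfun}).
Variables (h : coords) (K : seq coords) (hK : cartan_ok h K).
Local Notation n := (size K).
Definition cartan_gram (i j : 'I_n) : R := emb R (gmul (nth g0 h i) (nth g0 (nth [::] K i) j)).
Variables (b : 'I_n -> V) (b_dot : forall i j, dot (b i) (b j) = cartan_gram i j).

Let size_h : size h = n. Proof. by case/and4P: hK => /eqP. Qed.
Let size_K (i : 'I_n) : size (nth [::] K i) = n.
Proof. by case/and4P: hK => _ /(all_nthP [::])/(_ i (ltn_ord i))/eqP. Qed.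
Lemma half_norm_gt0 (i : 'I_n) : 0 < emb R (nth g0 h i).
Proof. by case/and4P: hK => _ _ /(all_nthP g0)/(_ i); rewrite size_h ltn_ord (gposE R) => ->. Qed.
Lemma cartan_diag (i : 'I_n) : emb R (nth g0 (nth [::] K i) i) = 2.
Proof.
case/and4P: hK => _ _ _ /allP/(_ i); rewrite mem_iota ltn_ord => /(_ isT)/eqP->.
exact: emb2.
Qed.

Definition ev (r : coords) : V := \sum_(i < n) emb R (nth g0 r i) *: b i.

Lemma gdotE r s : size r = n -> size s = n ->
  emb R (gdot r s) = \sum_(i < n) emb R (nth g0 r i) * emb R (nth g0 s i).
Proof.
move: (n) => m; elim: m r s => [|m IH] [|x r] [|y s] //=.
  by move=> _ _; rewrite big_ord0 emb0.
by move=> [rm] [sm]; rewrite big_ord_recl emb_add emb_mul /= IH.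
Qed.

Lemma ev_coroot (i : 'I_n) r : size r = n ->
  dot (ev r) (b i) = emb R (nth g0 h i) * emb R (coroot K i r).
Proof.
move=> rn; rewrite dotC dot_sumr /coroot gdotE // mulr_sumr; apply: eq_bigr => j _.
by rewrite dotZr b_dot /cartan_gram emb_mul mulrC -mulrA.
Qed.

Lemma ev_gram r s : size r = n -> size s = n ->
  dot (ev r) (ev s) = emb R (gram h K r s).
Proof.
move=> rn sn; have zn : size (zip h K) = n by rewrite size1_zip size_h.
rewrite /gram gdotE ?size_map // dotC dot_sumr; apply: eq_bigr => i _.
rewrite dotZr ev_coroot // (nth_map (g0, [::])) ?zn ?ltn_ord //.
by rewrite nth_zip ?size_h //= emb_mul.
Qed.

Lemma ev_reflect (i : 'I_n) r : size r = n -> refl dot (b i) (ev r) = ev (reflect K i r).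
Proof.
move=> rn; rewrite reflE ev_coroot // b_dot /cartan_gram emb_mul cartan_diag.
have -> : 2 * (emb R h`_i * emb R (coroot K i r)) / (emb R h`_i * 2) = emb R (coroot K i r).
  by field; rewrite gt_eqF ?half_norm_gt0.
rewrite /ev (bigD1 i) //= [in RHS](bigD1 i) //= nth_set_nth /= eqxx.
rewrite emb_add emb_opp scalerBl addrAC; congr (_ + _).
apply: eq_bigr => j ji; have ji' : (j == i :> nat) = false by apply/negbTE.
by rewrite nth_set_nth /= ji'.
Qed.

Lemma ev_simple (i : 'I_n) : ev (simple n i) = b i.
Proof.
rewrite /ev (bigD1 i) //= nth_mkseq // eqxx emb1 scale1r.
rewrite big1 ?addr0 // => j ji; have ji' : (j == i :> nat) = false by apply/negbTE.
have -> : nth g0 (simple n i) j = g0 by rewrite nth_mkseq // ji'.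
by rewrite emb0 scale0r.
Qed.

Lemma ev_neg r : ev (gneg_vec r) = - ev r.
Proof.
rewrite /ev -sumrN; apply: eq_bigr => i _; rewrite -scaleNr -emb_opp.
have [ri|ri] := ltnP i (size r); first by rewrite (nth_map g0).
by rewrite !nth_default ?size_map // emb_opp emb0 oppr0.
Qed.

End Evaluation.

Lemma size_reflect K i r : (i < size K)%N -> size r = size K -> size (reflect K i r) = size K.
Proof. by move=> lt_i rn; rewrite size_set_nth rn; apply/maxn_idPr. Qed.

Section RootCoordinates.
Variables (R : realType) (V : vectType R) (dot : {dot V for idfun}).
Variables (Phi : {fset V}) (Phi_root : root_system dot fullv Phi).
Variables (h : coords) (K : seq coords) (hK : cartan_ok h K).
Local Notation n := (size K).
Variables (b : 'I_n -> V) (bP : frame dot Phi (@cartan_gram R h K) b).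
Let b_dot := frame_dot bP.
Local Notation ev := (ev b).

Lemma mem_raise L r : r \in raise K L -> exists s (i : 'I_n),
  [/\ s \in L, gneg (coroot K i s) & r = reflect K i s].
Proof.
rewrite mem_undup => /flatten_mapP[s sL /mapP[i]].
rewrite mem_filter mem_iota => /andP[neg /andP[_ lt_i]] ->.
by exists s, (Ordinal lt_i).
Qed.

Lemma raise_mem L s (i : 'I_n) : s \in L -> gneg (coroot K i s) ->
  reflect K i s \in raise K L.
Proof.
move=> sL neg; rewrite mem_undup; apply/flatten_mapP; exists s => //.
by apply/mapP; exists (i : nat) => //; rewrite mem_filter neg mem_iota /= ltn_ord.
Qed.

Variable m : nat.
Hypothesis pos_end : iter m (raise K) [seq simple n i | i <- iota 0 n] = [::].
Local Notation Pos := (pos_roots K m).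

Lemma pos_rootsP r : r \in Pos <->
  exists2 k, (k < m)%N & r \in iter k (raise K) [seq simple n i | i <- iota 0 n].
Proof.
split=> [/flattenP[L /trajectP[k km ->] rL]|[k km rL]]; first by exists k.
by apply/flattenP; exists (iter k (raise K) [seq simple n i | i <- iota 0 n]) => //;
   apply/trajectP; exists k.
Qed.

Lemma pos_roots_ray r : r \in Pos -> size r = n /\ ray Phi (ev r).
Proof.
move/pos_rootsP => [k _]; elim: k r => [|k IH] r /=.
  move=> /mapP[i]; rewrite mem_iota => /andP[_ lt_i] ->; rewrite size_mkseq; split=> //.
  by rewrite (ev_simple b (Ordinal lt_i)); exact: frame_root bP _.
move=> /mem_raise[s [i [/IH[sn rs] _ ->]]]; rewrite size_reflect //; split=> //.
by rewrite -(ev_reflect hK b_dot) //; apply: (ray_refl Phi_root) rs; exact: frame_root bP i.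
Qed.

Lemma pos_roots_cover a : a \in Phi ->
  exists2 c : R, 0 < c & exists2 r, r \in Pos & c *: a = ev r \/ c *: a = - ev r.
Proof.
pose X v := exists2 r, r \in Pos & v = ev r.
case/(frame_ind bP (X := X)) => [i|i v [r rPos ->]|c c0].
- exists (simple n i); last by rewrite ev_simple.
  apply/pos_rootsP; exists 0%N => /=; last by apply/mapP; exists (i : nat) => //; rewrite mem_iota /= ltn_ord.
  case: m pos_end => //=; case: (n) (i) => [[] //|n'] _ //.
- have [rn _] := pos_roots_ray rPos.
  rewrite (ev_coroot hK b_dot) // pmulr_rlt0 ?(half_norm_gt0 R hK) // -(gnegE R) => neg.
  exists (reflect K i r); last by rewrite (ev_reflect hK b_dot).
  move/pos_rootsP: rPos => [k km rk]; apply/pos_rootsP; exists k.+1; last exact: raise_mem.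
  rewrite ltn_neqAle km andbT; apply/eqP => mE; move: pos_end.
  by rewrite -mE /= => E; have := raise_mem rk neg; rewrite E.
by case=> [[r rP E]|[r rP E]]; exists c => //; exists r => //; [left | right; rewrite -E opprK].
Qed.

Definition all_roots : seq coords := Pos ++ map gneg_vec Pos.

Lemma all_roots_ray r : r \in all_roots -> size r = n /\ ray Phi (ev r).
Proof.
rewrite mem_cat => /orP[/pos_roots_ray //|/mapP[s /pos_roots_ray[sn rs] ->]].
by rewrite size_map ev_neg; split=> //; exact: (ray_opp Phi_root).
Qed.

Lemma all_roots_cover a : a \in Phi ->
  exists2 c : R, 0 < c & exists2 r, r \in all_roots & c *: a = ev r.
Proof.
move=> /pos_roots_cover[c c0 [r rP [E|E]]]; exists c => //.
  by exists r; rewrite // mem_cat rP.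
by exists (gneg_vec r); rewrite ?ev_neg // mem_cat map_f ?orbT.
Qed.

(** * Certified lower bounds *)

(** [cert r] lists functionals, by their values on the frame, one of which
    separates [r] from the rest of [S]. *)
Definition certified (S : seq coords) (cert : coords -> seq coords) : bool :=
  [&& uniq S, all (mem Pos) S, all (fun r => gpos (height r)) Pos &
   all (fun r => has (fun u => gneg (gdot r u) &&
     all (fun s => (s == r) || gpos (gdot s u)) S) (filter (fun u => size u == n) (cert r))) Pos].

Lemma dual_functional u : size u = n -> exists v, forall r, size r = n ->
  dot v (ev r) = emb R (gdot r u).
Proof.
move=> un; have [v vE] := frame_dual bP (fun i => emb R (nth g0 u i)); exists v => r rn.
by rewrite dot_sumr (@gdotE R K) //; apply: eq_bigr => i _; rewrite dotZr vE.
Qed.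

(** A negative root needs no certificate, as a functional that is positive on all
    positive roots separates it. *)
Lemma certified_free S cert : certified S cert ->
  exists2 D, convex_free dot Phi D & #|` D| = size S.
Proof.
case/and4P => S_uniq /allP S_pos /allP ht_pos /allP S_cert.
have [ht htE] := dual_functional (size_nseq n g1).
have ht_gt0 r : r \in Pos -> 0 < dot ht (ev r).
  move=> rP; have [rn _] := pos_roots_ray rP; rewrite htE // -(gposE R).
  by have := ht_pos r rP; rewrite /height rn.
apply: (convex_free_family Phi_root all_roots_cover S_uniq) => [s /S_pos/pos_roots_ray[] //||r].
  by exists ht => s /S_pos/ht_gt0.
rewrite mem_cat => /orP[rP|/mapP[s sP ->]]; last first.
  exists ht; first by rewrite ev_neg dotNr oppr_lt0 ht_gt0.
  by move=> t /S_pos/ht_gt0.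
have [rn _] := pos_roots_ray rP.
have /hasP[u] := S_cert r rP; rewrite mem_filter => /andP[/eqP un _] /andP[ur /allP uS].
have [v vE] := dual_functional un; exists v; first by rewrite vE // -(gnegE R).
move=> s sS sr; have [sn _] := pos_roots_ray (S_pos s sS).
by rewrite vE // -(gposE R); have := uS s sS; rewrite (negPf sr).
Qed.
End RootCoordinates.

(** * Exhaustive search *)

Section Search.
Variables (T : eqType) (inc : seq T -> T -> T -> bool) (exc : T -> T -> bool).

(** Branch on whether the first candidate [r] is chosen: if it is, the other
    candidates must pass [inc C r], where [C] lists the earlier choices; if it is
    not, they must pass [exc r]. The [if]s avoid exploring pruned branches. *)
Fixpoint bounded (fuel : nat) (C cand : seq T) (k : nat) : bool :=
  if (size cand <= k)%N then true else
  match fuel, cand, k with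
  | f.+1, r :: c, k'.+1 =>
      if bounded f (r :: C) (filter (inc C r) c) k'
      then bounded f C (filter (exc r) c) k else false
  | _, _, _ => false
  end.

Variables (A S : pred T).
Hypothesis incP : forall C r s, (forall x, x \in C -> S x) ->
  A r -> A s -> S r -> S s -> r != s -> inc C r s.
Hypothesis excP : forall r s, A r -> A s -> ~~ S r -> S s -> exc r s.

Lemma boundedP fuel C cand k : uniq cand -> {subset cand <= A} ->
  (forall x, x \in C -> S x) -> bounded fuel C cand k -> (count S cand <= k)%N.
Proof.
elim: fuel C cand k => [|f IH] C cand k cand_uniq candA CS /=.
  by case: leqP => // ck _; apply: leq_trans (count_size _ _) ck.
case: leqP => [ck _|_]; first by apply: leq_trans (count_size _ _) ck.
case: cand k cand_uniq candA => [|r c] [|k] //= /andP[rc c_uniq] rcA.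
have Ar : A r by apply: rcA; exact: mem_head.
have cA : {subset c <= A} by move=> s sc; apply: rcA; rewrite inE sc orbT.
have fA (P : pred T) : {subset filter P c <= A} by move=> s; rewrite mem_filter => /andP[_ /cA].
have cE (P : pred T) : (forall s, s \in c -> S s -> P s) -> count S (filter P c) = count S c.
  move=> HP; rewrite count_filter; apply: eq_in_count => s sc /=.
  by case Ss: (S s); rewrite //= HP.
case: ifP => // b_in b_ex; have [Sr|nSr] := boolP (S r).
  rewrite add1n ltnS -(cE (inc C r)); last first.
    move=> s sc Ss; apply: incP => //; first exact: cA.
    by apply: contraNneq rc => ->.
  apply: IH b_in => //; first exact: filter_uniq.
  by move=> x; rewrite inE => /orP[/eqP->|/CS].
rewrite add0n -(cE (exc r)); last by move=> s sc Ss; apply: excP => //; exact: cA.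
by apply: IH b_ex => //; exact: filter_uniq.
Qed.
End Search.

(** * Shifting *)

Section Shifting.
Variables (R : realType) (V : vectType R) (dot : {dot V for idfun}).
Variables (U : {vspace V}) (Phi : {fset V}) (Phi_root : root_system dot U Phi).
Variable (ht : V).
Implicit Types (a c : V) (S D : {fset V}).

Definition acute S : Prop := forall a c, a \in S -> c \in S -> a != c -> 0 <= dot a c.

Definition shift S a c : V :=
  if (dot c a < 0) && (refl dot a c \notin S) then refl dot a c else c.

(** As in the theorem of Erdos, Ko and Rado, reflecting in [a] the elements that
    make an obtuse angle with [a], unless their mirror image is already present,
    preserves acuteness: if [c] moves and [d] stays obtuse to [a], the mirror image
    of [d] is present and makes with [c] the angle required. *)
Lemma shift_acute S a : acute S -> acute [fset shift S a c | c in S]%fset.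
Proof.
move=> acS; suff main c d : c \in S -> d \in S -> shift S a c != shift S a d ->
    0 <= dot (shift S a c) (shift S a d).
  by move=> _ _ /imfsetP[c cS ->] /imfsetP[d dS ->]; exact: main.
have moved x y : x \in S -> y \in S -> dot x a < 0 -> refl dot a x \notin S ->
    ~~ ((dot y a < 0) && (refl dot a y \notin S)) -> 0 <= dot (refl dot a x) y.
  move=> xS yS xa sxS; rewrite negb_and -leNgt negbK => /orP[ya|syS].
    have [xy|xy] := eqVneq x y; first by rewrite -xy leNgt xa in ya.
    rewrite reflE dotBl dotZl (dotC dot a y) subr_ge0.
    apply: (@le_trans _ _ 0); last exact: acS.
    rewrite mulr_le0_ge0 // mulr_le0_ge0 ?invr_ge0 //; first by rewrite pmulr_rle0 // ltW.
    by have [->|a0] := eqVneq a 0; rewrite ?dot0l // ltW // dot_gt0.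
  rewrite dot_refl; apply: acS => //; apply: contraNneq sxS => ->.
  by rewrite reflK.
move=> cS dS; rewrite /shift.
case: ifPn => [/andP[ca sc]|nc]; case: ifPn => [/andP[da sd]|nd] cd.
- by rewrite refl_dot; apply: acS => //; apply: contraNneq cd => ->.
- exact: moved.
- by rewrite dotC; exact: moved.
- exact: acS.
Qed.

Lemma shift_inj S a : {in S &, injective (shift S a)}.
Proof.
move=> c d cS dS; rewrite /shift; case: ifPn => [/andP[_ sc]|_]; case: ifPn => [/andP[_ sd]|_].
- exact: (inv_inj (reflK dot a)).
- by move=> E; rewrite E dS in sc.
- by move=> E; rewrite -E cS in sd.
- by [].
Qed.

(** Shifting along roots of positive height raises the sum of the heights, so an
    acute set for which this sum is largest is stable. *)
Lemma shift_stable S : {subset S <= Phi} -> acute S ->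
  exists S', [/\ {subset S' <= Phi}, acute S', #|` S'| = #|` S| &
    forall a c, a \in Phi -> 0 < dot ht a -> c \in S' -> dot c a < 0 ->
      refl dot a c \in S'].
Proof.
move=> SPhi acS.
pose val_ (X : {set Phi}) : {fset V} := [fset fsval a | a in X]%fset.
have val_P (X : {set Phi}) a : a \in val_ X -> a \in Phi.
  by move/imfsetP => [y _ ->]; exact: fsvalP.
have val_of D : {subset D <= Phi} -> D = val_ [set a | fsval a \in D].
  move=> DPhi; apply/fsetP => a; apply/idP/imfsetP => [aD|[y /=]]; last first.
    by rewrite inE => yD ->.
  by exists [` DPhi a aD]%fset; rewrite //= inE.
pose P X := `[< acute (val_ X) /\ #|` val_ X| = #|` S| >].
pose X0 : {set Phi} := [set a | fsval a \in S].
have P0 : P X0 by apply/asboolP; rewrite -val_of.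
pose F (X : {set Phi}) : R := \sum_(a <- val_ X) dot ht a.
case: (arg_maxP F P0) => X /asboolP[acX cardX] Xmax.
exists (val_ X); split=> //; first exact: val_P.
move=> a c aP hta cX ca; apply/contraT => scX.
pose S2 := [fset shift (val_ X) a d | d in val_ X]%fset.
have S2Phi : {subset S2 <= Phi}.
  move=> _ /imfsetP[d /val_P dP ->]; rewrite /shift; case: ifP => // _.
  exact: (root_refl_mem Phi_root).
have S2P : P [set a | fsval a \in S2].
  apply/asboolP; rewrite -val_of //; split; first exact: shift_acute.
  by rewrite card_in_imfset //; exact: shift_inj.
have /= := Xmax _ S2P; rewrite /F -val_of // leNgt => /negP[].
have aa := root_dot_gt0 Phi_root aP.
have raise d : dot d a < 0 -> dot ht d < dot ht (refl dot a d).
  move=> da; rewrite reflE dotBr dotZr ltrDl oppr_gt0 pmulr_llt0 //.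
  by rewrite pmulr_llt0 ?invr_gt0 // pmulr_rlt0.
have -> : \sum_(d <- S2) dot ht d = \sum_(d <- val_ X) dot ht (shift (val_ X) a d).
  by rewrite big_imfset //=; exact: shift_inj.
rewrite (big_rem c) //= [ltRHS](big_rem c) //= ltr_leD //.
  by rewrite /shift ca scX raise.
by apply: ler_sum => d _; rewrite /shift; case: ifP => [/andP[/raise/ltW]|].
Qed.
End Shifting.

(** * Rays of free sets and the bound by shifting *)

Section Bounds.
Variables (R : realType) (V : vectType R) (dot : {dot V for idfun}).
Variables (Phi : {fset V}) (Phi_root : root_system dot fullv Phi).
Variables (h : coords) (K : seq coords) (hK : cartan_ok h K).
Local Notation n := (size K).
Variables (b : 'I_n -> V) (bP : frame dot Phi (@cartan_gram R h K) b).
Variable m : nat.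
Hypothesis pos_end : iter m (raise K) [seq simple n i | i <- iota 0 n] = [::].
Let b_dot := frame_dot bP.
Local Notation ev := (ev b).
Local Notation Pos := (pos_roots K m).
Local Notation roots := (all_roots K m).
Local Notation gram := (gram h K).

(** [D] is a set of roots of unknown lengths, so its elements are recorded by the
    rays of coordinate vectors that they span. *)
Definition hits (D : {fset V}) (r : coords) : bool :=
  `[< exists2 c : R, 0 < c & c *: ev r \in D >].

Lemma mem_hits D a r (c : R) : a \in D -> 0 < c -> c *: a = ev r -> hits D r.
Proof.
move=> aD c0 E; apply/asboolP; exists c^-1; rewrite ?invr_gt0 // -E scalerA mulVf ?gt_eqF //.
by rewrite scale1r.
Qed.

Lemma hits_count D L : {subset D <= Phi} ->
  (forall r, r \in roots -> hits D r -> r \in L) -> (#|` D| <= count (hits D) L)%N.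
Proof.
move=> DPhi HL.
have [f f_inj f_ray] := label_roots Phi_root (all_roots_cover Phi_root hK bP pos_end) [::].
rewrite -size_filter -(size_map f); apply: uniq_leq_size.
  by rewrite map_inj_in_uniq ?fset_uniq // => x y /DPhi xP /DPhi yP; exact: f_inj.
move=> _ /mapP[a aD ->]; have [fa [c c0 E]] := f_ray a (DPhi a aD).
have hit : hits D (f a) by exact: mem_hits aD c0 E.
by rewrite mem_filter hit HL.
Qed.

Lemma root_gram r s : r \in roots -> s \in roots -> dot (ev r) (ev s) = emb R (gram r s).
Proof.
move=> /(all_roots_ray Phi_root hK bP)[rn _] /(all_roots_ray Phi_root hK bP)[sn _].
exact: ev_gram.
Qed.

Section Acute.
Variables (D : {fset V}) (DPhi : {subset D <= Phi}) (acD : acute dot D).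

Lemma hits_acute r s : hits D r -> hits D s -> 0 <= dot (ev r) (ev s).
Proof.
move=> /asboolP[x x0 rD] /asboolP[y y0 sD].
have [E|ne] := eqVneq (x *: ev r) (y *: ev s); last first.
  by have := acD rD sD ne; rewrite dotZl dotZr pmulr_rge0 // pmulr_rge0.
have := root_dot_gt0 Phi_root (DPhi rD).
by rewrite {2}E dotZl dotZr pmulr_rgt0 // pmulr_rgt0 // => /ltW.
Qed.

Lemma hits_gneg r s : r \in roots -> s \in roots -> hits D r -> hits D s ->
  gneg (gram r s) = false.
Proof.
move=> rP sP hr hs; rewrite (gnegE R) -root_gram //; apply/negbTE; rewrite -leNgt.
exact: hits_acute.
Qed.
End Acute.

Lemma free_acute D : convex_free dot Phi D -> acute dot D.
Proof. by move=> freeD a c aD cD; exact: (convex_free_acute Phi_root freeD). Qed.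

Section Free.
Variables (D : {fset V}) (freeD : convex_free dot Phi D).

Lemma hits_cone r s v (x y : R) : hits D r -> hits D s ->
  (forall c, ev r <> c *: ev s) -> 0 < x -> 0 < y -> ray Phi v ->
  v <> x *: ev r + y *: ev s.
Proof.
move=> /asboolP[c c0 rD] /asboolP[d d0 sD] nprop x0 y0 vP vE.
have ne : c *: ev r != d *: ev s.
  apply/eqP => E; apply: (nprop (c^-1 * d)).
  by rewrite -scalerA -E scalerA mulVf ?scale1r // gt_eqF.
apply: (convex_free_ray_cone Phi_root freeD rD sD (x := x / c) (y := y / d) _ _ ne ltr01 vP).
- by rewrite divr_gt0.
- by rewrite divr_gt0.
by rewrite scale1r vE !scalerA !divfK // gt_eqF.
Qed.
End Free.

Definition ok_acute (_ : seq (coords * coords)) (r s : coords * coords) : bool :=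
  ~~ gneg (gdot r.1 s.2).
Definition ok_upward (r s : coords * coords) : bool :=
  ~~ (if geq (gdot r.1 s.2) g1 then gpos (gadd (height r.1) (gopp (height s.1))) else false).

(** Shifting along roots of positive height turns an acute set into one
    that consists of positive roots and is closed under raising a root to another
    root at angle 60 degrees to it. *)
Lemma shifted_bound N :
  all (fun r => (gram r r == g2) && gpos (height r)) Pos -> uniq Pos ->
  bounded ok_acute ok_upward (size Pos) [::] [seq (r, covec h K r) | r <- rev Pos] N ->
  forall D, convex_free dot Phi D -> (#|` D| <= N)%N.
Proof.
move=> /allP norm_ht uniqPos search D freeD; have [DPhi _ _] := freeD.
have [ht htE] := dual_functional bP (size_nseq n g1).
have posP r : r \in Pos -> size r = n /\ ray Phi (ev r) := pos_roots_ray Phi_root hK bP (m:=m) (r:=r).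
have ht_gt0 r : r \in Pos -> 0 < dot ht (ev r).
  move=> rP; have [rn _] := posP r rP.
  by rewrite htE // -(gposE R); have /andP[_] := norm_ht r rP; rewrite /height rn.
have [S [SPhi acS cardS stS]] := shift_stable Phi_root ht DPhi (free_acute freeD).
have hits_pos r : r \in roots -> hits S r -> r \in Pos.
  rewrite mem_cat => /orP[//|/mapP[s sP ->]] /asboolP[c c0 cS].
  have htc : 0 < dot ht (- (c *: ev (gneg_vec s))).
    by rewrite ev_neg scalerN opprK dotZr mulr_gt0 // ht_gt0.
  set a := c *: ev _ in cS htc.
  have a0 : 0 < dot a a by apply: (root_dot_gt0 Phi_root); exact: SPhi.
  have := stS (- a) a (root_opp Phi_root (SPhi a cS)) htc cS.
  rewrite dotNr oppr_lt0 => /(_ a0).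
  have -> : refl dot (- a) a = - a.
    by rewrite -scaleN1r reflZ ?oppr_eq0 ?oner_eq0 // refl_self scaleN1r.
  move=> naS; have ne : a != - a.
    apply/eqP => aE; have hta : 0 < dot ht a by rewrite aE.
    by move: htc; rewrite dotNr oppr_gt0 lt_gtF.
  by have := acS a (- a) cS naS ne; rewrite dotNr oppr_ge0 leNgt a0.
rewrite -cardS; apply: leq_trans (hits_count SPhi hits_pos) _.
have -> : count (hits S) Pos =
    count (fun p => hits S p.1) [seq (r, covec h K r) | r <- rev Pos].
  by rewrite count_map -(count_rev (hits S)); apply: eq_count.
pose A (p : coords * coords) := (p.1 \in Pos) && (p.2 == covec h K p.1).
have rootsP r : r \in Pos -> r \in roots by move=> rP; rewrite mem_cat rP.
apply: (boundedP (A := A) _ _ _ _ _ search) => //=.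
- move=> C [r x] [s y] _ /andP[/= rP _] /andP[/= sP /eqP->] hr hs _.
  by rewrite /ok_acute -/(gram r s) (hits_gneg SPhi acS (rootsP r rP) (rootsP s sP) hr hs).
- move=> [r x] [s y] /andP[/= rP _] /andP[/= sP /eqP->] nr hs.
  rewrite /ok_upward /= -/(gram r s); apply: contra nr; case: geqP => // rsE htrs.
  have [[rn rr] [sn rs]] := (posP r rP, posP s sP); rewrite /height rn sn in htrs.
  have [/andP[/eqP rE _] /andP[/eqP sE _]] := (norm_ht r rP, norm_ht s sP).
  have ss : dot (ev s) (ev s) = 2 by rewrite root_gram ?rootsP // sE emb2.
  have rs1 : dot (ev r) (ev s) = 1 by rewrite root_gram ?rootsP // rsE emb1.
  have dE : refl dot (ev s) (ev r) = ev r - ev s.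
    by rewrite reflE ss rs1 mulr1 divff ?pnatr_eq0 // scale1r.
  have [d d0 dP] : ray Phi (ev r - ev s) by rewrite -dE; exact: (ray_refl Phi_root).
  have /asboolP[c c0 cS] := hs; apply/asboolP; exists c => //.
  have := stS _ _ dP _ cS.
  rewrite !dotZr !dotZl dotBr dotBr htE // htE // -emb_opp -emb_add.
  rewrite mulr_gt0 // -?(gposE R) // ss dotC rs1 => /(_ isT).
  rewrite reflZ ?gt_eqF // linearZ /= reflE.
  have -> : dot (ev s) (ev r - ev s) = -1 by rewrite dotBr ss dotC rs1; ring.
  have -> : dot (ev r - ev s) (ev r - ev s) = 2.
    by rewrite -dE refl_dot root_gram ?rootsP // rE emb2.
  have -> : 2 * -1 / 2 = -1 :> R by field.
  rewrite scaleN1r opprK [ev s + _]addrC subrK; apply.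
  by rewrite pmulr_rlt0 // pmulr_rlt0 //; lra.
- by rewrite map_inj_uniq ?rev_uniq // => x y [].
- move=> p /mapP[r]; rewrite mem_rev => rP ->; apply/andP; split=> //=.
Qed.

(** * Clique search *)

(** Storing the covector of a root with it makes an inner product a sum of [n]
    products. *)
Definition entry (r : coords) : coords * coords := (r, covec h K r).

(** [pre] lists elements that are taken for granted and [L] the candidates for the
    others; [C] is the part of [pre] that the compatibility test consults. *)
Lemma clique_count D (pre L : seq coords) (inc : _ -> _ -> _ -> bool) C fuel k :
  {subset D <= Phi} -> uniq L -> {subset L <= roots} ->
  (forall r, r \in roots -> hits D r -> r \in pre ++ L) ->
  (forall r, r \in C -> r \in roots /\ hits D r) ->
  (forall C r s, (forall c, c \in C -> c \in roots /\ hits D c) -> r \in roots -> s \in roots ->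
     hits D r -> hits D s -> r != s -> inc (map entry C) (entry r) (entry s)) ->
  bounded inc (fun _ _ => true) fuel (map entry C) (map entry L) k ->
  (#|` D| <= size pre + k)%N.
Proof.
move=> DPhi L_uniq LP cover CP incP search.
apply: leq_trans (hits_count DPhi cover) _; rewrite count_cat leq_add ?count_size //.
pose A (p : coords * coords) := (p.1 \in roots) && (p == entry p.1).
pose S (p : coords * coords) := A p && hits D p.1.
have -> : count (hits D) L = count S (map entry L).
  rewrite count_map; apply: eq_in_count => r rL.
  by rewrite /= /S /A /= (LP r rL) eqxx.
apply: (boundedP (A := A) _ _ _ _ _ search) => //.
- move=> B r s BS _ _ /andP[/andP[rP /eqP rE] hr] /andP[/andP[sP /eqP sE] hs] rs.
  have BE : B = map entry (map fst B).
    rewrite -map_comp -[LHS]map_id; apply/eq_in_map => p /BS/andP[/andP[_ /eqP pE] _].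
    exact: pE.
  rewrite BE rE sE; apply: incP => //.
    by move=> c /mapP[p /BS/andP[/andP[pP _] hp] ->].
  by apply: contra rs => /eqP E; rewrite rE sE E.
- have inj : injective entry by move=> r s [].
  by rewrite (map_inj_uniq inj).
- by move=> p /mapP[r /LP rP ->]; rewrite unfold_in /A /= rP eqxx.
- by move=> p /mapP[r /CP[rP hr] ->]; rewrite /S /A /= rP eqxx.
Qed.

(** Two roots of a free set cannot span a cone that contains a third root. This
    rules out two orthogonal roots whose sum, or half their sum, is a root. *)
Definition splits (r s : coords) : bool :=
  geq (gram r s) g0 && has (fun t => let u := map (fun p => gadd p.1 p.2) (zip r s) in
    (t == u) || (map (fun x => gadd x x) t == u)) roots.

Lemma ev_add (x : coords) (y : coords) : size x = n -> size y = n ->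
  ev [seq gadd p.1 p.2 | p <- zip x y] = ev x + ev y.
Proof.
move=> xn yn; rewrite /ev -big_split; apply: eq_bigr => i _ /=.
by rewrite (nth_map (g0, g0)) ?size1_zip ?xn ?yn // nth_zip ?xn ?yn //= emb_add scalerDl.
Qed.

Lemma ev_double (x : coords) : size x = n -> ev [seq gadd t t | t <- x] = 2 *: ev x.
Proof.
move=> xn; rewrite /ev scaler_sumr; apply: eq_bigr => i _ /=.
by rewrite (nth_map g0) ?xn // emb_add scalerA -mulr2n mulr_natl.
Qed.

Lemma hits_splits D r s : convex_free dot Phi D -> r \in roots -> s \in roots ->
  hits D r -> hits D s -> splits r s = false.
Proof.
move=> freeD rP sP hr hs; apply/negbTE/negP => /andP[/geqP gE /hasP[t tP tE]].
have [[rn rr] [sn rs]] := (all_roots_ray Phi_root hK bP rP, all_roots_ray Phi_root hK bP sP).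
have [tn tr] := all_roots_ray Phi_root hK bP tP.
have rs0 : dot (ev r) (ev s) = 0 by rewrite root_gram // gE emb0.
have nprop c : ev r <> c *: ev s.
  move=> rE; have : dot (ev r) (ev r) = 0 by rewrite {2}rE dotZr rs0 mulr0.
  have [d d0 /(root_dot_gt0 Phi_root)] := rr.
  by rewrite dotZl dotZr => + E; rewrite E !mulr0 ltxx.
have sumE : ev [seq gadd p.1 p.2 | p <- zip r s] = ev r + ev s by exact: ev_add.
case/orP: tE => /eqP tE.
  apply: (hits_cone freeD hr hs nprop ltr01 ltr01 tr).
  by rewrite !scale1r -sumE tE.
have half : 0 < 2^-1 :> R by rewrite invr_gt0.
apply: (hits_cone freeD hr hs nprop half half tr).
by rewrite -scalerDr -sumE -tE ev_double // scalerA mulVf ?pnatr_eq0 // scale1r.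
Qed.

(** In a free set, two roots of squared norm 2 never make an inner product [x]
    strictly between 0 and 1: [x r + (1 - x^2) s] is a root. *)
Lemma hits_gap D r s : convex_free dot Phi D -> r \in roots -> s \in roots ->
  geq (gram r r) g2 -> geq (gram s s) g2 ->
  hits D r -> hits D s ->
  gpos (gram r s) && gpos (gadd g1 (gopp (gram r s))) = false.
Proof.
have far (c : R) : 0 < c * 2 -> c * 2 < 1 -> c * (c * 2) <> 2 by move=> *; nra.
have sq (x : R) : 0 < x -> x < 1 -> 0 < 1 - x ^+ 2 by move=> *; nra.
move=> freeD rP sP /geqP rr /geqP ss hr hs; apply/negbTE/negP => /andP[].
rewrite !(gposE R) emb_add emb_opp emb1 -root_gram // subr_gt0 => x0 x1.
have [[_ rayr] [_ rays]] := (all_roots_ray Phi_root hK bP rP, all_roots_ray Phi_root hK bP sP).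
have rr2 : dot (ev r) (ev r) = 2 by rewrite root_gram // rr emb2.
have ss2 : dot (ev s) (ev s) = 2 by rewrite root_gram // ss emb2.
set x := dot _ _ in x0 x1.
have nprop c : ev r <> c *: ev s.
  move=> rE; have xE : x = c * 2 by rewrite /x rE dotZl ss2.
  have : c * x = 2 by rewrite -rr2 {1}rE dotZl dotC.
  by move: x0 x1; rewrite xE => c0 c1 /(far c c0 c1).
have y0 : 0 < 1 - x ^+ 2 by exact: sq.
apply: (hits_cone freeD hr hs nprop x0 y0).
  exact: (ray_opp Phi_root (ray_refl Phi_root rays (ray_refl Phi_root rayr rays))).
have sr : refl dot (ev r) (ev s) = ev s - x *: ev r.
  by rewrite reflE rr2 (dotC dot (ev s)) -/x mulrAC divff ?mul1r // pnatr_eq0.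
have reflBZ (a u v : V) (c : R) : refl dot a (u - c *: v) = refl dot a u - c *: refl dot a v.
  by have /= -> := linearB (refl dot a) u (c *: v); have /= -> := linearZ_LR (refl dot a) c v.
rewrite sr reflBZ refl_self reflE ss2 -/x mulrAC divff ?mul1r ?pnatr_eq0 //.
rewrite opprD !opprK scalerBr scalerBl scale1r scalerA expr2.
exact: addrCA.
Qed.
End Bounds.

(** A pair of roots that fails [ok] is excluded by one of the three reasons why two
    roots cannot occur together in a free set: they make an obtuse angle, or one of
    [hits_splits] and [hits_gap] applies. *)
Definition sound (h : coords) (K : seq coords) m (ok : coords * coords -> coords * coords -> bool) : bool :=
  let L := [seq entry h K r | r <- all_roots K m] in
  all (fun r => all (fun s =>
    if ok r s then true else if r.1 == s.1 then true else
    let g := gdot r.1 s.2 in if gneg g then true else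
    if geq g g0 then splits h K m r.1 s.1 else
    if geq (gdot r.1 r.2) g2 && geq (gdot s.1 s.2) g2 then gpos g && gpos (gadd g1 (gopp g))
    else false) L) L.

(** Two long roots, or two short ones, that are orthogonal have a sum that is a
    multiple of a root, so roots of equal length must make an angle of 60 degrees. *)
Definition ok_F4 (r s : coords * coords) : bool :=
  let g := gdot r.1 s.2 in let nr := gdot r.1 r.2 in
  if geq nr (gdot s.1 s.2) then geq (gadd g g) nr else ~~ gneg g.

(** The inner products of roots of squared norm 2 in type H are [0], [1], [phi],
    [phi - 1], [2] and their opposites; [hits_gap] excludes [phi - 1]. *)
Definition ok_H (r s : coords * coords) : bool :=
  let g := gdot r.1 s.2 in if geq g g0 then true else if geq g g1 then true else geq g gphi.

Definition gm1 : gold := (Zneg 1, Z0).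
Definition gm2 : gold := (Zneg 2, Z0).
Definition F4_half : coords := [:: g2; g2; g1; g1].
Definition F4_cartan : seq coords :=
  [:: [:: g2; gm1; g0; g0]; [:: gm1; g2; gm1; g0]; [:: g0; gm2; g2; gm1]; [:: g0; g0; gm1; g2]].
Definition gmphi : gold := (Z0, Zneg 1).
Definition H3_cartan : seq coords :=
  [:: [:: g2; gmphi; g0]; [:: gmphi; g2; gm1]; [:: g0; gm1; g2]].

(** Reflect in simple roots, raising [r] while possible, and then raising [s] by
    reflections that fix [r]. *)
Fixpoint climb (K : seq coords) fuel (p : coords * coords) : coords * coords :=
  if fuel is f.+1 then
    let: (r, s) := p in
    if [seq i <- iota 0 (size K) | let c := coroot K i r in
          if gneg c then true else if geq c g0 then gneg (coroot K i s) else false] is i :: _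
    then climb K f (reflect K i r, reflect K i s) else p
  else p.

Section Bounds.
Variables (R : realType) (V : vectType R) (dot : {dot V for idfun}).
Variables (Phi : {fset V}) (Phi_root : root_system dot fullv Phi).
Variables (h : coords) (K : seq coords) (hK : cartan_ok h K).
Local Notation n := (size K).
Variables (b : 'I_n -> V) (bP : frame dot Phi (@cartan_gram R h K) b).
Variable m : nat.
Hypothesis pos_end : iter m (raise K) [seq simple n i | i <- iota 0 n] = [::].
Let b_dot := frame_dot bP.
Local Notation ev := (ev b).
Local Notation roots := (all_roots K m).
Local Notation entry := (entry h K).
Local Notation hits := (hits b).

Lemma compatible ok D r s : sound h K m ok -> convex_free dot Phi D ->
  r \in roots -> s \in roots -> hits D r -> hits D s -> r != s -> ok (entry r) (entry s).
Proof.
move=> okP freeD rP sP hr hs rs; have [DPhi _ _] := freeD.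
have /allP/(_ (entry s) (map_f entry sP)) := allP okP (entry r) (map_f entry rP).
case: ifP => //= _; rewrite (negPf rs) -/(gram h K r s).
have acD := free_acute Phi_root freeD.
rewrite (hits_gneg Phi_root hK bP DPhi acD rP sP hr hs).
rewrite (hits_splits Phi_root hK bP freeD rP sP hr hs); case: ifP => // _.
by case: ifP => // /andP[rr ss]; rewrite (hits_gap Phi_root hK bP freeD rP sP rr ss hr hs).
Qed.

Lemma clique_bound ok N : sound h K m ok -> uniq roots ->
  bounded (fun _ => ok) (fun _ _ => true) (size roots) [::] (map entry roots) N ->
  forall D, convex_free dot Phi D -> (#|` D| <= N)%N.
Proof.
move=> okP roots_uniq search D freeD; have [DPhi _ _] := freeD.
apply: (clique_count (pre := [::]) (C := [::]) Phi_root hK bP pos_end DPhi roots_uniq _ _ _ _ search) => //.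
by move=> C r s _ rP sP; exact: compatible.
Qed.

Lemma convex_free_refl a D : a \in Phi -> convex_free dot Phi D ->
  convex_free dot Phi [fset refl dot a c | c in D]%fset.
Proof.
move=> aP [DPhi [u uD] sepD]; split.
- by move=> _ /imfsetP[c /DPhi cP ->]; exact: (root_refl_mem Phi_root).
- by exists (refl dot a u) => _ /imfsetP[c /uD uc ->]; rewrite refl_dot.
move=> c cP; have [v vc vD] := sepD _ (root_refl_mem Phi_root aP cP).
exists (refl dot a v); first by rewrite dot_refl.
move=> _ /imfsetP[d dD ->] dc; rewrite refl_dot vD //.
by apply: contraNneq dc => ->; rewrite reflK.
Qed.

(** Reflecting a free set in a simple root gives a free set, so a free set may be
    assumed to contain the end of the climb of any one or two of its elements. *)
Lemma climb_free fuel p D : convex_free dot Phi D -> size p.1 = n -> size p.2 = n ->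
  hits D p.1 -> hits D p.2 ->
  exists D', [/\ convex_free dot Phi D', #|` D'| = #|` D|,
    hits D' (climb K fuel p).1 & hits D' (climb K fuel p).2].
Proof.
elim: fuel p D => [|f IH] p D freeD; first by exists D.
case: p => r s /= rn sn hr hs; set is_ := filter _ _.
have : {subset is_ <= iota 0 n} by exact: mem_subseq (filter_subseq _ _).
case: is_ => [|i is_] sub; first by exists D.
have := sub i (mem_head _ _); rewrite mem_iota => /andP[_ lt_i].
pose i' := Ordinal lt_i; have [c c0 cP] := frame_root bP i'.
pose D' := [fset refl dot (c *: b i') a | a in D]%fset.
have freeD' : convex_free dot Phi D' by exact: convex_free_refl.
have hitsD' t : size t = n -> hits D t -> hits D' (reflect K i t).
  move=> tn /asboolP[d d0 dD]; apply/asboolP; exists d => //; apply/imfsetP; exists (d *: ev t) => //.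
  by rewrite reflZ ?gt_eqF // linearZ /= (ev_reflect hK b_dot i' tn).
have card : #|` D'| = #|` D| by rewrite card_imfset //; exact: (inv_inj (reflK _ _)).
by rewrite -card; apply: IH; rewrite ?size_reflect //; exact: hitsD'.
Qed.
End Bounds.

(** * Type H4 *)

Definition pattern_gram : seq coords :=
  [:: [:: g2; g1; g1; gphi]; [:: g1; g2; g1; g1]; [:: g1; g1; g2; g1]; [:: gphi; g1; g1; g2]].
(** In the basis of the four vectors this is
    [(2 phi - 3, 2 - phi, 2 - phi, 2 phi - 3)], with positive entries. *)
Definition pattern_root : coords :=
  foldl (fun r i => reflect pattern_gram i r) (simple 4 1) [:: 0; 3; 2; 0; 1; 3; 1; 0; 2; 3; 0].

Section Pattern.
Variables (R : realType) (V : vectType R) (dot : {dot V for idfun}).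
Variables (Phi : {fset V}) (Phi_root : root_system dot fullv Phi).
Variables (D : {fset V}) (freeD : convex_free dot Phi D).

(** Four rays of a free set cannot have [pattern_gram] as Gram matrix: reflecting
    them in one another produces a root in the interior of their cone. *)
Lemma pattern_free (x : 'I_(size pattern_gram) -> V) :
  (forall i j, dot (x i) (x j) = cartan_gram R (nseq 4 g1) i j) ->
  (forall i, exists2 c : R, 0 < c & c *: x i \in D) -> False.
Proof.
move=> x_dot xD; have [DPhi _ _] := freeD.
have pK : cartan_ok (nseq 4 g1) pattern_gram by vm_compute.
have x_ray i : ray Phi (x i) by have [c c0 /DPhi cP] := xD i; exists c.
have word_ray w : all (gtn 4) w -> let r := foldl (fun r i => reflect pattern_gram i r) (simple 4 1) w in
    size r = 4 /\ ray Phi (ev x r).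
  elim/last_ind: w => [_|w i IH] /=.
    split=> //; have := ev_simple x (Ordinal (isT : (1 < size pattern_gram)%N)).
    by rewrite /= => ->.
  rewrite all_rcons foldl_rcons => /andP[i4 /IH[rn rP]].
  split; first by rewrite (size_reflect (K := pattern_gram)).
  by rewrite -(ev_reflect pK x_dot (Ordinal i4)) //; exact: (ray_refl Phi_root).
have [size4 ray4] : size pattern_root = 4 /\ ray Phi (ev x pattern_root) by exact: word_ray.
have normE : dot (ev x pattern_root) (ev x pattern_root) = 2.
  by rewrite (ev_gram pK x_dot) // (_ : gram _ _ _ _ = g2) ?emb2.
have lt2 i : dot (ev x pattern_root) (x i) < 2.
  rewrite (ev_coroot pK x_dot) // -subr_gt0 -emb_mul -emb_opp.
  rewrite -emb2 -emb_add -(gposE R); case: i => [[|[|[|[|]]]] lt_i] //.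
have coef_gt0 (i : 'I_(size pattern_gram)) : 0 < emb R (nth g0 pattern_root i).
  by rewrite -(gposE R); case: i => [[|[|[|[|]]]] lt_i].
have x_norm i : dot (x i) (x i) = 2.
  rewrite x_dot /cartan_gram -emb2.
  by congr emb; case: i => [[|[|[|[|]]]] lt_i].
have [d d0 dP] := ray4.
have [c cP] := boolp.choice (fun i => let: ex_intro2 c c0 cD := xD i in ex_intro (fun c => 0 < c /\ c *: x i \in D) c (conj c0 cD)).
pose s := [seq (d * emb R (nth g0 pattern_root i) / c i, c i *: x i) | i : 'I_(size pattern_gram)].
have sP p : p \in s -> [/\ 0 <= p.1, p.2 \in D & p.2 != d *: ev x pattern_root].
  move=> /mapP[i _ ->] /=; have [c0 cD] := cP i; split=> //.
    by rewrite divr_ge0 ?mulr_ge0 // ltW.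
  apply/eqP => E; have := lt2 i; set y := dot _ _.
  have E1 : c i * 2 = d * y by rewrite -(x_norm i) -!dotZl E.
  have E2 : c i * y = d * 2 by rewrite /y -normE -[RHS]dotZl -E dotZl dotC.
  suff -> : y = 2 by rewrite ltxx.
  have : (c i + d) * (y - 2) = 0 by rewrite mulrBr !mulrDl; lra.
  by move/eqP; rewrite mulf_eq0 gt_eqF ?addr_gt0 //= subr_eq0 => /eqP.
have /negP[] := convex_free_cone freeD dP sP.
rewrite big_map big_enum /= /ev scaler_sumr; apply/eqP; apply: eq_bigr => i _.
by have [c0 _] := cP i; rewrite !scalerA divfK ?gt_eqF.
Qed.
End Pattern.

Section TypeH4.
Definition H4_half : coords := nseq 4 g1.
Definition H4_cartan : seq coords :=
  [:: [:: g2; gmphi; g0; g0]; [:: gmphi; g2; gm1; g0]; [:: g0; gm1; g2; gm1]; [:: g0; g0; gm1; g2]].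
Local Notation roots := (all_roots H4_cartan 29).
Local Notation gram := (gram H4_half H4_cartan).
Local Notation entry := (entry H4_half H4_cartan).
Definition H4_top : coords :=
  [:: (Zpos 2, Zpos 3); (Zpos 2, Zpos 4); (Zpos 1, Zpos 3); (Z0, Zpos 2)].
Definition H4_next : coords :=
  [:: (Zpos 2, Zpos 3); (Zpos 2, Zpos 4); (Zpos 1, Zpos 3); (Zpos 1, Zpos 1)].

(** The Gram matrices of four vectors of squared norm 2, listed above the
    diagonal, that agree with [pattern_gram] up to reordering. *)
Definition patterns : seq coords :=
  [seq mkseq (fun j => if i == j then gphi else g1) 6 | i <- iota 0 6].

(** The test for free sets that contain [H4_top] and [H4_next]; a pattern contains no
    orthogonal pair, which makes the search faster. *)
Definition ok_next (C : seq (coords * coords)) (r s : coords * coords) : bool :=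
  if ok_H r s then
    let vr := gdot H4_top r.2 in let vs := gdot H4_top s.2 in let rs := gdot r.1 s.2 in
    if geq rs g0 then true else ~~ has (fun c =>
      [:: vr; vs; rs; gdot H4_top c.2; gdot r.1 c.2; gdot s.1 c.2] \in patterns) C
  else false.

(** The test for free sets without a pair at the inner product [phi]. *)
Definition ok_flat (C : seq (coords * coords)) (r s : coords * coords) : bool :=
  let g := gdot r.1 s.2 in if geq g g0 then true else geq g g1.

(** The order of the candidates matters for the size of the search. *)
Definition by_angle (us : seq coords) (xs : seq gold) (L : seq coords) : seq coords :=
  foldr (fun u L' => flatten [seq [seq r <- L' | geq (gram r u) x] | x <- xs]) L us.

Lemma mem_by_angle us xs L r :
  (r \in by_angle us xs L) = (r \in L) && all (fun u => gram r u \in xs) us.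
Proof.
elim: us => [|u us IH] /=; first by rewrite andbT.
rewrite andbCA -IH; apply/flatten_mapP/andP => [[x xxs]|[rx rL]].
  by rewrite mem_filter => /andP[/geqP-> rL].
by exists (gram r u) => //; rewrite mem_filter rL andbT; apply/geqP.
Qed.

Definition near_next := by_angle [:: H4_top; H4_next] [:: g0; g1; gphi] roots.
Definition near_top := by_angle [:: H4_top] [:: g0; g1] roots.

Lemma H4_cartan_ok : cartan_ok H4_half H4_cartan. Proof. by vm_compute. Qed.
Lemma H4_end : iter 29 (raise H4_cartan) [seq simple 4 i | i <- iota 0 4] = [::].
Proof. by vm_compute. Qed.
Lemma H4_norm r : r \in roots -> gram r r = g2.
Proof.
have /allP H : all (fun r => geq (gram r r) g2) roots by vm_compute.
by move=> /H/geqP.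
Qed.
Lemma H4_sound : sound H4_half H4_cartan 29 ok_H. Proof. by vm_compute. Qed.
Lemma climb_top r : r \in roots -> (climb H4_cartan 60 (r, r)).1 = H4_top.
Proof.
have /allP H : all (fun r => (climb H4_cartan 60 (r, r)).1 == H4_top) roots by vm_compute.
by move=> /H/eqP.
Qed.
Lemma climb_next r s : r \in roots -> s \in roots -> gram r s = gphi ->
  climb H4_cartan 60 (r, s) = (H4_top, H4_next).
Proof.
have /allP H : all (fun r => all (fun s => if geq (gram r s) gphi then
  climb H4_cartan 60 (r, s) == (H4_top, H4_next) else true) roots) roots by vm_compute.
by move=> /H/allP Hr /Hr; case: geqP => // _ /eqP.
Qed.
Lemma H4_top_root : (H4_top \in roots) && (H4_next \in roots). Proof. by vm_compute. Qed.

Lemma H4_search_next : (uniq near_next && bounded ok_next (fun _ _ => true) 120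
  [:: entry H4_next] (map entry near_next) 6).
Proof. by vm_compute. Qed.

Lemma H4_search_flat : (uniq near_top && bounded ok_flat (fun _ _ => true) 120
  [::] (map entry near_top) 7).
Proof. by vm_compute. Qed.

Lemma flat_angle g : g \in [:: g0; g1; gphi] -> g <> gphi -> g \in [:: g0; g1].
Proof. by rewrite !inE => /or3P[->|->|/eqP e]; rewrite ?orbT. Qed.

Lemma ok_flatP C r s : gdot r.1 s.2 \in [:: g0; g1] -> ok_flat C r s.
Proof. by rewrite !inE /ok_flat => /orP[/eqP->|/eqP->]. Qed.

Lemma forall_mem4 (T : eqType) (P : T -> Prop) a b c d : P a -> P b -> P c -> P d ->
  forall x, x \in [:: a; b; c; d] -> P x.
Proof. by move=> Pa Pb Pc Pd x; rewrite !inE => /or4P[] /eqP->. Qed.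

Local Opaque all_roots near_top near_next H4_top H4_next.

Section H4.
Variables (R : realType) (V : vectType R) (dot : {dot V for idfun}).
Variables (Phi : {fset V}) (Phi_root : root_system dot fullv Phi).
Variables (b : 'I_(size H4_cartan) -> V).
Variable (bP : frame dot Phi (@cartan_gram R H4_half H4_cartan) b).
Local Notation ev := (ev b).
Local Notation hits := (hits b).

Let hK := H4_cartan_ok.
Let pos_end := H4_end.

Lemma H4_pattern_free D (r s t u : coords) : convex_free dot Phi D ->
  {subset [:: r; s; t; u] <= roots} -> (forall v, v \in [:: r; s; t; u] -> hits D v) ->
  [:: gram r s; gram r t; gram s t; gram r u; gram s u; gram t u] \in patterns -> False.
Proof.
move=> freeD sub hit.
have dE x y : x \in roots -> y \in roots -> dot (ev x) (ev y) = emb R (gram x y).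
  exact: (root_gram Phi_root hK bP).
have norm x : x \in roots -> dot (ev x) (ev x) = emb R g2.
  by move=> xP; rewrite (dE x x xP xP) H4_norm.
have main (x1 x2 x3 x4 : coords) : {subset [:: x1; x2; x3; x4] <= [:: r; s; t; u]} ->
    dot (ev x1) (ev x4) = emb R gphi -> dot (ev x1) (ev x2) = emb R g1 ->
    dot (ev x1) (ev x3) = emb R g1 -> dot (ev x2) (ev x3) = emb R g1 ->
    dot (ev x2) (ev x4) = emb R g1 -> dot (ev x3) (ev x4) = emb R g1 -> False.
  move=> subx e14 e12 e13 e23 e24 e34.
  pose x (i : 'I_(size pattern_gram)) := ev (nth [::] [:: x1; x2; x3; x4] i).
  have xi (i : 'I_(size pattern_gram)) : nth [::] [:: x1; x2; x3; x4] i \in [:: r; s; t; u].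
    by apply: subx; rewrite mem_nth.
  apply: (@pattern_free _ _ _ _ Phi_root _ freeD x) => [i j|i]; last first.
    by have /asboolP := hit _ (xi i).
  have n1 := norm _ (sub _ (xi (@Ordinal (size pattern_gram) 0 isT))).
  have n2 := norm _ (sub _ (xi (@Ordinal (size pattern_gram) 1 isT))).
  have n3 := norm _ (sub _ (xi (@Ordinal (size pattern_gram) 2 isT))).
  have n4 := norm _ (sub _ (xi (@Ordinal (size pattern_gram) 3 isT))).
  rewrite /x /cartan_gram.
  have e := (n1, n2, n3, n4, (e14, e12, e13), (e23, e24, e34)).
  have e' := (etrans (dotC _ _ _) e14, etrans (dotC _ _ _) e12, etrans (dotC _ _ _) e13,
    (etrans (dotC _ _ _) e23, etrans (dotC _ _ _) e24, etrans (dotC _ _ _) e34)).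
  by case: i => [[|[|[|[|//]]]] ?]; case: j => [[|[|[|[|//]]]] ?]; rewrite [LHS]/= ?(e, e');
    apply: (f_equal (emb R)).
have [rP sP tP uP] : [/\ r \in roots, s \in roots, t \in roots & u \in roots].
  by split; apply: sub; rewrite !in_cons eqxx ?orbT.
move: (dE r s rP sP) (dE r t rP tP) (dE s t sP tP) (dE r u rP uP) (dE s u sP uP) (dE t u tP uP).
rewrite /patterns /= !inE => e1 e2 e3 e4 e5 e6.
move: (etrans (dotC _ _ _) e1) (etrans (dotC _ _ _) e2) (etrans (dotC _ _ _) e3) => f1 f2 f3.
move: (etrans (dotC _ _ _) e4) (etrans (dotC _ _ _) e5) (etrans (dotC _ _ _) e6) => f4 f5 f6.
case/or4P => [||| /or3P[]] /eqP[p1 p2 p3 p4 p5 p6];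
  rewrite ?(p1, p2, p3, p4, p5, p6) in e1 e2 e3 e4 e5 e6 f1 f2 f3 f4 f5 f6.
- by apply: (main r t u s); [by apply/allP; rewrite /= !inE !eqxx ?orbT | assumption ..].
- by apply: (main r s u t); [by apply/allP; rewrite /= !inE !eqxx ?orbT | assumption ..].
- by apply: (main s r u t); [by apply/allP; rewrite /= !inE !eqxx ?orbT | assumption ..].
- by apply: (main r s t u); [by apply/allP; rewrite /= !inE !eqxx ?orbT | assumption ..].
- by apply: (main s r t u); [by apply/allP; rewrite /= !inE !eqxx ?orbT | assumption ..].
- by apply: (main t r s u); [by apply/allP; rewrite /= !inE !eqxx ?orbT | assumption ..].
Qed.

Lemma H4_ok D r s : convex_free dot Phi D -> r \in roots -> s \in roots ->
  hits D r -> hits D s -> r != s -> gram r s \in [:: g0; g1; gphi].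
Proof.
move=> freeD rP sP hr hs rs.
have := compatible Phi_root hK bP H4_sound freeD rP sP hr hs rs.
rewrite /ok_H -/(gram r s) !inE; case: geqP => [-> //|_]; case: geqP => [-> //|_].
by move=> /geqP ->.
Qed.

(** Pairs of roots with inner product [phi] form one orbit under the Weyl group. If
    the free set contains such a pair, it may be assumed to be [H4_top] and
    [H4_next], and then at most six further elements fit; otherwise one element may
    be assumed to be [H4_top], and at most seven others have only inner products
    [0] and [1] with it and each other. *)
Lemma H4_bound D : convex_free dot Phi D -> (#|` D| <= 8)%N.
Proof.
move=> freeD; have [DPhi _ _] := freeD.
have [->|/fset0Pn[a aD]] := eqVneq D fset0; first by rewrite cardfs0.
have [c c0 [r rP rE]] := all_roots_cover Phi_root hK bP pos_end (DPhi a aD).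
have hr : hits D r := mem_hits aD c0 rE.
have sizeP x : x \in roots -> size x = size H4_cartan by case/(all_roots_ray Phi_root hK bP).
have [D1 [free1 <- top1 _]] := climb_free Phi_root hK bP 60 (p := (r, r)) freeD (sizeP r rP) (sizeP r rP) hr hr.
rewrite (climb_top rP) in top1; have [D1Phi _ _] := free1.
have /andP[top_root next_root] := H4_top_root.
have [[x [y [xP yP hx hy xy]]]|flat] := pselect (exists x y, [/\ x \in roots, y \in roots,
    hits D1 x, hits D1 y & gram x y = gphi]).
  have [D2 [free2 <-]] := climb_free Phi_root hK bP 60 (p := (x, y)) free1 (sizeP x xP) (sizeP y yP) hx hy.
  rewrite (climb_next xP yP xy) => top2 next2; have [D2Phi _ _] := free2.
  have sub : {subset near_next <= roots} by move=> z; rewrite mem_by_angle => /andP[].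
  have /andP[next_uniq search] := H4_search_next.
  apply: (clique_count (pre := [:: H4_top; H4_next]) (C := [:: H4_next]) Phi_root hK bP pos_end D2Phi next_uniq sub _ _ _ search).
  - move=> z zP hz; rewrite mem_cat; have [zT|] := boolP (z \in [:: H4_top; H4_next]).
      exact: isT.
    rewrite inE mem_seq1 negb_or => /andP[zt zn]; apply/orP; right.
    rewrite mem_by_angle; apply/and3P; split; first exact: zP.
      exact: H4_ok free2 zP top_root hz top2 zt.
    rewrite andbT; exact: H4_ok free2 zP next_root hz next2 zn.
  - by move=> z; rewrite mem_seq1 => /eqP->; split; [exact: next_root | exact: next2].
  move=> C z t CP zP tP hz ht zt; rewrite /ok_next.
  rewrite (compatible Phi_root hK bP H4_sound free2 zP tP hz ht zt); case: ifP => [//|_].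
  apply/hasPn => p /mapP[u uC ->]; apply/negP => bad.
  have [uP hu] := CP u uC.
  have all4 := forall_mem4 (P := fun v => v \in roots /\ hits D2 v)
    (conj top_root top2) (conj zP hz) (conj tP ht) (conj uP hu).
  apply: (H4_pattern_free free2 _ _ bad) => v v4; [exact: proj1 (all4 v v4) | exact: proj2 (all4 v v4)].
have sub : {subset near_top <= roots} by move=> x; rewrite mem_by_angle => /andP[].
have /andP[top_uniq search] := H4_search_flat.
have flatE x y : x \in roots -> y \in roots -> hits D1 x -> hits D1 y -> x != y ->
    gram x y \in [:: g0; g1].
  move=> xP yP hx hy xy; have := H4_ok free1 xP yP hx hy xy.
  have ne : gram x y <> gphi by move=> e; apply: flat; exists x, y; exact: And5 xP yP hx hy e.
  by move/flat_angle; apply.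
apply: (clique_count (pre := [:: H4_top]) (C := [::]) Phi_root hK bP pos_end D1Phi top_uniq sub _ _ _ search) => [x xP hx|x|C x y _ xP yP hx hy xy].
- rewrite mem_cat; have [xT|] := boolP (x \in [:: H4_top]); first exact: isT.
  rewrite mem_seq1 => xt; apply/orP; right.
  by rewrite mem_by_angle xP /= andbT; exact: flatE xP top_root hx top1 xt.
- by rewrite in_nil.
exact: (@ok_flatP _ (entry x) (entry y) (flatE x y xP yP hx hy xy)).
Qed.
End H4.
End TypeH4.

(** * From the Coxeter matrix to a frame *)

Definition gold_cos2 (m : nat) : gold :=
  match m with 3 => g1 | 4 => g2 | 5 => gadd gphi g1 | _ => g0 end%N.

Definition coxeter_ok (t : coxeter_type) (h : coords) (K : seq coords) : bool :=
  let g i j := gmul (nth g0 h i) (nth g0 (nth [::] K i) j) in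
  let I := iota 0 (size K) in
  all (fun i => all (fun j => geq (g i j) (g j i) && ((i < j)%N ==>
    [&& coxeter_entry t i j \in [:: 2; 3; 4; 5]%N, ~~ gpos (g i j) &
        geq (gmul (gadd g2 g2) (gmul (g i j) (g i j)))
            (gmul (gmul (gold_cos2 (coxeter_entry t i j)) (g i i)) (g j j))])) I) I.

Section Frames.
Variables (R : realType) (V : vectType R) (dot : {dot V for idfun}).
Variables (Phi : {fset V}) (Phi_root : root_system dot fullv Phi).

Lemma emb_cos2 m : emb R (gold_cos2 m) = four_cos2 R m.
Proof.
case: m => [|[|[|[|[|[|m]]]]]]; rewrite /= ?emb0 ?emb1 ?emb2 // emb_add emb1.
by rewrite {1}/emb /= mul1r add0r.
Qed.

Section Coxeter.
Variables (t : coxeter_type) (h : coords) (K : seq coords).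
Variables (D : (size K).-tuple V) (D_simple : simple_system Phi D).
Hypothesis D_type : forall i j : 'I_(size K), (i < j)%N ->
  has_order (reflGL dot (tnth D i) * reflGL dot (tnth D j))%g (coxeter_entry t i j).

Lemma coxeter_frame : cartan_ok h K -> coxeter_ok t h K ->
  exists b, frame dot Phi (@cartan_gram R h K) b.
Proof.
move=> hK tK; have in_iota (i : 'I_(size K)) : (i : nat) \in iota 0 (size K).
  by rewrite mem_iota ltn_ord.
have {}tK (i j : 'I_(size K)) := andP (allP (allP tK i (in_iota i)) j (in_iota j)).
apply: (simple_frame Phi_root D_simple (N := fun i => @cartan_gram R h K i i)) => // [i|i j|i j ij].
- rewrite /cartan_gram emb_mul (cartan_diag R hK) mulr_gt0 //; exact: half_norm_gt0.
- by have [/geqP E _] := tK i j; rewrite /cartan_gram E.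
have [_ /implyP/(_ ij)/and3P[mP npos /geqP E]] := tK i j; split.
  by rewrite leNgt -(gposE R).
exists (coxeter_entry t i j) => //; split; first exact: D_type.
have := congr1 (emb R) E; rewrite !emb_mul emb_cos2 emb_add emb2 /cartan_gram !emb_mul expr2 => <-.
ring.
Qed.
End Coxeter.

Lemma typeA_frame n (D : n.-tuple V) : simple_system Phi D ->
  (forall i j : 'I_n, (i < j)%N ->
    has_order (reflGL dot (tnth D i) * reflGL dot (tnth D j))%g (coxeter_entry (TypeA n) i j)) ->
  exists b, frame dot Phi (@path_gram R n (fun=> 2)) b.
Proof.
move=> D_simple D_type; apply: (simple_frame Phi_root D_simple (N := fun=> 2)) => //.
- by move=> i; rewrite /path_gram eqxx.
- by move=> i j; rewrite /path_gram eq_sym orbC.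
move=> i j ij; have := D_type i j ij; rewrite /path_gram /=.
rewrite [i == j]ltn_eqF // [(i == j.+1 :> nat)]ltn_eqF ?ltnS 1?ltnW // orbF.
case: eqP => _ mij; split; rewrite ?lerN10 //; first by exists 3%N => //=; split=> //; ring.
by exists 2%N => //=; split=> //; ring.
Qed.

Lemma typeB_frame m (D : m.+1.-tuple V) : simple_system Phi D ->
  (forall i j : 'I_m.+1, (i < j)%N ->
    has_order (reflGL dot (tnth D i) * reflGL dot (tnth D j))%g (coxeter_entry (TypeBC m.+1) i j)) ->
  exists b, frame dot Phi (path_gram (@typeB_norm R m)) b.
Proof.
move=> D_simple D_type; apply: (simple_frame Phi_root D_simple (N := @typeB_norm R m)).
- by move=> i; rewrite /typeB_norm; case: ifP.
- by move=> i; rewrite /path_gram eqxx.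
- by move=> i j; rewrite /path_gram eq_sym orbC; case: eqP => // ->.
move=> i j ij; have := D_type i j ij; rewrite /path_gram /=.
rewrite [i == j]ltn_eqF // [(i == j.+1 :> nat)]ltn_eqF ?ltnS 1?ltnW // orbF.
have nij : typeB_norm R i = 2.
  by rewrite /typeB_norm -val_eqE /= ltn_eqF // (leq_trans ij) // -ltnS.
case: eqP => [_|_] mij; last by split=> //; exists 2%N => //=; split=> //; ring.
split; rewrite ?lerN10 //; move: mij; rewrite nij /typeB_norm -val_eqE /=.
by case: eqP => _ mij; [exists 4%N | exists 3%N] => //=; split=> //; ring.
Qed.

Lemma typeD_frame m (D : m.+1.-tuple V) : simple_system Phi D ->
  (forall i j : 'I_m.+1, (i < j)%N ->
    has_order (reflGL dot (tnth D i) * reflGL dot (tnth D j))%g (coxeter_entry (TypeD m.+1) i j)) ->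
  (2 < m)%N -> exists b, frame dot Phi (@typeD_gram R m) b.
Proof.
move=> D_simple D_type m3; apply: (simple_frame Phi_root D_simple (N := fun=> 2)) => //.
- by move=> i; rewrite /typeD_gram eqxx.
- by move=> i j; rewrite /typeD_gram eq_sym orbC.
move=> i j ij; have := D_type i j ij; rewrite /typeD_gram /= -/(typeD_adj m i j).
have -> : typeD_adj m j i = false by rewrite /typeD_adj; lia.
rewrite [i == j]ltn_eqF // orbF.
case: ifP => _ mij; split; rewrite ?lerN10 //; first by exists 3%N => //=; split=> //; ring.
by exists 2%N => //=; split=> //; ring.
Qed.
End Frames.

(** * The exceptional types *)

(** In type E all simple roots are given the squared norm 2. *)
Definition laced_cartan (t : coxeter_type) : seq coords :=
  mkseq (fun i => mkseq (fun j => if i == j then g2 else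
    if coxeter_entry t (minn i j) (maxn i j) == 3 then gm1 else g0) (type_rank t)) (type_rank t).

Definition upper_layer K m (k : nat) (c : gold) : seq coords :=
  [seq r <- pos_roots K m | ~~ gneg (gadd (nth g0 r k) (gopp c))].

(** If the [k]-th coordinate [f] of a root never exceeds [2 c - 1], the roots with
    [c <= f] form a free set: on a positive root [r], the functional
    [p f - q (r, .)] with [p = 3] and [q = 3 c - 1] takes the value
    [3 f r - 2 (3 c - 1) < 0], and if [s] is another root with [c <= f s], then
    [(r, s) <= 1] and its value on [s] is at least [1]. *)
Definition layer_dual h K (k : nat) (p q : gold) (r : coords) : seq coords :=
  [:: [seq gadd (if i == k then p else g0) (gopp (gmul q (nth g0 (covec h K r) i)))
       | i <- iota 0 (size K)]].

Section Exceptional.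
Variables (R : realType) (V : vectType R) (dot : {dot V for idfun}).
Variables (Phi : {fset V}) (Phi_root : root_system dot fullv Phi).

Definition free_max (N : nat) : Prop :=
  (forall D, convex_free dot Phi D -> (#|` D| <= N)%N) /\
  (exists2 D, convex_free dot Phi D & #|` D| = N).

Definition certified_type t h K m (S : seq coords) (cert : coords -> seq coords) : bool :=
  [&& cartan_ok h K, coxeter_ok t h K,
      iter m (raise K) [seq simple (size K) i | i <- iota 0 (size K)] == [::],
      certified K m S cert & size S == type_degree t].

Section Certified.
Variables (t : coxeter_type) (h : coords) (K : seq coords) (m : nat).
Variables (S : seq coords) (cert : coords -> seq coords).
Variables (D : (size K).-tuple V) (D_simple : simple_system Phi D).
Hypothesis D_type : forall i j : 'I_(size K), (i < j)%N ->
  has_order (reflGL dot (tnth D i) * reflGL dot (tnth D j))%g (coxeter_entry t i j).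

Lemma certified_max : certified_type t h K m S cert ->
  (forall b, frame dot Phi (@cartan_gram R h K) b ->
     forall F, convex_free dot Phi F -> (#|` F| <= type_degree t)%N) ->
  free_max (type_degree t).
Proof.
case/and5P => hK tK /eqP pos_end certS /eqP <- upper.
have [b bP] := coxeter_frame Phi_root D_simple D_type hK tK.
split; first exact: upper bP.
exact: (certified_free Phi_root hK bP pos_end certS).
Qed.

Lemma shifted_max : certified_type t h K m S cert ->
  all (fun r => (gram h K r r == g2) && gpos (height r)) (pos_roots K m) ->
  uniq (pos_roots K m) ->
  bounded ok_acute ok_upward (size (pos_roots K m)) [::]
    [seq (r, covec h K r) | r <- rev (pos_roots K m)] (type_degree t) ->
  free_max (type_degree t).
Proof.
move=> certK norms pos_uniq search; apply: certified_max (certK) _ => b bP.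
have [hK _ /eqP pos_end _ _] := and5P certK.
exact: (shifted_bound Phi_root hK bP pos_end norms pos_uniq search).
Qed.

Lemma clique_max ok : certified_type t h K m S cert -> sound h K m ok ->
  uniq (all_roots K m) ->
  bounded (fun _ => ok) (fun _ _ => true) (size (all_roots K m)) [::]
    (map (entry h K) (all_roots K m)) (type_degree t) ->
  free_max (type_degree t).
Proof.
move=> certK okP roots_uniq search; apply: certified_max (certK) _ => b bP.
have [hK _ /eqP pos_end _ _] := and5P certK.
exact: (clique_bound Phi_root hK bP pos_end okP roots_uniq search).
Qed.
End Certified.
End Exceptional.

Delimit Scope Z_scope with coqZ.

Definition const_coords (s : seq Z) : coords := [seq (x, Z0) | x <- s].

(** Free sets of largest size, and functionals, given by their values on the frame,
    such that every positive root is separated by one of them from the rest of the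
    free set; both were found by computer search. *)
Definition F4_roots : seq coords := map const_coords
  [:: [:: 2; 3; 4; 2]; [:: 1; 3; 4; 2]; [:: 1; 2; 4; 2]; [:: 1; 2; 3; 2];
      [:: 1; 2; 3; 1]; [:: 0; 1; 2; 1]]%coqZ.
Definition F4_duals : seq coords := map const_coords
  [:: [:: -1; -7; 6; 0]; [:: -3; 7; -1; -3]; [:: 0; 1; -1; 2]; [:: 3; 0; -1; 1];
      [:: 2; -7; 4; 1]; [:: -5; 7; -3; 1]; [:: -7; 7; 2; -7]; [:: -7; -7; 5; 7];
      [:: -7; 7; -5; 7]]%coqZ.

Definition H3_roots : seq coords :=
  [:: [:: (1, 1); (1, 1); (0, 1)]; [:: (1, 1); (1, 1); (1, 0)];
      [:: (0, 1); (1, 0); (1, 0)]; [:: (0, 1); (1, 0); (0, 0)];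
      [:: (1, 0); (0, 0); (0, 0)]]%coqZ.
Definition H3_duals : seq coords := map const_coords
  [:: [:: 6; -4; -3]; [:: 1; 1; -3]; [:: 2; -1; -2]; [:: 2; -3; 2]; [:: 2; -3; 3];
      [:: -4; 7; 0]; [:: 1; -4; 8]]%coqZ.

Definition H4_roots : seq coords :=
  [:: [:: (2, 3); (2, 4); (1, 3); (0, 2)]; [:: (2, 3); (2, 4); (1, 3); (1, 1)];
      [:: (2, 3); (2, 4); (2, 2); (1, 1)]; [:: (2, 3); (3, 3); (2, 2); (1, 1)];
      [:: (1, 3); (3, 3); (2, 2); (1, 1)]; [:: (1, 3); (2, 3); (2, 2); (1, 1)];
      [:: (1, 3); (2, 3); (1, 2); (1, 1)]; [:: (1, 3); (2, 3); (1, 2); (0, 1)]]%coqZ.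
Definition H4_duals : seq coords := map const_coords
  [:: [:: 6; -1; -1; -8]; [:: 1; 0; -4; 7]; [:: -2; -3; 8; 0]; [:: -2; 5; -1; -6];
      [:: 3; -3; 0; 2]; [:: 1; 3; 0; -10]; [:: 1; -7; 10; 0]; [:: -10; 8; 1; 0];
      [:: 1; 3; -10; 10]; [:: -10; 3; 10; -2]; [:: -8; 9; -5; 4]; [:: -10; -1; 10; 10]]%coqZ.

(** * Largest free sets by type *)

Section Types.
Variables (R : realType) (V : vectType R) (dot : {dot V for idfun}).
Variables (Phi : {fset V}) (Phi_root : root_system dot fullv Phi).

Let g3 : gold := (Zpos 3, Z0).
Let g5 : gold := (Zpos 5, Z0).

Lemma type_max t : type_valid t -> has_type dot Phi t -> free_max dot Phi (type_degree t).
Proof.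
case: t => [n|n|n||||||m||] /= n_ok [D D_simple D_type].
- have [b bP] := typeA_frame Phi_root D_simple D_type; exact: (typeA_max Phi_root bP).
- case: n n_ok D D_simple D_type => [//|m] m_ok D D_simple D_type.
  have [b bP] := typeB_frame Phi_root D_simple D_type; exact: (typeB_max Phi_root bP).
- case: n n_ok D D_simple D_type => [//|m] m_ok D D_simple D_type.
  have [b bP] := typeD_frame Phi_root D_simple D_type m_ok; exact: (typeD_max Phi_root bP m_ok).
- pose K := laced_cartan TypeE6.
  apply: (@shifted_max _ _ _ _ Phi_root TypeE6 (nseq 6 g1) K 11 (upper_layer K 11 0 g1)
    (layer_dual (nseq 6 g1) K 0 g3 g2) D D_simple D_type); by vm_compute.
- pose K := laced_cartan TypeE7.
  apply: (@shifted_max _ _ _ _ Phi_root TypeE7 (nseq 7 g1) K 17 (upper_layer K 17 5 g1)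
    (layer_dual (nseq 7 g1) K 5 g3 g2) D D_simple D_type); by vm_compute.
- pose K := laced_cartan TypeE8.
  apply: (@shifted_max _ _ _ _ Phi_root TypeE8 (nseq 8 g1) K 29 (upper_layer K 29 7 g2)
    (layer_dual (nseq 8 g1) K 7 g3 g5) D D_simple D_type); by vm_compute.
- apply: (@clique_max _ _ _ _ Phi_root TypeF4 F4_half F4_cartan 11 F4_roots (fun=> F4_duals) D
    D_simple D_type ok_F4); by vm_compute.
- exact: (rank2_max Phi_root D_simple).
- exact: (rank2_max Phi_root D_simple).
- apply: (@clique_max _ _ _ _ Phi_root TypeH3 (nseq 3 g1) H3_cartan 9 H3_roots (fun=> H3_duals) D
    D_simple D_type ok_H); by vm_compute.
apply: (@certified_max _ _ _ _ Phi_root TypeH4 H4_half H4_cartan 29 H4_roots (fun=> H4_duals) D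
  D_simple D_type); first by vm_compute.
by move=> b bP F; exact: (H4_bound Phi_root bP).
Qed.

Lemma type_degree_gt0 t : type_valid t -> (0 < type_degree t)%N.
Proof.
case: t => //= n n_ok.
- by rewrite divn_gt0 // (@leq_exp2r 2 _ 2).
- by rewrite addn1.
- by rewrite bin_gt0; lia.
Qed.
End Types.

Theorem theorem10p2 (R : realType) (V : vectType R) (dot : {dot V for idfun})
    (Phi Pos : {fset V}) (hPhi : root_system dot fullv Phi)
    (hPos : positive_system Phi Pos) :
  (irreducible dot Phi ->
     forall t : coxeter_type, type_valid t -> has_type dot Phi t ->
       degree (punctured_weyl dot Phi Pos) = (type_degree t)%:E) /\
  (forall (r : nat) (Phi_ : 'I_r -> {fset V}),
     (0 < r)%N -> orthogonal_union dot Phi_ Phi ->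
     degree (punctured_weyl dot Phi Pos) =
     (\sum_(i < r) degree (punctured_weyl dot (Phi_ i) (Pos `&` Phi_ i)%fset))%E).
Proof.
split=> [_ t t_ok t_type|r Phi_ r0 Phi_union].
  have [maxN exN] := type_max hPhi t_ok t_type.
  exact: (degree_max hPhi hPos (type_degree_gt0 t_ok) maxN exN).
exact: (degree_union Phi_union hPhi hPos r0).
Qed.
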